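(* Suppose $\rho$ is such that $\rho_\eta\equiv\tau^{m_0}\bmod\mathfrak{p}_H$ and let $L=E_\rho^m$ for an integer $m\ge n$. Let $u$ be a unit of $L$ such that $\mu(1-u)>\max\{\frac{nm_0}{q},\frac1{q-1}\}+\frac1{q-1}$. Then $$N_{L|K}(u^{-1})-1\equiv T_{L|K}\Big(\frac{1-u}{u}\Big(1-\frac{g'(v_m)}{u}v_m\Big)\Big)\mod\mathfrak{p}_K^{(n+m)m_0},$$ where $g(X)\in\mathbb{F}_{q_L}[[X]]$ is such that $g(v_m)=u$.
   Context: $K$ is a local field of characteristic $p>0$ with normalized discrete valuation $\mu_K$, valuation ring $\mathcal{O}_K$, maximal ideal $\mathfrak{p}_K$, residue field of order $q$. $\Omega$ is a fixed algebraic closure of $K$, $\mu$ the unique extension of $\mu_K$ to $\Omega$, $\bar\Omega$ the completion of $\Omega$, and $\mathfrak{p}_{\bar\Omega}$ the set of its elements with $\mu>0$. $H\subset\Omega$ is a finite unramified extension of $K$ with valuation ring $\mathcal{O}_H$ and maximal ideal $\mathfrak{p}_H$. $\mathcal{O}_H\{\{\tau\}\}$ is the ring of twisted power series $\sum_{i\ge0}c_i\tau^i$ with $\tau x=x^q\tau$; such a series acts by $x\mapsto\sum c_ix^{q^i}$. A formal Drinfeld module with stable reduction of height one is a ring homomorphism $\rho:\mathcal{O}_K\to\mathcal{O}_H\{\{\tau\}\}$, $a\mapsto\rho_a$, such that the constant coefficient of $\rho_a$ is $a$ and, for a uniformizer $\pi$ of $K$, the coefficient of $\tau$ in $\rho_\pi$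 is a unit of $\mathcal{O}_H$. Fix such a $\rho$. It makes $\mathfrak{p}_{\bar\Omega}$ an $\mathcal{O}_K$-module by $a\cdot_\rho x=\rho_a(x)$. Fix an integer $m_0\ge1$ dividing $[H:K]$ and $\eta\in K$ with $\mu(\eta)=m_0$. For $m\ge1$ let $W_\rho^m=\{\alpha\in\mathfrak{p}_{\bar\Omega}:\rho_{\eta^m}(\alpha)=0\}$ (isomorphic to $\mathcal{O}_K/\mathfrak{p}_K^{mm_0}$ as an $\mathcal{O}_K$-module), let $v_m$ be a generator of $W_\rho^m$, and $E_\rho^m=H(W_\rho^m)=H(v_m)$; $v_m$ is a uniformizer of $E_\rho^m$. $n\ge1$ is a fixed integer. $\mathbb{F}_{q_L}\subset L$ is the residue field of $L$ (embedded in $L$ since $L$ has characteristic $p$), so that every element of the valuation ring of $L$ is uniquely $g(v_m)$ with $g\in\mathbb{F}_{q_L}[[X]]$; $g'$ is the formal derivative. $T_{L|K}$ and $N_{L|K}$ are trace and norm. The congruence $\rho_\eta\equiv\tau^{m_0}\bmod\mathfrak{p}_H$ is coefficientwise. *)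

(* Defs.v *)
From mathcomp Require Import all_boot all_order all_algebra all_field.
From mathcomp Require Import boolp classical_sets constructive_ereal.

Set Implicit Arguments.
Unset Strict Implicit.
Unset Printing Implicit Defensive.

Import Order.TTheory GRing.Theory Num.Theory.
Local Open Scope classical_set_scope.
Local Open Scope ring_scope.

(* Valuations are written additively with values in QQ \cup {+oo}: this is
   enough for the algebraic closure of a discretely valued field and for its
   completion, whose value groups are both QQ. *)
Record is_valuation (F : fieldType) (v : F -> \bar rat) : Prop := {
  val_gtNy : forall x, (-oo < v x)%E;
  val_eqy  : forall x, v x = +oo%E <-> x = 0;
  valM     : forall x y, v (x * y) = (v x + v y)%E;
  valD     : forall x y, (Order.min (v x) (v y) <= v (x + y)%R)%E
}.

Definition val_ring (F : fieldType) (v : F -> \bar rat) : set F :=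
  [set x | (0 <= v x)%E].

Definition val_max (F : fieldType) (v : F -> \bar rat) : set F :=
  [set x | (0 < v x)%E].

(* x = y modulo p_F ^ k, for v a normalized discrete valuation: then p_F ^ k is
   the set of the elements of valuation at least k. *)
Definition val_congr (F : fieldType) (v : F -> \bar rat) (k : nat) (x y : F) :=
  (k%:R%:E <= v (x - y)%R)%E.

Definition vcvg (F : fieldType) (v : F -> \bar rat) (s : nat -> F) (l : F) :=
  forall M : rat, exists N : nat,
    forall i, (N <= i)%N -> (M%:E <= v (s i - l)%R)%E.

Definition vcauchy (F : fieldType) (v : F -> \bar rat) (s : nat -> F) :=
  forall M : rat, exists N : nat,
    forall i j, (N <= i)%N -> (N <= j)%N -> (M%:E <= v (s i - s j)%R)%E.

Definition vcomplete (F : fieldType) (v : F -> \bar rat) :=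
  forall s, vcauchy v s -> exists l, vcvg v s l.

(* The limit of s, with the junk value 0 when s does not converge. *)
Definition vlim (F : fieldType) (v : F -> \bar rat) (s : nat -> F) : F :=
  xget 0 [set l | vcvg v s l].

Definition normalized_discrete (F : fieldType) (v : F -> \bar rat) :=
  (forall x, x != 0 -> exists k : int, v x = k%:~R%:E) /\
  (exists pi, v pi = 1%:E).

(* The residue field has q elements: the sequence r is a set of representatives
   of O_F / p_F, without repetition. *)
Definition residue_order (F : fieldType) (v : F -> \bar rat) (q : nat) :=
  exists r : seq F, [/\ size r = q, uniq r,
    (forall c, c \in r -> val_ring v c) &
    forall x, val_ring v x -> exists! c, c \in r /\ val_max v (x - c)].

Record is_local_field (F : fieldType) (v : F -> \bar rat) (q : nat) : Prop := {
  lf_val      : is_valuation v;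
  lf_discrete : normalized_discrete v;
  lf_complete : vcomplete v;
  lf_residue  : residue_order v q
}.

(* The residue field of F, as a subfield of F: k is a subfield of F contained in
   O_F which reduction modulo p_F maps bijectively onto O_F / p_F. When the
   residue field is finite there is exactly one such k in characteristic p. *)
Definition residue_subfield (F : fieldType) (v : F -> \bar rat) (k : set F) :=
  [/\ divring_closed [in k], k `<=` val_ring v &
      forall x, val_ring v x -> exists! c, k c /\ val_max v (x - c)].

Definition is_algebraic_closure (K : fieldType) (Omega : closedFieldType)
    (iK : {rmorphism K -> Omega}) :=
  forall x : Omega, algebraicOver iK x.

Definition is_completion (F Fbar : fieldType) (v : Fbar -> \bar rat)
    (j : {rmorphism F -> Fbar}) :=
  vcomplete v /\
  forall (x : Fbar) (M : rat), exists y : F, (M%:E <= v (x - j y)%R)%E.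

(* j identifies the extension L of K with a subextension of Omega, itself an
   extension of K through iK. *)
Definition is_Kembedding (K Omega : fieldType) (iK : {rmorphism K -> Omega})
    (L : fieldExtType K) (j : {rmorphism L -> Omega}) :=
  forall a : K, j (a%:A) = iK a.

(* Ramification index 1; residue fields being finite, the residue extension is
   automatically separable. *)
Definition unramified (K : fieldType) (vK : K -> \bar rat)
    (H : fieldExtType K) (vH : H -> \bar rat) :=
  forall x : H, exists a : K, vK a = vH x.

Definition subfield_gen (F : fieldType) (A : set F) : set F :=
  smallest [set E : set F | divring_closed [in E]] A.

Definition ext_trace (K : fieldType) (L : fieldExtType K) (x : L) : K :=
  \tr (passmx.mxof (vbasis {:L}) (vbasis {:L}) (amull x)).

Definition ext_norm (K : fieldType) (L : fieldExtType K) (x : L) : K :=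
  \det (passmx.mxof (vbasis {:L}) (vbasis {:L}) (amull x)).

Definition ps_eval (F : fieldType) (v : F -> \bar rat) (g : nat -> F) (x : F) :=
  vlim v (fun N => \sum_(i < N) g i * x ^+ i).

Definition ps_deriv (F : fieldType) (g : nat -> F) : nat -> F :=
  fun i => g i.+1 *+ i.+1.

(* A twisted power series \sum_i c_i tau^i is given by its coefficients; the
   product comes from tau x = x ^ q tau. *)
Definition tps_tau (F : fieldType) (k : nat) : nat -> F := fun i => (i == k)%:R.

Definition tps_add (F : fieldType) (c d : nat -> F) : nat -> F :=
  fun k => c k + d k.

Definition tps_mul (F : fieldType) (q : nat) (c d : nat -> F) : nat -> F :=
  fun k => \sum_(i < k.+1) c i * d (k - i)%N ^+ (q ^ i).

Definition tps_eval (F : fieldType) (v : F -> \bar rat) (q : nat)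
    (c : nat -> F) (x : F) :=
  vlim v (fun N => \sum_(i < N) c i * x ^+ (q ^ i)).

(* Formal Drinfeld O_K-modules over O_H with stable reduction of height one. The
   values of rho outside O_K are irrelevant. *)
Record is_drinfeld_height1 (K : fieldType) (vK : K -> \bar rat) (q : nat)
    (H : fieldExtType K) (vH : H -> \bar rat) (rho : K -> nat -> H) : Prop := {
  drin_int   : forall a, val_ring vK a -> forall i, val_ring vH (rho a i);
  drin1      : rho 1 =1 tps_tau H 0%N;
  drinD      : forall a b, val_ring vK a -> val_ring vK b ->
                 rho (a + b) =1 tps_add (rho a) (rho b);
  drinM      : forall a b, val_ring vK a -> val_ring vK b ->
                 rho (a * b) =1 tps_mul q (rho a) (rho b);
  drin_const : forall a, val_ring vK a -> rho a 0%N = a%:A;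
  drin_unit  : exists2 pi, vK pi = 1%:E & vH (rho pi 1%N) = 0%E
}.

(* Here and below F is the completion of the algebraic closure, into which the
   coefficients of rho have been mapped. *)
Definition drin_torsion (F : fieldType) (v : F -> \bar rat) (q : nat)
    (K : fieldType) (rho : K -> nat -> F) (a : K) : set F :=
  [set x | val_max v x /\ tps_eval v q (rho a) x = 0].

Definition drin_generator (F : fieldType) (v : F -> \bar rat) (q : nat)
    (K : fieldType) (vK : K -> \bar rat) (rho : K -> nat -> F)
    (W : set F) (x : F) :=
  W x /\ W = [set tps_eval v q (rho a) x | a in val_ring vK].

(* Main.v *)
Require Import Defs.
From HB Require Import structures.
From mathcomp Require Import all_boot all_order all_algebra all_field.
From mathcomp Require Import boolp classical_sets constructive_ereal.
From mathcomp Require Import ring lra zify.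

(** Write M = m m0, Q = q^M, kappa = (n + m) m0, and w for the inverse of u.
    With v = v_m and x' the derivative with respect to v of a series in v, the
    claim is that N(w) - 1 is congruent to T((w - 1)(1 + v w'/w)).

    The torsion points are the roots of a q-polynomial P(X) = X^Q + c_(M-1)
    X^(Q/q) + ... + c_1 X^q + c_0 X, where c_i has valuation at least M - i:
    rho_(pi^M) is a series with unit constant coefficient composed with a
    product of M factors tau + d, each found by a Weierstrass division
    (twisted_weierstrass, torsion_polyS). The conjugates of v over H are the
    roots that are not roots of the similar polynomial of level M - 1. The
    derivative of P is the constant c_0, which is why traces and norms over
    its roots are computable.

    Traces. By Lagrange interpolation the sum of the f(alpha) over the roots
    is c_0 times the top coefficient of f mod P. Modulo c_0, P is a polynomial
    in X^q, so that f mod P has no top coefficient when f is a derivative: the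
    trace of a derivative vanishes modulo c_0^2, hence modulo p_K^kappa since
    n <= m (sum_root_pow, sum_root_deriv).

    Norms. Represent w by a polynomial W congruent to 1 modulo X^h, and factor
    it as a product of 1 - t X. The norm of 1 - t X over the roots of P is the
    reciprocal polynomial of P at t; expanding the product to first order in
    c_0, and using the partial fractions of c_0 / P, one finds that N(w) is
    the norm computed with c_0 = 0, times 1 - T(v w'/w), modulo c_0^2
    (norm_perturbation). The norm computed with c_0 = 0 is the norm of the
    polynomial with q-th power coefficients over a q-polynomial of level M -
    1. There the valuation of u - 1 makes w - 1 divisible by the power n m0 +
    1 of the uniformizer (qpol_divisible), and such a norm is 1 modulo
    p_K^kappa; this last fact is proved by descending through the levels with
    the same device (norm_1add). The level M - 1 part of the roots of P is
    negligible for the same reason.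

    So N(w) - 1 is congruent to -T(v w'/w), and adding T((w - 1)(1 + v w'/w))
    to T(v w'/w) gives the trace of the derivative of v w, minus the trace of
    1: both vanish. This is norm_trace_all; norm_trace_primitive restricts the
    congruence to the conjugates of v.

    It remains to see trace and norm of L over K as sum and product over the
    embeddings of L, grouped by their restriction to H, which preserve
    valuations because K is complete (embedding_isometric,
    embeddings_grouped). This uses that L is separable over K and of degree at
    least Q - Q/q over H, that it has the same residue subfield as H, so that
    truncations of g have coefficients in H, and that 1/u is approximated by
    powers of such truncations (totally_ramified_separable, degree_ge_e,
    residue_sub, approximating_polynomials). *)

Set Implicit Arguments.
Unset Strict Implicit.
Unset Printing Implicit Defensive.

Import Order.TTheory GRing.Theory Num.Theory.
Local Open Scope ring_scope.

(** * Valuations *)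

(** Lower bounds are all that the estimates need; unlike the values of v they
    require no case distinction for the value +oo at 0. *)
Definition vge (F : fieldType) (v : F -> \bar rat) (t : rat) (x : F) : bool :=
  (t%:E <= v x)%E.

Section Valuation.

Variables (F : fieldType) (v : F -> \bar rat).
Hypothesis hv : is_valuation v.

Lemma v0 : v 0 = +oo%E.
Proof. exact/(val_eqy hv). Qed.

Lemma v_fin x : x != 0 -> exists t : rat, v x = t%:E.
Proof.
move=> x0; have := val_gtNy hv x.
case E: (v x) => [t| |//] _; first by exists t.
by move/(val_eqy hv): E x0 => ->; rewrite eqxx.
Qed.

Lemma v1 : v 1 = 0%E.
Proof.
have [t vt] := v_fin (oner_neq0 F).
have := Defs.valM hv 1 1; rewrite mulr1 vt -EFinD => -[] /eqP.
by rewrite -{1}[t]addr0 (inj_eq (addrI t)) eq_sym => /eqP ->.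
Qed.

Lemma vX x n t : v x = t%:E -> v (x ^+ n) = (n%:R * t)%:E.
Proof.
move=> vx; elim: n => [|n IH]; first by rewrite expr0 v1 mul0r.
by rewrite exprS Defs.valM // IH vx -EFinD; congr (_%:E); rewrite -natr1; ring.
Qed.

Lemma v_neq0 x t : v x = t%:E -> x != 0.
Proof. by move=> vx; apply/eqP => x0; rewrite x0 v0 in vx. Qed.

Lemma vV x t : v x = t%:E -> v x^-1 = (- t)%:E.
Proof.
move=> vx; have x0 := v_neq0 vx.
have [s vs] : exists s : rat, v x^-1 = s%:E by apply: v_fin; rewrite invr_eq0.
have := Defs.valM hv x x^-1; rewrite divff // v1 vx vs -EFinD => -[] h.
by congr (_%:E); lra.
Qed.

Lemma vM x y s t : v x = s%:E -> v y = t%:E -> v (x * y) = (s + t)%:E.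
Proof. by move=> vx vy; rewrite Defs.valM // vx vy. Qed.

Lemma vN x : v (- x) = v x.
Proof.
have vN1 : v (- 1) = 0%E.
  have [|t vt] := v_fin (x := -1 : F); first by rewrite oppr_eq0 oner_neq0.
  have := vX 2 vt; rewrite sqrrN expr1n v1 => -[] h.
  by rewrite vt; congr (_%:E); lra.
by rewrite -mulN1r Defs.valM // vN1 add0e.
Qed.

Lemma vge0 t : vge v t 0.
Proof. by rewrite /vge v0 leey. Qed.

Lemma vge1 : vge v 0 1.
Proof. by rewrite /vge v1. Qed.

Lemma vgeE x s t : v x = s%:E -> vge v t x = (t <= s).
Proof. by move=> vx; rewrite /vge vx lee_fin. Qed.

Lemma vgeW s t x : s <= t -> vge v t x -> vge v s x.
Proof. by move=> st; apply: le_trans; rewrite lee_fin. Qed.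

Lemma vgeD t x y : vge v t x -> vge v t y -> vge v t (x + y).
Proof.
move=> gx gy; apply: le_trans (Defs.valD hv x y).
by rewrite le_min; apply/andP.
Qed.

Lemma vgeN t x : vge v t (- x) = vge v t x.
Proof. by rewrite /vge vN. Qed.

Lemma vgeB t x y : vge v t x -> vge v t y -> vge v t (x - y).
Proof. by move=> gx gy; apply: vgeD; rewrite ?vgeN. Qed.

Lemma vge_subC t x y : vge v t (x - y) = vge v t (y - x).
Proof. by rewrite -vgeN opprB. Qed.

Lemma vge_trans t x y z : vge v t (x - y) -> vge v t (y - z) -> vge v t (x - z).
Proof. by move=> xy yz; rewrite -(subrKA y); apply: vgeD. Qed.

Lemma vgeM s t x y : vge v s x -> vge v t y -> vge v (s + t) (x * y).
Proof.
have [->|x0] := eqVneq x 0; first by rewrite mul0r => *; apply: vge0.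
have [->|y0] := eqVneq y 0; first by rewrite mulr0 => *; apply: vge0.
have [a va] := v_fin x0; have [b vb] := v_fin y0.
by rewrite (vgeE _ va) (vgeE _ vb) (vgeE _ (vM va vb)) => *; rewrite lerD.
Qed.

Lemma vgeMl t x y : vge v 0 x -> vge v t y -> vge v t (x * y).
Proof. by move=> gx gy; rewrite -[t]add0r vgeM. Qed.

Lemma vgeMr t x y : vge v t x -> vge v 0 y -> vge v t (x * y).
Proof. by move=> gx gy; rewrite mulrC vgeMl. Qed.

Lemma vgeX n t x : vge v t x -> vge v (n%:R * t) (x ^+ n).
Proof.
move=> gx; elim: n => [|n IH]; first by rewrite mul0r vge1.
by rewrite exprS -natr1 mulrDl mul1r addrC vgeM.
Qed.

Lemma vgeX0 n x : vge v 0 x -> vge v 0 (x ^+ n).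
Proof. by move/(vgeX n); rewrite mulr0. Qed.

Lemma vge_sum (I : Type) (r : seq I) (P : pred I) (f : I -> F) t :
  (forall i, P i -> vge v t (f i)) -> vge v t (\sum_(i <- r | P i) f i).
Proof. by move=> h; elim/big_rec: _ => [|i x Pi]; [exact: vge0|apply/vgeD/h]. Qed.

Lemma vge_sum_seq (I : eqType) (r : seq I) (f : I -> F) t :
  (forall i, i \in r -> vge v t (f i)) -> vge v t (\sum_(i <- r) f i).
Proof. by move=> h; rewrite big_seq; apply: vge_sum => i /h. Qed.

Lemma vgeMn t x n : vge v t x -> vge v t (x *+ n).
Proof.
by move=> gx; elim: n => [|n IH]; rewrite ?mulr0n ?vge0 // mulrS vgeD.
Qed.

Lemma vge_eq0 x : (forall k : nat, vge v k%:R x) -> x = 0.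
Proof.
move=> h; apply/eqP/negP => /negP /v_fin[t vt].
have := h (Num.Def.trunc `|t|).+1; rewrite (vgeE _ vt).
move=> /(lt_le_trans (truncnS_gt `|t|)).
by rewrite ltNge ler_norm.
Qed.

Lemma vge_inv_unit x : v x = 0%E -> vge v 0 x^-1.
Proof. by move/vV; rewrite oppr0 /vge => ->. Qed.

Lemma vge_div_unit t x y : v y = 0%E -> vge v t (x / y) = vge v t x.
Proof.
move=> vy; apply/idP/idP => h; last by apply: vgeMr h _; apply: vge_inv_unit.
rewrite -[x](divfK (v_neq0 vy)); apply: vgeMr h _.
by rewrite (vgeE _ vy).
Qed.

Lemma v_add_lt x y s : v x = s%:E -> (v x < v y)%E -> v (x + y) = v x.
Proof.
move=> vx lt; apply/le_anti/andP; split; last first.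
  by apply: le_trans (Defs.valD hv x y); rewrite le_min lexx ltW.
rewrite leNgt; apply/negP => lt2.
have := Defs.valD hv (x + y) (- y); rewrite addrK vN leNgt lt_min lt2 lt //.
Qed.

Lemma v_1add t x : 0 < t -> vge v t x -> v (1 + x) = 0%E.
Proof.
move=> t0 gx; rewrite (v_add_lt v1) ?v1 //.
by apply: lt_le_trans gx; rewrite lte_fin.
Qed.

Lemma v_gt0P x : (0 < v x)%E -> exists2 t : rat, 0 < t & vge v t x.
Proof.
have [->|/v_fin[t vt]] := eqVneq x 0; first by exists 1; rewrite ?vge0.
by rewrite vt lte_fin => t0; exists t; rewrite // (vgeE _ vt).
Qed.

Lemma vge_gt0 t x : 0 < t -> vge v t x -> (0 < v x)%E.
Proof. by move=> t0; apply: lt_le_trans; rewrite lte_fin. Qed.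

Lemma vge_prod_sub1 t (I : eqType) (r : seq I) (f : I -> F) :
  0 <= t -> (forall i, i \in r -> vge v t (f i - 1)) ->
  vge v t (\prod_(i <- r) f i - 1).
Proof.
move=> t0; elim: r => [|a r IH] h; first by rewrite big_nil subrr vge0.
rewrite big_cons; have h1 := h a (mem_head _ _).
have h2 : vge v t (\prod_(j <- r) f j - 1).
  by apply: IH => i ir; apply: h; rewrite inE ir orbT.
have -> : f a * \prod_(j <- r) f j - 1
  = f a * (\prod_(j <- r) f j - 1) + (f a - 1) by ring.
apply: vgeD => //; apply: vgeMl => //.
by rewrite -[f a](subrK 1) vgeD ?vge1 // (vgeW t0).
Qed.

(** The terms of order two and more have valuation at least 2 M. *)
Lemma vge_prod_first_order M t (I : eqType) (r : seq I) (f : I -> F) :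
  0 <= M -> t <= M + M -> (forall i, i \in r -> vge v M (f i - 1)) ->
  vge v t (\prod_(i <- r) f i - 1 - \sum_(i <- r) (f i - 1)).
Proof.
move=> M0 tM; elim: r => [|a r IH] h.
  by rewrite !big_nil subrr subr0 vge0.
rewrite !big_cons; have h1 := h a (mem_head _ _).
have hr i : i \in r -> vge v M (f i - 1).
  by move=> ir; apply: h; rewrite inE ir orbT.
have h2 := IH hr; have h3 := vge_prod_sub1 M0 hr.
set p := \prod_(j <- r) _; set s := \sum_(j <- r) _.
have -> : f a * p - 1 - (f a - 1 + s) = (f a - 1) * (p - 1) + (p - 1 - s).
  by ring.
by apply: vgeD => //; apply: vgeW tM _; apply: vgeM.
Qed.

Lemma vge_prod (I : eqType) (r : seq I) (f : I -> F) :
  (forall i, i \in r -> vge v 0 (f i)) -> vge v 0 (\prod_(i <- r) f i).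
Proof.
move=> h; rewrite big_seq; elim/big_rec: _ => [|i x /h]; first exact: vge1.
exact: vgeMl.
Qed.

Lemma vge_prod_congr t (I : eqType) (r : seq I) (f g : I -> F) :
  (forall i, i \in r -> vge v 0 (f i)) -> (forall i, i \in r -> vge v 0 (g i)) ->
  (forall i, i \in r -> vge v t (f i - g i)) ->
  vge v t (\prod_(i <- r) f i - \prod_(i <- r) g i).
Proof.
elim: r => [|a r IH] hf hg h; first by rewrite !big_nil subrr vge0.
rewrite !big_cons.
set p := \prod_(j <- r) f j; set s := \prod_(j <- r) g j.
have -> : f a * p - g a * s = (f a - g a) * p + g a * (p - s) by ring.
have sub i : i \in r -> i \in a :: r by rewrite inE orbC => ->.
apply: vgeD; first by apply: vgeMr; [exact/h/mem_head|apply: vge_prod => i /sub/hf].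
apply: vgeMl; first exact/hg/mem_head.
by apply: IH => i /sub; [apply: hf|apply: hg|apply: h].
Qed.

End Valuation.

(** The valuation ring takes the proof that v is a valuation as an argument, so
    that its stability under the ring operations can be inferred from it. *)
Definition vint (F : fieldType) (v : F -> \bar rat) (hv : is_valuation v) :
  {pred F} := [pred x | vge v 0 x].

Section IntegralPolynomials.

Variables (F : fieldType) (v : F -> \bar rat) (hv : is_valuation v).

Fact vint_subring : subring_closed (vint hv).
Proof.
split=> [|x y|x y]; rewrite ?inE; first exact: vge1.
- exact: vgeB.
- exact: vgeMl.
Qed.

End IntegralPolynomials.

HB.instance Definition _ (F : fieldType) (v : F -> \bar rat)
  (hv : is_valuation v) :=
  GRing.isSubringClosed.Build F (vint hv) (vint_subring hv).

Lemma int_horner (F : fieldType) (v : F -> \bar rat) (hv : is_valuation v)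
    (p : {poly F}) x :
  p \is a polyOver (vint hv) -> vge v 0 x -> vge v 0 p.[x].
Proof. by move=> pO xO; have := rpred_horner pO (xO : x \in vint hv). Qed.

(** * Finite extensions of a complete field *)

Lemma vge_lower (F : fieldType) (v : F -> \bar rat) (hv : is_valuation v) x :
  exists D : nat, vge v (- D%:R) x.
Proof.
have [->|/(v_fin hv)[t vt]] := eqVneq x 0; first by exists 0; apply: vge0.
exists (Num.Def.trunc `|t|).+1; rewrite (vgeE _ vt) lerNl.
by apply/ltW/(le_lt_trans _ (truncnS_gt `|t|)); rewrite -normrN ler_norm.
Qed.

Lemma vge_lower_fin (F : fieldType) (v : F -> \bar rat) (hv : is_valuation v)
    k (X : 'I_k -> F) :
  exists D : nat, forall i, vge v (- D%:R) (X i).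
Proof.
have [D hD] := choice (fun i => vge_lower hv (X i)).
exists (\max_i D i)%N => i; apply: vgeW (hD i).
by rewrite lerN2 ler_nat (leq_bigmax i).
Qed.

Section FiniteDimension.

Variables (K : fieldType) (vK : K -> \bar rat).
Hypotheses (hK : is_valuation vK) (cK : vcomplete vK).
Variables (L : fieldExtType K) (vL : L -> \bar rat).
Hypotheses (hL : is_valuation vL) (vKL : forall a : K, vL a%:A = vK a).

Lemma vge_scale s t a x : vge vK s a -> vge vL t x -> vge vL (s + t) (a *: x).
Proof.
by move=> ga gx; rewrite -mulr_algl; apply: vgeM; rewrite // /vge vKL.
Qed.

Lemma cauchy_rate (F : fieldType) (v : F -> \bar rat) (hv : is_valuation v)
    (s : nat -> F) (C : rat) :
  vcomplete v ->
  (forall i j, (i <= j)%N -> vge v (i%:R - C) (s i - s j)) ->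
  exists l, forall i, vge v (i%:R - C) (s i - l).
Proof.
move=> cv hs.
have [M|l hl] := cv s.
  have [N hN] : exists N : nat, M + C <= N%:R.
    exists (Num.Def.trunc `|M + C|).+1.
    by apply/ltW/(le_lt_trans _ (truncnS_gt _)); rewrite ler_norm.
  exists N => i j Ni Nj; wlog ij : i j Ni Nj / (i <= j)%N.
    by move=> H; case/orP: (leq_total i j) => ?; last rewrite -/(vge _ _ _) vge_subC //; apply: H.
  apply: vgeW (hs i j ij); apply: le_trans (_ : N%:R - C <= _); first lra.
  by rewrite lerD2r ler_nat.
exists l => i; have [N hN] := hl (i%:R - C).
apply: vge_trans (hN (maxn N i) (leq_maxl _ _)) => //.
by apply: hs; apply: leq_maxr.
Qed.

(** By induction on the number of vectors. If the first coordinate were not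
    controlled, rescaling it to 1 would give combinations X_0 + sum z_i X_i of
    arbitrarily large valuation; by the induction hypothesis the z_i form Cauchy
    sequences, and their limits give a linear relation. *)
Lemma free_coord_bounded k (X : 'I_k -> L) :
  (forall c : 'I_k -> K, \sum_i c i *: X i = 0 -> forall i, c i = 0) ->
  exists C : nat, forall (c : 'I_k -> K) t,
    vge vL t (\sum_i c i *: X i) -> forall i, vge vK (t - C%:R) (c i).
Proof.
elim: k X => [|k IH] X frX; first by exists 0 => c t _ [].
pose X' i := X (lift ord0 i).
have frX' (c : 'I_k -> K) : \sum_i c i *: X' i = 0 -> forall i, c i = 0.
  move=> c0 i; pose c' j := if unlift ord0 j is Some i then c i else 0.
  have := frX c'; rewrite big_ord_recl /c' unlift_none scale0r add0r.
  move=> /(_ _ (lift ord0 i)); rewrite liftK; apply.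
  by under eq_bigr do rewrite liftK; apply: c0.
have [C' hC'] := IH X' frX'.
have [D hD] := vge_lower_fin hL X.
have [C0 hC0] : exists C0 : nat, forall (c : 'I_k.+1 -> K) t,
    vge vL t (\sum_i c i *: X i) -> vge vK (t - C0%:R) (c ord0).
  apply: contrapT => /forallNP H.
  have {H} H (N : nat) : exists z : 'I_k -> K,
      vge vL N%:R (X ord0 + \sum_i z i *: X' i).
    have /existsNP[c /existsNP[t /not_implyP[gt /negP nge]]] := H N.
    have c0 : c ord0 != 0.
      by apply: contraNneq nge => ->; apply: vge0.
    have [s vs] := v_fin hK c0.
    exists (fun i => (c ord0)^-1 * c (lift ord0 i)).
    have -> : X ord0 + \sum_i ((c ord0)^-1 * c (lift ord0 i)) *: X' i =
        (c ord0)^-1 *: (\sum_i c i *: X i).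
      rewrite big_ord_recl scalerDr scalerA mulVf // scale1r scaler_sumr.
      by congr (_ + _); apply: eq_bigr => i _; rewrite scalerA.
    move: nge; rewrite (vgeE _ vs) -ltNge => lt.
    apply: vgeW (_ : _ <= - s + t) _; first lra.
    by apply: vge_scale => //; rewrite (vgeE _ (vV hK vs)).
  have [z hz] := choice H.
  have cz i : exists l, forall N, vge vK (N%:R - C'%:R) (z N i - l).
    apply: cauchy_rate => // N M NM.
    apply: (hC' (fun i => z N i - z M i) N%:R).
    have -> : \sum_i (z N i - z M i) *: X' i =
       (X ord0 + \sum_i z N i *: X' i) - (X ord0 + \sum_i z M i *: X' i).
      under eq_bigr do rewrite scalerBl.
      by rewrite sumrB; ring.
    by apply: vgeB => //; apply: vgeW (hz M); rewrite ler_nat.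
  have [l hl] := choice cz.
  suff X0 : X ord0 + \sum_i l i *: X' i = 0.
    pose c j := if unlift ord0 j is Some i then l i else 1.
    have := frX c; rewrite big_ord_recl /c unlift_none scale1r.
    move=> /(_ _ ord0); rewrite unlift_none => h.
    suff /h/eqP : X ord0 + \sum_(i < k)
       (match unlift ord0 (lift ord0 i) with Some i => l i | None => 1 end) *: X (lift ord0 i) = 0 by rewrite oner_eq0.
    by under eq_bigr do rewrite liftK.
  apply: (vge_eq0 hL) => N; pose N' := (N + C' + D)%N.
  have -> : X ord0 + \sum_i l i *: X' i =
     (X ord0 + \sum_i z N' i *: X' i) - \sum_i (z N' i - l i) *: X' i.
    have -> : \sum_i (z N' i - l i) *: X' i =
        \sum_i z N' i *: X' i - \sum_i l i *: X' i.
      by rewrite -sumrB; apply: eq_bigr => i _; rewrite scalerBl.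
    by ring.
  apply: vgeB => //; first by apply: vgeW (hz N'); rewrite ler_nat /N'; lia.
  apply: vge_sum => // i _.
  apply: vgeW (_ : _ <= (N'%:R - C'%:R) + - D%:R) _; first by rewrite /N' !natrD; lra.
  by apply: vge_scale; [exact: hl|exact: hD].
exists (C0 + C' + D)%N => c t ct i.
have g0 := hC0 _ _ ct.
have [pC [pC' pD]] : 0 <= C0%:R :> rat /\ 0 <= C'%:R :> rat /\ 0 <= D%:R :> rat.
  by rewrite !ler0n.
case: (unliftP ord0 i) => [j ->|->]; last by apply: vgeW g0; rewrite !natrD; lra.
apply: vgeW (hC' (fun j => c (lift ord0 j)) (t - C0%:R - D%:R) _ j).
  by rewrite !natrD; lra.
have -> : \sum_i c (lift ord0 i) *: X' i = \sum_i c i *: X i - c ord0 *: X ord0.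
  by rewrite big_ord_recl addrC addKr.
apply: vgeB => //; last exact: vge_scale.
by apply: vgeW ct; lra.
Qed.

(** The coordinates of x on a basis are bounded in terms of x. This serves for
    coordinate forms, for endomorphisms and for embeddings. *)
Lemma semilinear_bounded (F : fieldType) (v : F -> \bar rat)
    (hv : is_valuation v) (f : L -> F) :
  {morph f : x y / x + y} ->
  (forall a x t s, vge vK s a -> vge v t (f x) -> vge v (s + t) (f (a *: x))) ->
  exists C : nat, forall x t, vge vL t x -> vge v (t - C%:R) (f x).
Proof.
move=> fD fZ; pose b := vbasis {:L}.
have [D hD] := vge_lower_fin hv (fun i => f b`_i : F) (k := \dim {:L}).
have f0 : f 0 = 0 by apply: (addrI (f 0)); rewrite -fD !addr0.
have [|C hC] := free_coord_bounded (X := fun i : 'I_(\dim {:L}) => b`_i).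
  by move=> c c0; apply/freeP: c0; apply: basis_free (vbasisP _).
exists (C + D)%N => x t gx.
rewrite (coord_vbasis (memvf x)) in gx *.
rewrite (big_morph f fD f0); apply: vge_sum => // i _.
apply: vgeW (_ : _ <= t - C%:R + - D%:R) _; first by rewrite natrD; lra.
by apply: fZ (hD i); apply: (hC _ _ gx).
Qed.

Lemma linear_bounded (f : 'End(L)) :
  exists C : nat, forall x t, vge vL t x -> vge vL (t - C%:R) (f x).
Proof.
apply: semilinear_bounded => // [x y|a x t s ga gx]; first exact: linearD.
by rewrite linearZ; apply: vge_scale.
Qed.

(** A subspace is the kernel of an endomorphism, which is continuous. *)
Lemma subspace_closed (U : {vspace L}) (s : nat -> L) l :
  (forall i, s i \in U) -> vcvg vL s l -> l \in U.
Proof.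
move=> sU sl; pose f : 'End(L) := (\1 - projv U)%VF.
have [C hC] := linear_bounded f.
have fE x : f x = x - projv U x by rewrite add_lfunE opp_lfunE id_lfunE.
suff : f l = 0.
  by rewrite fE => /eqP; rewrite subr_eq0 => /eqP ->; apply: memv_proj.
apply: (vge_eq0 hL) => N; have [k /(_ k (leqnn k)) hk] := sl (N + C)%:R.
have := hC _ _ hk; rewrite linearB /= vge_subC //.
have -> : f (s k) = 0 by rewrite fE projv_id // subrr.
by rewrite subr0; apply: vgeW; rewrite natrD; lra.
Qed.

Lemma finite_ext_complete : vcomplete vL.
Proof.
move=> s sc; pose b := vbasis {:L}.
have cb (i : 'I_(\dim {:L})) : exists C : nat, forall x t, vge vL t x ->
    vge vK (t - C%:R) (coord b i x).
  apply: semilinear_bounded => // [x y|a x t r ga gx]; first exact: linearD.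
  by rewrite linearZ; apply: vgeM.
have lb (i : 'I_(\dim {:L})) : exists l, vcvg vK (fun k => coord b i (s k)) l.
  apply: cK => M; have [C hC] := cb i; have [N hN] := sc (M + C%:R).
  exists N => j k Nj Nk; have := hC _ _ (hN j k Nj Nk).
  by rewrite linearB /= addrK.
have [l hl] := choice lb.
exists (\sum_i l i *: b`_i) => M.
have [D hD] := vge_lower_fin hL (fun i : 'I_(\dim {:L}) => b`_i).
have [N hN] := choice (fun i => hl i (M + D%:R)).
exists (\max_i N i)%N => k kN.
rewrite {1}(coord_vbasis (memvf (s k))) -sumrB.
apply: vge_sum => // i _; rewrite -scalerBl.
rewrite -[M](addrK D%:R); apply: vge_scale => //; apply: hN.
by apply: leq_trans kN; apply: leq_bigmax.
Qed.

(** The valuation of a complete field extends uniquely: a ring morphism over K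
    is bounded, and boundedness applied to high powers is an isometry. *)
Lemma embedding_isometric (F : fieldType) (v : F -> \bar rat)
    (hv : is_valuation v) (f : {rmorphism L -> F}) :
  (forall a : K, v (f a%:A) = vK a) -> forall x, v (f x) = vL x.
Proof.
move=> fK.
have [|a x t s ga gx|C hC] := semilinear_bounded hv (f := f).
- exact: rmorphD.
- by rewrite -mulr_algl rmorphM; apply: vgeM => //; rewrite /vge fK.
have le x r s : vL x = r%:E -> v (f x) = s%:E -> r <= s.
  move=> vx vfx; rewrite leNgt; apply/negP => lt.
  pose n := (Num.Def.trunc `|C%:R / (r - s)|).+1.
  have hn : C%:R / (r - s) < n%:R.
    by apply: le_lt_trans (truncnS_gt _); rewrite ler_norm.
  rewrite ltr_pdivrMr ?subr_gt0 // in hn.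
  have := hC (x ^+ n) (n%:R * r).
  rewrite rmorphXn (vgeE _ (vX hL n vx)) (vgeE _ (vX hv n vfx)) lexx.
  by move/(_ isT); rewrite leNgt => /negP; apply; lra.
move=> x; have [->|x0] := eqVneq x 0; first by rewrite rmorph0 !v0.
have [r vr] := v_fin hL x0.
have [|s vs] := v_fin hv (x := f x); first by rewrite fmorph_eq0.
rewrite vr vs; congr (_%:E); apply/le_anti; rewrite (le _ _ _ vr vs) andbT.
rewrite -lerN2; apply: (le x^-1); rewrite ?fmorphV; exact: vV.
Qed.

End FiniteDimension.

(** * Twisted power series *)

Section FrobeniusPower.

Variables (F : fieldType) (p q : nat).
Hypotheses (pF : p \in [pchar F]) (q0 : (0 < q)%N).

(** Over infinitely many points, additivity of the q-th power on the lines 1 + b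
    is the polynomial identity (1 + X)^q = 1 + X^q. *)
Lemma additive_power_pnat (b : nat -> F) :
  injective b -> (forall i, (1 + b i) ^+ q = 1 + b i ^+ q) -> [pchar F].-nat q.
Proof.
move=> binj hb.
have E : (1 + 'X) ^+ q = 1 + 'X^q :> {poly F}.
  apply/eqP; rewrite -subr_eq0; apply/negPn/negP => n0.
  set f := (_ - _) in n0.
  have := max_poly_roots n0 (rs := [seq b i | i <- iota 0 (size f)]).
  rewrite size_map size_iota ltnn map_inj_uniq // iota_uniq.
  suff -> : all (root f) [seq b i | i <- iota 0 (size f)] by move/(_ isT isT).
  apply/allP => _ /mapP[i _ ->]; rewrite /root /f !hornerE /=.
  by rewrite hb subrr.
have qp1 : (q`_p^' = 1)%N.
  apply/eqP; rewrite eqn_leq part_gt0 andbT leqNgt; apply/negP => lt1.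
  set d := (q`_p)%N; set e := (q`_p^')%N in lt1.
  have dq : (d * e = q)%N by rewrite partnC.
  have d0 : (0 < d)%N by rewrite part_gt0.
  have dpi : [pchar F].-nat d.
    by rewrite (eq_pnat _ (pcharf_eq pF)); apply: part_pnat.
  have E2 : (1 + 'X^d) ^+ e = 1 + 'X^q :> {poly F}.
    rewrite -E -dq exprM; congr (_ ^+ e).
    by rewrite exprDn_pchar ?expr1n // (eq_pnat _ (pchar_poly F)).
  have := congr1 (fun f : {poly F} => f`_d) E2.
  have -> : (1 + 'X^d) ^+ e = ((1 + 'X) ^+ e) \Po 'X^d :> {poly F}.
    by rewrite rmorphXn rmorphD rmorph1 /= comp_polyX.
  rewrite coef_comp_poly_Xn // dvdnn divnn d0 coefD coefXn coef1.
  have -> : ((1 + 'X) ^+ e : {poly F})`_1 = e%:R.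
    rewrite -[LHS]mulr1n -coef_deriv -horner_coef0 deriv_exp derivD derivX derivC.
    by rewrite add0r mul1r hornerMn horner_exp !hornerE expr1n.
  have ltdq : (d < q)%N by rewrite -dq ltn_Pmulr.
  rewrite (ltn_eqF ltdq) (gtn_eqF d0) addr0 => /eqP e0.
  have : (p %| e)%N by rewrite (dvdn_pcharf pF).
  have : p^'.-nat e by apply: part_pnat.
  by rewrite p'natE ?(pcharf_prime pF) // => /negbTE ->.
rewrite (eq_pnat _ (pcharf_eq pF)) -(partnC p q0) qp1 muln1.
exact: part_pnat.
Qed.

End FrobeniusPower.

Section Limits.

Variables (F : fieldType) (v : F -> \bar rat).
Hypotheses (hv : is_valuation v) (cv : vcomplete v).

Lemma rat_ltn (t : rat) : exists N : nat, t < N%:R.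
Proof.
exists (Num.Def.trunc `|t|).+1.
by apply: le_lt_trans (truncnS_gt _); rewrite ler_norm.
Qed.

Lemma vcvg_unique (s : nat -> F) l l' : vcvg v s l -> vcvg v s l' -> l = l'.
Proof.
move=> h h'; apply/eqP; rewrite -subr_eq0; apply/eqP/(vge_eq0 hv) => k.
have [N hN] := h k%:R; have [N' hN'] := h' k%:R.
rewrite vge_subC //; apply: (vge_trans hv (y := s (maxn N N'))); last first.
  by apply: hN; apply: leq_maxl.
by rewrite vge_subC //; apply: hN'; apply: leq_maxr.
Qed.

Lemma vlimE (s : nat -> F) l : vcvg v s l -> vlim v s = l.
Proof.
move=> h; apply: xget_unique => // l' h'; exact: vcvg_unique h' h.
Qed.

Lemma telescope_cvg (s : nat -> F) :
  (forall k, vge v k%:R (s k.+1 - s k)) -> exists l, forall i, vge v i%:R (s i - l).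
Proof.
move=> hs; have [|l hl] := @cauchy_rate F v hv s 0 cv.
  move=> i j ij; rewrite subr0 vge_subC // -(subnK ij).
  elim: (j - i)%N => [|k IH]; first by rewrite add0n subrr vge0.
  rewrite addSn; apply: vge_trans IH => //; apply: vgeW (hs _).
  by rewrite ler_nat leq_addl.
by exists l => i; have := hl i; rewrite subr0.
Qed.

(** Right division of a twisted power series of height one by some tau + d: d and
    the coefficients of the quotient r solve a system of fixed-point equations
    whose iteration gains one in valuation at each step. *)
Lemma twisted_weierstrass q (f : nat -> F) :
  (1 < q)%N -> (forall i, vge v 0 (f i)) -> vge v 1 (f 0%N) -> v (f 1%N) = 0%E ->
  exists d (r : nat -> F), [/\ vge v 1 d, forall i, vge v 0 (r i), v (r 0%N) = 0%E,
    f 0%N = r 0%N * d & forall i, f i.+1 = r i + r i.+1 * d ^+ (q ^ i.+1)].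
Proof.
move=> q1 fO f0 f1.
pose step (x : F * (nat -> F)) :=
  (f 0%N / x.2 0%N, fun i => f i.+1 - x.2 i.+1 * x.1 ^+ (q ^ i.+1)).
pose x k := iter k step (0, fun i => f i.+1).
have xS k : x k.+1 = step (x k) by [].
have qi i : (1 < q ^ i.+1)%N by rewrite -(exp1n i.+1) ltn_exp2r.
have pow_ge d n : vge v 1 d -> vge v n%:R (d ^+ n).
  by move/(vgeX hv n); rewrite mulr1.
have inv k : [/\ vge v 1 (x k).1, forall i, vge v 0 ((x k).2 i) &
    v ((x k).2 0%N) = 0%E].
  elim: k => [|k [d1 rO r0]]; first by split=> [|i|] /=; [apply: vge0|apply: fO|].
  have small i : vge v 1 ((x k).2 i.+1 * (x k).1 ^+ (q ^ i.+1)).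
    apply: vgeMl => //; apply: vgeW (pow_ge _ _ d1).
    by rewrite ler1n ltnW.
  rewrite xS; split=> /=.
  - by rewrite vge_div_unit.
  - by move=> i; apply: vgeB => //; apply: vgeW (small i).
  rewrite (v_add_lt hv f1) ?f1 // vN //.
  exact: vge_gt0 (small 0%N).
have pow_lip k d d' j : vge v 1 d -> vge v 1 d' -> vge v k (d - d') -> (1 < j)%N ->
    vge v (k + 1) (d ^+ j - d' ^+ j).
  move=> gd gd' gdd; case: j => // j j1; rewrite subrXX; apply: vgeM => //.
  apply: vge_sum => // i _; apply: vgeW (_ : _ <= (j.+1.-1 - i)%:R + i%:R) _.
    by rewrite -natrD subnK ?ler1n // -ltnS.
  by apply: vgeM => //; apply: pow_ge.
have contr k : vge v (k.+1)%:R ((x k.+1).1 - (x k).1) /\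
    forall i, vge v (k.+1)%:R ((x k.+1).2 i - (x k).2 i).
  elim: k => [|k [hd hr]].
    split; first by rewrite /= subr0 vge_div_unit.
    move=> i /=; rewrite expr0n expn_eq0 /= (gtn_eqF (ltnW q1)) /= mulr0 subr0.
    by rewrite subrr; apply: vge0.
  have [d1 rO r0] := inv k.+1; have [d1' rO' r0'] := inv k.
  rewrite xS [x k.+1 in X in _ - X]xS [x k.+1 in X in forall i, vge _ _ (_ - X i)]xS.
  split=> [|i] /=.
    have n0 := v_neq0 hv r0; have n0' := v_neq0 hv r0'.
    have -> : f 0%N / (x k.+1).2 0%N - f 0%N / (x k).2 0%N =
      f 0%N * - ((x k.+1).2 0%N - (x k).2 0%N) / (x k.+1).2 0%N / (x k).2 0%N.
      by field; rewrite ?n0 ?n0'.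
    rewrite !vge_div_unit // mulrC -natr1; apply: vgeM => //.
    by rewrite vgeN.
  set r := (x k.+1).2 i.+1; set r' := (x k).2 i.+1.
  set d := (x k.+1).1; set d' := (x k).1; set j := (q ^ i.+1)%N.
  have -> : f i.+1 - r * d ^+ j - (f i.+1 - r' * d' ^+ j) =
     - ((r - r') * d ^+ j + r' * (d ^+ j - d' ^+ j)) by ring.
  rewrite vgeN // -natr1; apply: vgeD => //.
    apply: vgeM; rewrite // /r /r'; first exact: hr.
    by apply: vgeW (pow_ge _ _ d1); rewrite ler1n ltnW // qi.
  by apply: vgeMl => //; [apply: rO'|apply: pow_lip => //; apply: qi].
have [d hd] : exists d, forall k, vge v k%:R ((x k).1 - d).
  apply: telescope_cvg => k; apply: vgeW (contr k).1.
  by rewrite ler_nat.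
have /choice[r hr] i : exists ri, forall k, vge v k%:R ((x k).2 i - ri).
  apply: telescope_cvg => k; apply: vgeW ((contr k).2 i).
  by rewrite ler_nat.
have d1 : vge v 1 d.
  have [h _ _] := inv 1%N; rewrite -[d](subrK (x 1%N).1) vgeD // vge_subC //.
  exact: hd.
have rO i : vge v 0 (r i).
  have [_ h _] := inv 0%N; rewrite -[r i](subrK ((x 0%N).2 i)) vgeD // vge_subC //.
  exact: hr.
have r0 : v (r 0%N) = 0%E.
  have [_ _ h] := inv 1%N; rewrite -h -[r 0%N](subrK ((x 1%N).2 0%N)) addrC.
  rewrite (v_add_lt hv h) // h; apply: (@vge_gt0 _ _ 1) => //.
  by rewrite vge_subC //; apply: (hr 0%N 1%N).
exists d, r; split=> //.
  apply/eqP; rewrite -subr_eq0; apply/eqP/(vge_eq0 hv) => k.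
  have [dk rOk r0k] := inv k.
  have -> : f 0%N = (x k).2 0%N * (x k.+1).1.
    by rewrite xS /= mulrC divfK // (v_neq0 hv r0k).
  have -> : (x k).2 0%N * (x k.+1).1 - r 0%N * d =
    ((x k).2 0%N - r 0%N) * (x k.+1).1 + r 0%N * ((x k.+1).1 - d) by ring.
  apply: vgeD => //; first by apply: vgeMr => //; have [h _ _] := inv k.+1; apply: vgeW h.
  by apply: vgeMl => //; apply: vgeW (hd k.+1); rewrite ler_nat.
move=> i; apply/eqP; rewrite -subr_eq0; apply/eqP/(vge_eq0 hv) => k.
have [dk rOk r0k] := inv k; set j := (q ^ i.+1)%N.
have -> : f i.+1 = (x k.+1).2 i + (x k).2 i.+1 * (x k).1 ^+ j.
  by rewrite xS /= subrK.
have -> : (x k.+1).2 i + (x k).2 i.+1 * (x k).1 ^+ j - (r i + r i.+1 * d ^+ j) =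
  ((x k.+1).2 i - r i) + (((x k).2 i.+1 - r i.+1) * (x k).1 ^+ j
  + r i.+1 * ((x k).1 ^+ j - d ^+ j)) by ring.
apply: vgeD => //; first by apply: vgeW (hr i k.+1); rewrite ler_nat.
apply: vgeD => //; first by apply: vgeMr => //; apply: vgeW (pow_ge _ _ dk).
by apply: vgeMl => //; apply: vgeW (_ : _ <= k%:R + 1) _; rewrite ?lerDl //; apply: pow_lip => //; apply: qi.
Qed.

End Limits.

Section FrobeniusMorphism.

Variables (R : comNzRingType) (q : nat).
Hypotheses (q1 : (1 < q)%N) (qR : [pchar R].-nat q).

Lemma frobD i : {morph (fun x : R => x ^+ (q ^ i)) : x y / x + y}.
Proof. by move=> x y; rewrite exprDn_pchar // pnatX qR. Qed.

Lemma frobB i : {morph (fun x : R => x ^+ (q ^ i)) : x y / x - y}.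
Proof. by move=> x y; rewrite frobD exprNn_pchar // pnatX qR. Qed.

Lemma frob_sum i (I : Type) (r : seq I) (P : pred I) (f : I -> R) :
  (\sum_(j <- r | P j) f j) ^+ (q ^ i) = \sum_(j <- r | P j) f j ^+ (q ^ i).
Proof.
by rewrite (big_morph _ (frobD i) (expr0n _ _)) // expn_eq0 (gtn_eqF (ltnW q1)).
Qed.

End FrobeniusMorphism.

Section Evaluation.

Variables (F : fieldType) (v : F -> \bar rat) (q : nat).
Hypotheses (hv : is_valuation v) (cv : vcomplete v).
Hypotheses (q1 : (1 < q)%N) (qF : [pchar F].-nat q).

(** Sums of twisted power series are recorded with the rate at which the partial
    sums converge, which is what the composition of two series needs. *)
Definition tps_lim (f : nat -> F) (x l : F) :=
  forall t N, 0 < t -> vge v t x ->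
    vge v ((q ^ N)%:R * t) (\sum_(i < N) f i * x ^+ (q ^ i) - l).

Lemma tps_lim_cvg f x l : (0 < v x)%E -> tps_lim f x l ->
  vcvg v (fun N => \sum_(i < N) f i * x ^+ (q ^ i)) l.
Proof.
move=> /(v_gt0P hv)[t t0 gx] h M; have [N hN] := rat_ltn (M / t).
exists N => i Ni; apply: vgeW (h t i t0 gx).
rewrite ltr_pdivrMr // in hN; apply: ltW; apply: lt_le_trans hN _.
by rewrite ler_pM2r // ler_nat (leq_trans Ni) // ltnW // ltn_expl.
Qed.

Lemma tps_lim_eval f x l : (0 < v x)%E -> tps_lim f x l -> tps_eval v q f x = l.
Proof. by move=> vx h; apply: (vlimE hv); apply: tps_lim_cvg. Qed.

Lemma tps_lim_unique f x l l' :
  (0 < v x)%E -> tps_lim f x l -> tps_lim f x l' -> l = l'.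
Proof. by move=> vx /(tps_lim_eval vx) <- /(tps_lim_eval vx). Qed.

Lemma tps_tail (f : nat -> F) x t N M : (forall i, vge v 0 (f i)) -> 0 < t -> vge v t x ->
  (N <= M)%N -> vge v ((q ^ N)%:R * t)
    (\sum_(i < M) f i * x ^+ (q ^ i) - \sum_(i < N) f i * x ^+ (q ^ i)).
Proof.
move=> fO t0 gx NM; rewrite -(subnK NM) addnC big_split_ord /= addrAC subrr add0r.
apply: vge_sum => // i _; apply: vgeMl => //.
apply: vgeW (vgeX hv _ gx); rewrite ler_pM2r // ler_nat leq_exp2l //.
exact: leq_addr.
Qed.

Lemma tps_lim_ex (f : nat -> F) x : (forall i, vge v 0 (f i)) -> (0 < v x)%E ->
  exists l, tps_lim f x l.
Proof.
move=> fO /(v_gt0P hv)[t t0 gx].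
have rate (M t' : rat) : 0 < t' ->
    exists N : nat, forall i, (N <= i)%N -> M <= (q ^ i)%:R * t'.
  move=> t'0; have [N hN] := rat_ltn (M / t'); exists N => i Ni.
  rewrite ltr_pdivrMr // in hN; apply: ltW; apply: lt_le_trans hN _.
  by rewrite ler_pM2r // ler_nat (leq_trans Ni) // ltnW // ltn_expl.
have [M|l hl] := cv (s := fun N => \sum_(i < N) f i * x ^+ (q ^ i)).
  have [N hN] := rate M _ t0; exists N => i j Ni Nj.
  wlog ji : i j Ni Nj / (j <= i)%N.
    move=> H; case/orP: (leq_total j i) => ?; first exact: H.
    by rewrite -/(vge _ _ _) vge_subC //; apply: H.
  by apply: vgeW (hN j Nj) _; apply: tps_tail.
exists l => t' N t'0 gx'.
have [N1 h1] := hl ((q ^ N)%:R * t').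
apply: (vge_trans hv) (h1 (maxn N N1) (leq_maxr _ _)).
by rewrite vge_subC //; apply: tps_tail => //; apply: leq_maxl.
Qed.

Lemma tps_lim_ge f x l t : 0 < t -> vge v t x -> tps_lim f x l -> vge v t l.
Proof.
by move=> t0 gx /(_ t 0%N t0 gx); rewrite big_ord0 sub0r vgeN // mul1r.
Qed.

Lemma tps_lim_gt0 f x l : (0 < v x)%E -> tps_lim f x l -> (0 < v l)%E.
Proof.
by move=> /(v_gt0P hv)[t t0 gx] /(tps_lim_ge t0 gx); apply: vge_gt0.
Qed.

Lemma tps_lim_0 f : tps_lim f 0 0.
Proof.
move=> t N _ _; rewrite subr0 big1 ?vge0 // => i _.
by rewrite expr0n expn_eq0 (gtn_eqF (ltnW q1)) mulr0.
Qed.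

(** At a point of valuation t > 0 the linear term has valuation t and all the
    other terms have valuation at least q t. *)
Lemma tps_lim_unit_eq0 f x : v (f 0%N) = 0%E -> (0 < v x)%E ->
  tps_lim f x 0 -> x = 0.
Proof.
move=> f0 vx h; apply/eqP/negP => /negP /(v_fin hv)[t vt].
have t0 : 0 < t by rewrite vt lte_fin in vx.
have := h t 1%N t0; rewrite (vgeE _ vt) lexx => /(_ isT).
rewrite big_ord1 expn0 expr1 subr0 (vgeE _ (vM hv f0 vt)) add0r expn1.
by rewrite leNgt => /negP; apply; rewrite ltr_pMl // ltr1n.
Qed.

Lemma sum_triangle (G : nat -> nat -> F) N :
  \sum_(k < N) \sum_(i < k.+1) G i (k - i)%N = \sum_(i < N) \sum_(j < N - i) G i j.
Proof.
elim: N => [|N IH]; first by rewrite !big_ord0.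
rewrite big_ord_recr IH [RHS]big_ord_recr /= [X in _ + X = _]big_ord_recr /=.
rewrite addrA -big_split /=; congr (_ + _).
  by apply: eq_bigr => i _; rewrite (subSn (ltnW (ltn_ord i))) big_ord_recr.
by rewrite subSnn subnn big_ord1.
Qed.

(** In the term of degree i the argument y is needed to the order N - i only: the
    q^i-th power turns a precision q^(N-i) into q^N. *)
Lemma tps_lim_mul (f g : nat -> F) x y z : (forall i, vge v 0 (f i)) ->
  tps_lim g x y -> tps_lim f y z -> tps_lim (tps_mul q f g) x z.
Proof.
move=> fO hg hf t N t0 gx; have gy := tps_lim_ge t0 gx hg.
apply: (vge_trans hv) (hf t N t0 gy).
have -> : \sum_(k < N) tps_mul q f g k * x ^+ (q ^ k) =
    \sum_(k < N) \sum_(i < k.+1) f i * (g (k - i)%N * x ^+ (q ^ (k - i))) ^+ (q ^ i).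
  apply: eq_bigr => k _; rewrite mulr_suml; apply: eq_bigr => i _.
  rewrite -mulrA exprMn -exprM -expnD subnK //.
  by rewrite -ltnS.
rewrite (sum_triangle (fun i j => f i * (g j * x ^+ (q ^ j)) ^+ (q ^ i))) -sumrB.
apply: vge_sum => // i _; rewrite -mulr_sumr -mulrBr -(frob_sum q1 qF) -(frobB qF).
apply: vgeMl => //; have := vgeX hv (q ^ i) (hg t (N - i)%N t0 gx).
by rewrite mulrA -natrM -expnD subnKC // ltnW.
Qed.

(** Here f is the twisted product of r and tau + d. *)
Lemma tps_lim_factor (f r : nat -> F) d x z :
  (forall i, vge v 0 (r i)) -> vge v 0 d -> f 0%N = r 0%N * d ->
  (forall i, f i.+1 = r i + r i.+1 * d ^+ (q ^ i.+1)) ->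
  tps_lim r (x ^+ q + d * x) z -> tps_lim f x z.
Proof.
move=> rO dO f0 fS hr.
pose g i : F := if i is 0%N then d else (i == 1%N)%:R.
have hg : tps_lim g x (x ^+ q + d * x).
  move=> t N t0 gx; have gq : vge v (q%:R * t) (x ^+ q) by apply: vgeX.
  case: N => [|[|N]].
  - rewrite big_ord0 sub0r vgeN // mul1r; apply: vgeD => //; last exact: vgeMl.
    by apply: vgeW gq; apply: ler_peMl; [exact: ltW|rewrite ler1n ltnW].
  - rewrite big_ord1 expn0 expr1 /= opprD addrCA subrr addr0 vgeN // expn1.
  - rewrite 2!big_ord_recl /= big1 ?addr0 => [|i _]; last by rewrite mul0r.
    by rewrite mul1r expn0 expr1 expn1 [_ + x ^+ q]addrC subrr; apply: vge0.
suff -> : f = tps_mul q r g by apply: tps_lim_mul hr.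
apply: funext => -[|i]; first by rewrite /tps_mul big_ord1 subnn expr1 f0.
rewrite /tps_mul big_ord_recr /= subnn /= big_ord_recr /= subSnn expr1n mulr1.
rewrite big1 ?add0r ?fS // => j _.
have -> : g (i.+1 - j)%N = 0.
  have := ltn_ord j; case E: (i.+1 - j)%N => [|[|k]] //=; lia.
by rewrite expr0n expn_eq0 (gtn_eqF (ltnW q1)) mulr0.
Qed.

End Evaluation.

(** * Norms modulo q-polynomials *)

Section Determinants.

Variables (F : fieldType) (v : F -> \bar rat) (hv : is_valuation v).

Lemma det_congr t n (A B : 'M[F]_n) :
  (forall i j, vge v 0 (A i j)) -> (forall i j, vge v 0 (B i j)) ->
  (forall i j, vge v t (A i j - B i j)) -> vge v t (\det A - \det B).
Proof.
move=> hA hB hAB; rewrite /determinant -sumrB; apply: vge_sum => // s _.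
rewrite -mulrBr; apply: vgeMl => //; last by apply: vge_prod_congr.
by apply: vgeX0; rewrite // vgeN // vge1.
Qed.

Lemma mx_exp_congr t n (A B : 'M[F]_n.+1) k :
  (forall i j, vge v 0 (A i j)) -> (forall i j, vge v 0 (B i j)) ->
  (forall i j, vge v t (A i j - B i j)) ->
  (forall i j, vge v 0 ((A ^+ k) i j)) /\
  (forall i j, vge v t ((A ^+ k) i j - (B ^+ k) i j)).
Proof.
move=> hA hB hAB; elim: k => [|k [IH1 IH2]].
  rewrite !expr0; split=> i j; last by rewrite subrr vge0.
  by rewrite !mxE; case: (_ == _); rewrite ?vge1 ?vge0.
rewrite !exprSr; split=> i j; rewrite !mxE.
  by apply: vge_sum => // l _; apply: vgeMl.
rewrite -sumrB; apply: vge_sum => // l _.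
have -> : (A ^+ k) i l * A l j - (B ^+ k) i l * B l j =
  (A ^+ k) i l * (A l j - B l j) + ((A ^+ k) i l - (B ^+ k) i l) * B l j by ring.
by apply: vgeD => //; [apply: vgeMl|apply: vgeMr].
Qed.

Lemma horner_mx_sum n (A : 'M[F]_n.+1) (f : {poly F}) :
  horner_mx A f = \sum_(i < size f) f`_i *: A ^+ i.
Proof.
rewrite -{1}[f]coefK poly_def linear_sum /=; apply: eq_bigr => i _.
by rewrite linearZ /= rmorphXn /= horner_mx_X.
Qed.

Lemma horner_mx_congr t n (A B : 'M[F]_n.+1) (f : {poly F}) :
  f \is a polyOver (vint hv) ->
  (forall i j, vge v 0 (A i j)) -> (forall i j, vge v 0 (B i j)) ->
  (forall i j, vge v t (A i j - B i j)) ->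
  (forall i j, vge v 0 (horner_mx A f i j)) /\
  (forall i j, vge v t (horner_mx A f i j - horner_mx B f i j)).
Proof.
move=> /polyOverP fO hA hB hAB; rewrite !horner_mx_sum.
split=> i j; rewrite !summxE; last rewrite -sumrB.
  apply: vge_sum => // k _; rewrite mxE; apply: vgeMl => //; first exact: fO.
  by have [] := mx_exp_congr k hA hB hAB.
apply: vge_sum => // k _; rewrite !mxE -mulrBr; apply: vgeMl => //; first exact: fO.
by have [] := mx_exp_congr k hA hB hAB.
Qed.

Lemma companion_char_poly (P : {poly F}) d :
  P \is monic -> size P = d.+2 ->
  char_poly (\matrix_(i < d.+1, j < d.+1)
     (if i == d :> nat then - P`_j else (i.+1 == j :> nat)%:R)) = P.
Proof.
move=> Pm sP; have := companionmxK Pm; rewrite /companionmx /=.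
by rewrite sP.
Qed.

End Determinants.

Lemma prod_scale_seq (R : comNzRingType) (I : Type) (r : seq I) (c : R) (f : I -> R) :
  \prod_(i <- r) (c * f i) = c ^+ size r * \prod_(i <- r) f i.
Proof. by rewrite big_split /= big_const_seq count_predT iter_mulr_1. Qed.

(** Both sides are multiplicative in f, and for linear f this is the definition
    of the characteristic polynomial. *)
Lemma det_horner_mx (F : closedFieldType) d (C : 'M[F]_d.+1) (rs : seq F)
    (f : {poly F}) :
  char_poly C = \prod_(x <- rs) ('X - x%:P) ->
  \det (horner_mx C f) = \prod_(x <- rs) f.[x].
Proof.
move=> charC; have srs : size rs = d.+1.
  by have := size_char_poly C; rewrite charC size_prod_XsubC => -[].
have detB z : \det (C - z%:M) = \prod_(x <- rs) (x - z).
  have -> : C - z%:M = - 1 *: (z%:M - C) by rewrite scaleN1r opprB.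
  rewrite detZ; have -> : \det (z%:M - C) = (char_poly C).[z].
    rewrite /char_poly -horner_evalE -det_map_mx; congr (\det _).
    apply/matrixP => i j; rewrite !mxE /= /horner_eval hornerD hornerN hornerC.
    by rewrite hornerMn hornerX.
  rewrite charC horner_prod -srs -prod_scale_seq.
  by apply: eq_bigr => x _; rewrite hornerXsubC; ring.
have [zs ->] := closed_field_poly_normal f; set c := lead_coef f.
rewrite linearZ detZ /=; under [RHS]eq_bigr do rewrite hornerZ.
rewrite prod_scale_seq srs; congr (_ * _).
under [RHS]eq_bigr do rewrite horner_prod.
rewrite exchange_big /= rmorph_prod /=.
elim: zs => [|z zs IH]; first by rewrite !big_nil det1.
rewrite !big_cons [LHS]det_mulmx IH; congr (_ * _).
rewrite rmorphB /= horner_mx_X horner_mx_C detB.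
by apply: eq_bigr => x _; rewrite hornerXsubC.
Qed.

Definition qpol (F : fieldType) (q : nat) (c : nat -> F) (s : nat) : {poly F} :=
  'X^(q ^ s) + \sum_(i < s) c i *: 'X^(q ^ i).

Lemma map_qpol (F G : fieldType) (f : {rmorphism F -> G}) q (c : nat -> F) s :
  map_poly f (qpol q c s) = qpol q (f \o c) s.
Proof.
rewrite /qpol rmorphD rmorph_sum /= map_polyXn; congr (_ + _).
by apply: eq_bigr => i _; rewrite /= map_polyZ map_polyXn.
Qed.

Section QPolynomials.

Variables (F : fieldType) (v : F -> \bar rat) (q : nat).
Hypotheses (hv : is_valuation v) (q1 : (1 < q)%N) (qF : [pchar F].-nat q).
Variable (pi : F).
Hypothesis (pi1 : v pi = 1%:E).
Implicit Types (c : nat -> F) (s : nat) (x : F).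

Lemma qpow_gt0 i : (0 < q ^ i)%N. Proof. by rewrite expn_gt0 ltnW. Qed.

Lemma qpow_lt i j : (i < j)%N -> (q ^ i < q ^ j)%N.
Proof. by move=> ij; rewrite ltn_exp2l. Qed.

Lemma size_qpol_low c s : (size (\sum_(i < s) c i *: 'X^(q ^ i))%R <= q ^ s)%N.
Proof.
apply: (leq_trans (size_sum _ _ _)); apply/bigmax_leqP => i _.
by apply: (leq_trans (size_scale_leq _ _)); rewrite size_polyXn qpow_lt.
Qed.

Lemma size_qpol c s : size (qpol q c s) = (q ^ s).+1.
Proof. by rewrite size_polyDl size_polyXn // ltnS size_qpol_low. Qed.

Lemma qpol_monic c s : qpol q c s \is monic.
Proof.
apply/monicP; rewrite lead_coefDl ?lead_coefXn // size_polyXn ltnS.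
exact: size_qpol_low.
Qed.

Lemma horner_qpol c s x :
  (qpol q c s).[x] = x ^+ (q ^ s) + \sum_(i < s) c i * x ^+ (q ^ i).
Proof.
rewrite hornerD hornerXn horner_sum; congr (_ + _).
by apply: eq_bigr => i _; rewrite hornerZ hornerXn.
Qed.

(** The condition satisfied by the composite of s polynomials X^q + d X with d
    of positive integral valuation. *)
Definition level c s := forall i, (i < s)%N -> vge v (s - i)%:R (c i).

Lemma level_int c s i : level c s -> (i < s)%N -> vge v 0 (c i).
Proof. by move=> lc /lc; apply: vgeW. Qed.

Lemma qpol_int c s : level c s -> qpol q c s \is a polyOver (vint hv).
Proof.
move=> lc; apply: rpredD; first exact: polyOverXn.
apply: rpred_sum => i _; apply: polyOverZ; last exact: polyOverXn.
exact: level_int lc (ltn_ord i).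
Qed.

Lemma deriv_qpol c s : (0 < s)%N -> (qpol q c s)^`() = (c 0%N)%:P.
Proof.
have dX i : (0 < i)%N -> ('X^(q ^ i))^`() = 0 :> {poly F}.
  move=> i0; rewrite derivXn -mulr_natr; suff -> : (q ^ i)%:R = 0 :> {poly F} by rewrite mulr0.
  rewrite natrX; suff -> : q%:R = 0 :> {poly F} by rewrite expr0n gtn_eqF.
  have [p pr pq] : exists2 p, p \in [pchar F] & (p %| q)%N.
    exists (pdiv q); last exact: pdiv_dvd.
    by apply: (pnatPpi qF); rewrite pi_pdiv.
  by apply/eqP; rewrite -(dvdn_pcharf (p := p)) // pchar_poly.
case: s => // s _; rewrite derivD dX // add0r linear_sum big_ord_recl /=.
rewrite derivZ derivX alg_polyC big1 ?addr0 // => i _.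
by rewrite derivZ dX // scaler0.
Qed.

(** The derivative of a q-polynomial is its linear coefficient. *)
Lemma qpol_uniq_roots c s (rs : seq F) : ((0 < s)%N -> c 0%N != 0) ->
  qpol q c s = \prod_(x <- rs) ('X - x%:P) -> uniq rs.
Proof.
case: s => [_ E|s c0 E].
  have := size_qpol c 0; rewrite E size_prod_XsubC expn0 => -[].
  by case: rs {E} => [|x []].
rewrite -separable_prod_XsubC -E separable_poly.unlock deriv_qpol //.
by rewrite -alg_polyC coprimepZr ?coprimep1 // c0.
Qed.

(** The inequality behind the count of weights in the next lemma: reducing the
    exponent q^s to q^(s-k) costs at most k times the cost of reducing it to
    q^(s-1). *)
Lemma pow_geom k : (q ^ k.+1 <= k * (q - 1) * q ^ k + q)%N.
Proof.
elim: k => [|k IH]; first by rewrite expn1.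
have := qpow_gt0 k; rewrite !expnS in IH *; nia.
Qed.

(** Modulo a q-polynomial of level s, a power of the variable of weight at least
    r + 1/(q-1) is divisible by the r-th power of the uniformizer: the monomial
    of exponent q ^ i gains s - i in valuation. *)
Lemma qpol_divisible c s : level c s -> forall r h,
  (q ^ s * (1 + r * (q - 1)) <= q * h)%N ->
  exists2 y : {poly F}, y \is a polyOver (vint hv) &
    forall x, root (qpol q c s) x -> x ^+ h = pi ^+ r * y.[x].
Proof.
move=> lc r; elim/ltn_ind: r => -[|r] IH h hr.
  by exists 'X^h => [|x _]; rewrite ?polyOverXn // mul1r hornerXn.
have hs : (q ^ s <= h)%N.
  rewrite -(leq_pmul2l (ltnW q1)); apply: leq_trans hr.
  by rewrite mulnC leq_mul2l; apply/orP; right; nia.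
have piO : vge v 0 pi by rewrite (vgeE _ pi1).
have piX k : v (pi ^+ k) = k%:R%:E by rewrite (vX hv k pi1) mulr1.
have step (i : 'I_s) : exists y : {poly F}, y \is a polyOver (vint hv) /\
    forall x, root (qpol q c s) x ->
      c i * x ^+ (h - q ^ s + q ^ i) = pi ^+ r.+1 * y.[x].
  set k := (s - i)%N; have k0 : (0 < k)%N by rewrite subn_gt0.
  pose c' := c i / pi ^+ k; have pik := v_neq0 hv (piX k).
  have ci : c i = pi ^+ k * c' by rewrite /c'; field.
  have c'O : c' \in vint hv.
    rewrite inE /= -[0](subrr k%:R); apply: vgeM => //; first exact: lc.
    by rewrite (vgeE _ (vV hv (piX k))).
  have [rk|kr] := leqP r.+1 k.
    exists ((pi ^+ (k - r.+1) * c') *: 'X^(h - q ^ s + q ^ i)); split.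
      apply: polyOverZ; last exact: polyOverXn.
      by apply: rpredM => //; apply: rpredX.
    move=> x _; rewrite hornerZ hornerXn ci -{1}(subnKC rk) exprD; ring.
  have [||y yO hy] := IH (r.+1 - k)%N _ (h - q ^ s + q ^ i)%N; first by lia.
    have e : (q ^ s = q ^ i * q ^ k)%N by rewrite -expnD subnKC // ltnW.
    have g := pow_geom k.
    have {g} : (q ^ i * q ^ k.+1 <= q ^ i * (k * (q - 1) * q ^ k + q))%N by rewrite leq_mul2l g orbT.
    move: hr hs; rewrite e expnS; set a := (q ^ i)%N; set b := (q ^ k)%N.
    rewrite -{1}(subnK (ltnW kr)); move: (r.+1 - k)%N (q - 1)%N => r' Q1 hr hs g.
    move: hr; rewrite -{1}(subnKC hs); move: (h - a * b)%N => h' hr.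
    nia.
  exists (c' *: y); split; first exact: polyOverZ.
  move=> x rx; rewrite hornerZ ci -mulrA [c' * _]mulrC mulrA hy // mulrA.
  rewrite -[pi ^+ k * _ * _]mulrA; have -> : pi ^+ r.+1 = pi ^+ k * pi ^+ (r.+1 - k).
    by rewrite -exprD subnKC // ltnW.
  ring.
have [y hy] := choice step.
exists (- \sum_i y i).
  by rewrite rpredN; apply: rpred_sum => i _; have [] := hy i.
move=> x rx; rewrite hornerN horner_sum mulrN mulr_sumr.
have -> : \sum_(i < s) pi ^+ r.+1 * (y i).[x] = \sum_(i < s) c i * x ^+ (q ^ i) * x ^+ (h - q ^ s).
  apply: eq_bigr => i _; have [_ <-] := hy i; rewrite // exprD; ring.
rewrite -mulr_suml -{1}(subnKC hs) exprD -mulNr; congr (_ * _).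
by apply/eqP; rewrite -addr_eq0 -horner_qpol.
Qed.

End QPolynomials.

Section Norms.

Variables (F : closedFieldType) (v : F -> \bar rat) (q : nat).
Hypotheses (hv : is_valuation v) (q1 : (1 < q)%N) (qF : [pchar F].-nat q).
Implicit Types (c : nat -> F) (s : nat) (x : F).

Definition frobp (f : {poly F}) : {poly F} := \poly_(i < size f) f`_i ^+ q.

Lemma frobp_int (f : {poly F}) :
  f \is a polyOver (vint hv) -> frobp f \is a polyOver (vint hv).
Proof.
move=> /polyOverP fO; apply/polyOverP => i; rewrite coef_poly.
by case: ifP => _; rewrite ?rpred0 // rpredX.
Qed.

Lemma frobp_horner (f : {poly F}) x : (frobp f).[x ^+ q] = f.[x] ^+ q.
Proof.
rewrite [in RHS]horner_coef; have := frob_sum q1 qF 1 (index_enum 'I_(size f)) xpredT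
  (fun i : 'I_(size f) => f`_i * x ^+ i); rewrite expn1 => ->.
rewrite horner_poly; apply: eq_bigr => i _.
by rewrite exprMn -!exprM mulnC.
Qed.

Lemma qth_root_exists x : exists y, y ^+ q = x.
Proof.
have [|y /rootP hy] := closed_rootP ('X^q - x%:P) _.
  by rewrite size_XnsubC ?(ltnW q1) // eqSS -lt0n ltnW.
by exists y; apply/eqP; rewrite -subr_eq0 -hy !hornerE.
Qed.

(** Without linear term, P(X) = B(X^q) with B a q-polynomial of one level less; the
    d are the q-th roots of the roots of B. *)
Lemma qpol_frob_roots c s : c 0%N = 0 -> exists ds : seq F,
  [/\ qpol q c s.+1 = \prod_(d <- ds) ('X - d%:P) ^+ q,
      qpol q (fun i => c i.+1) s = \prod_(d <- ds) ('X - (d ^+ q)%:P) &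
      size ds = (q ^ s)%N].
Proof.
move=> c0; set B := qpol q _ s.
have [gs] := closed_field_poly_normal B.
rewrite (monicP (qpol_monic q1 _ _)) scale1r => hB.
have [root_q hq] := choice qth_root_exists.
exists [seq root_q g | g <- gs]; split.
- have -> : qpol q c s.+1 = B \Po 'X^q.
    rewrite /B /qpol big_ord_recl c0 scale0r add0r comp_polyD comp_Xn_poly -exprM -expnS.
    congr (_ + _); rewrite linear_sum; apply: eq_bigr => i _ /=.
    by rewrite comp_polyZ comp_Xn_poly -exprM -expnS.
  rewrite hB rmorph_prod big_map; apply: eq_bigr => g _ /=.
  rewrite comp_polyB comp_polyX comp_polyC -{1}[g]hq rmorphXn.
  have /= qP : [pchar {poly F}].-nat q by rewrite (eq_pnat _ (pchar_poly F)).
  by rewrite exprDn_pchar // exprNn_pchar.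
- by rewrite hB big_map; apply: eq_bigr => g _; rewrite hq.
- rewrite size_map; have := size_qpol q1 (fun i => c i.+1) s.
  by rewrite -/B hB size_prod_XsubC => -[].
Qed.

Lemma qpol_root_int c s x : level v c s -> root (qpol q c s) x -> vge v 0 x.
Proof.
move=> lc /rootP; rewrite horner_qpol => /eqP; rewrite addr_eq0 => /eqP e.
have [->|x0] := eqVneq x 0; first exact: vge0.
have [t vt] := v_fin hv x0; rewrite (vgeE _ vt) leNgt; apply/negP => t0.
have := vX hv (q ^ s) vt; rewrite e vN //.
move=> vs; have : vge v ((q ^ s)%:R * t + (- t)) (\sum_(i < s) c i * x ^+ (q ^ i)).
  apply: vge_sum => // i _; apply: vgeMl => //.
    exact: level_int lc (ltn_ord i).
  rewrite (vgeE _ (vX hv _ vt)) -subr_ge0.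
  have : (q ^ i)%:R + 1 <= (q ^ s)%:R :> rat by rewrite natr1 ler_nat qpow_lt.
  nra.
by rewrite (vgeE _ vs); lra.
Qed.

(** Dropping the linear term of the q-polynomial, of valuation s, changes the norm by a multiple of
    that term and of t; what remains is the norm of 1 + t^q y^(q) at level
    s - 1, and q >= 2 pays for the lost level. *)
Lemma norm_1add s : forall c (rs : seq F) (y : {poly F}) (t : F) (r : nat),
  level v c s -> qpol q c s = \prod_(x <- rs) ('X - x%:P) ->
  y \is a polyOver (vint hv) -> (0 < r)%N -> vge v r%:R t ->
  vge v (r + s)%:R (\prod_(x <- rs) (1 + t * y.[x]) - 1).
Proof.
elim: s => [|s IH] c rs y t r lc hP yO r0 gt.
  rewrite addn0; apply: vge_prod_sub1 => // x xrs; rewrite addrAC subrr add0r.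
  apply: vgeMr => //; apply: int_horner => //; apply: qpol_root_int lc _.
  by rewrite hP root_prod_XsubC.
pose c' i := if i is 0%N then 0 else c i.
have lc' : level v c' s.+1 by move=> [|i] hi; [apply: vge0|apply: lc].
have [ds [hP' hB sds]] := qpol_frob_roots (c := c') s erefl.
have [d qd] : exists d, (q ^ s.+1 = d.+1)%N.
  by exists (q ^ s.+1).-1; rewrite prednK // qpow_gt0.
pose cm (P : {poly F}) := \matrix_(i < d.+1, j < d.+1)
     (if i == d :> nat then - P`_j else (i.+1 == j :> nat)%:R).
have charP k : char_poly (cm (qpol q k s.+1)) = qpol q k s.+1.
  by apply: companion_char_poly; rewrite ?qpol_monic // size_qpol // qd.
have cmO k : level v k s.+1 -> forall i j, vge v 0 (cm (qpol q k s.+1) i j).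
  move=> lk i j; rewrite mxE; case: ifP => _; last first.
    by case: (_ == _); rewrite ?vge1 ?vge0.
  by rewrite vgeN //; apply: (polyOverP (qpol_int q hv lk)).
have cmB i j : vge v (s.+1)%:R (cm (qpol q c s.+1) i j - cm (qpol q c' s.+1) i j).
  rewrite !mxE; case: ifP => _; last by rewrite subrr vge0.
  rewrite -opprD vgeN // -coefB.
  have -> : qpol q c s.+1 - qpol q c' s.+1 = c 0%N *: 'X.
    rewrite /qpol !big_ord_recl /= scale0r add0r opprD addrACA subrr add0r.
    by rewrite addrK.
  rewrite coefZ coefX; apply: vgeMr => //; first by apply: vgeW (lc 0%N _).
  by case: (_ == _); rewrite ?vge1 ?vge0.
pose f := 1 + t *: y.
have fE x : f.[x] = 1 + t * y.[x] by rewrite !hornerE.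
have NP : \det (horner_mx (cm (qpol q c s.+1)) f) = \prod_(x <- rs) (1 + t * y.[x]).
  rewrite (det_horner_mx (rs := rs)) ?charP //.
  by apply: eq_bigr => x _; rewrite fE.
have NP' : \det (horner_mx (cm (qpol q c' s.+1)) f) =
    \prod_(d <- ds) (1 + t ^+ q * (frobp y).[d ^+ q]).
  rewrite (det_horner_mx (rs := flatten [seq nseq q d | d <- ds])); last first.
    rewrite charP hP' big_flatten big_map; apply: eq_bigr => e _.
    by rewrite big_nseq iter_mulr_1.
  rewrite big_flatten big_map; apply: eq_bigr => e _; rewrite big_nseq iter_mulr_1.
  rewrite fE frobp_horner -exprMn exprDn_pchar // expr1n //.
rewrite -NP; have [h1 h2] := horner_mx_congr yO (cmO _ lc) (cmO _ lc') cmB.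
have [h3 _] := horner_mx_congr yO (cmO _ lc') (cmO _ lc) (t := 0) (fun i j =>
  vgeB hv (cmO _ lc' i j) (cmO _ lc i j)).
have fmx A i j : horner_mx A f i j = (i == j)%:R + t * horner_mx A y i j :> F.
  by rewrite rmorphD rmorph1 /= horner_mxZ !mxE.
have tO : vge v 0 t by apply: vgeW gt.
have fO A : (forall i j, vge v 0 (horner_mx A y i j)) ->
    forall i j : 'I_d.+1, vge v 0 (horner_mx A f i j).
  move=> hA i j; rewrite fmx; apply: vgeD => //; last exact: vgeMl.
  by case: (_ == _); rewrite ?vge1 ?vge0.
apply: (vge_trans hv) (_ : vge v _ (\det (horner_mx (cm (qpol q c' s.+1)) f) - 1)).
  apply: det_congr => // [i j|i j|i j]; rewrite ?fO //.
  rewrite !fmx opprD addrACA subrr add0r -mulrBr natrD.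
  exact: vgeM.
rewrite NP'; apply: vgeW (_ : _ <= (q * r + s)%:R) _.
  by rewrite ler_nat; nia.
rewrite -(big_map (fun d => d ^+ q) xpredT (fun g => 1 + t ^+ q * (frobp y).[g])).
apply: (IH (fun i => c i.+1)).
- by move=> i hi; apply: vgeW (lc i.+1 _); rewrite ?subSS.
- by rewrite hB big_map.
- exact: frobp_int.
- by rewrite muln_gt0 ltnW.
- by rewrite natrM; apply: vgeX.
Qed.

End Norms.

(** * Traces over the roots of a q-polynomial *)

Section PowerSums.

Variables (F : fieldType) (v : F -> \bar rat) (q : nat).
Hypotheses (hv : is_valuation v) (q1 : (1 < q)%N) (qF : [pchar F].-nat q).
Variables (c : nat -> F) (s : nat) (rs : seq F).
Hypotheses (s0 : (0 < s)%N) (urs : uniq rs).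
Hypothesis (Prs : qpol q c s = \prod_(x <- rs) ('X - x%:P)).

Let P := qpol q c s.
Let quo (x : F) := P %/ ('X - x%:P).

Let rs_root x : x \in rs -> root P x.
Proof. by move=> xrs; rewrite /P Prs root_prod_XsubC. Qed.

Let quoE x : x \in rs -> P = quo x * ('X - x%:P).
Proof. by move/rs_root => rx; rewrite divpK // dvdp_XsubCl. Qed.

Let size_rs : size rs = (q ^ s)%N.
Proof. by have := size_qpol q1 c s; rewrite Prs size_prod_XsubC => -[]. Qed.

(** Lagrange interpolation of c_0 X^j at the roots, where the derivative of the
    q-polynomial is the constant c_0. *)
Lemma lagrange_qpol j : (j < q ^ s)%N ->
  \sum_(x <- rs) x ^+ j *: quo x = c 0%N *: 'X^j.
Proof.
move=> jQ; apply/eqP; rewrite -subr_eq0; apply/negPn/negP => n0.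
set f := _ - _ in n0.
have sf : (size f <= q ^ s)%N.
  apply: (leq_trans (size_polyD _ _)); rewrite geq_max size_polyN; apply/andP; split.
    apply: (leq_trans (size_sum _ _ _)); apply/bigmax_leqP_seq => x xrs _.
    apply: (leq_trans (size_scale_leq _ _)).
    by rewrite size_divp ?polyXsubC_eq0 // size_XsubC size_qpol //= subn1.
  by apply: (leq_trans (size_scale_leq _ _)); rewrite size_polyXn.
have := max_poly_roots n0 (rs := rs); rewrite urs size_rs.
suff -> : all (root f) rs by move=> /(_ isT isT); rewrite ltnNge sf.
apply/allP => y yrs; rewrite /root /f hornerD hornerN hornerZ hornerXn horner_sum.
rewrite (bigD1_seq y) //= big1_seq => [|x /andP[xy xrs]]; last first.
  have : (quo x).[y] * (y - x) = 0.
    by rewrite -hornerXsubC -hornerM -quoE //; apply/eqP/rs_root.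
  move/eqP; rewrite mulf_eq0 subr_eq0 [y == x]eq_sym (negbTE xy) orbF => /eqP h.
  by rewrite hornerZ h mulr0.
rewrite addr0 hornerZ.
have -> : (quo y).[y] = c 0%N.
  have := deriv_qpol q1 qF c s0; rewrite -/P {1}(quoE yrs) derivM derivXsubC mulr1.
  move/(congr1 (fun g => g.[y])); rewrite !hornerE subrr mulr0 add0r => ->.
  by [].
by rewrite mulrC subrr.
Qed.

Lemma sum_root_pow_low j : (j < q ^ s)%N ->
  \sum_(x <- rs) x ^+ j = c 0%N *+ (j.+1 == (q ^ s)%N).
Proof.
move=> jQ; have := congr1 (fun f : {poly F} => f`_(q ^ s).-1) (lagrange_qpol jQ).
rewrite coefZ coefXn coef_sum => e; rewrite -mulr_natr.
have -> : (j.+1 == (q ^ s)%N) = ((q ^ s).-1 == j).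
  by rewrite -[in LHS](prednK (qpow_gt0 q1 s)) eqSS eq_sym.
rewrite -e big_seq [RHS]big_seq; apply: eq_bigr => x xrs; rewrite coefZ.
suff -> : (quo x)`_(q ^ s).-1 = 1 by rewrite mulr1.
have sq : size (quo x) = (q ^ s)%N.
  by rewrite size_divp ?polyXsubC_eq0 // size_XsubC size_qpol //= subn1.
have := lead_coef_Mmonic (quo x) (monicXsubC x).
rewrite -(quoE xrs) (monicP (qpol_monic q1 c s)) lead_coefE sq => <- //.
Qed.

(** The interpolation of the constant c_0, evaluated at z, is the partial fraction
    decomposition of c_0 / P. *)
Lemma sum_inv_root z : (forall x, x \in rs -> z != x) ->
  \sum_(x <- rs) (P.[z] / (z - x)) = c 0%N.
Proof.
move=> hz; have := congr1 (fun f : {poly F} => f.[z]) (lagrange_qpol (qpow_gt0 q1 s)).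
rewrite horner_sum expr0 hornerZ hornerC mulr1 => <-.
rewrite big_seq [RHS]big_seq; apply: eq_bigr => x xrs.
rewrite scale1r {1}(quoE xrs) hornerM hornerXsubC mulfK // subr_eq0.
exact: hz.
Qed.

Lemma card_roots_eq0 : (size rs)%:R = 0 :> F.
Proof.
have -> : (size rs)%:R = \sum_(x <- rs) x ^+ 0 :> F.
  by rewrite -sum1_size natr_sum.
rewrite sum_root_pow_low ?qpow_gt0 // ltn_eqF // -[1%N](expn0 q).
by rewrite ltn_exp2l.
Qed.

Variable C : rat.
Hypotheses (lc : level v c s) (C0 : 0 <= C) (c0C : vge v C (c 0%N)).

(** The traces of the powers are multiples of c_0, and of its square unless q
    divides the exponent plus one: modulo c_0 the exponents that occur in a
    reduction are congruent modulo q. *)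
Lemma sum_root_pow j :
  vge v C (\sum_(x <- rs) x ^+ j) /\
  (~~ (q %| j.+1)%N -> vge v (C + C) (\sum_(x <- rs) x ^+ j)).
Proof.
elim/ltn_ind: j => j IH; have [jQ|Qj] := ltnP j (q ^ s)%N.
  rewrite sum_root_pow_low //; split; first exact: vgeMn.
  case: eqP => [->|_ _]; last by rewrite mulr0n vge0.
  by rewrite dvdn_exp.
pose k := (j - q ^ s)%N; have jE : j = (k + q ^ s)%N by rewrite subnK.
have -> : \sum_(x <- rs) x ^+ j =
    - \sum_(i < s) c i * \sum_(x <- rs) x ^+ (k + q ^ i).
  under [in RHS]eq_bigr do rewrite mulr_sumr.
  rewrite exchange_big -sumrN /= big_seq [RHS]big_seq; apply: eq_bigr => x xrs.
  have /rootP := rs_root xrs; rewrite horner_qpol => /eqP; rewrite addr_eq0 => /eqP h.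
  rewrite jE exprD h mulrN mulr_sumr; congr (- _).
  by apply: eq_bigr => i _; rewrite exprD; ring.
have lt (i : 'I_s) : (k + q ^ i < j)%N.
  by rewrite [ltnRHS]jE ltn_add2l qpow_lt.
split=> [|nq]; rewrite vgeN //; apply: vge_sum => // i _.
  by apply: vgeMl; [|exact: level_int lc (ltn_ord i)|have [] := IH _ (lt i)].
case: (posnP i) => i0.
  by apply: vgeM; rewrite ?i0 //; have [] := IH _ (lt i); rewrite i0.
apply: vgeMl; [by []|exact: level_int lc (ltn_ord i)|].
have [_] := IH _ (lt i); apply; apply: contra nq.
by rewrite jE -!addSn !dvdn_addl ?dvdn_exp.
Qed.

Lemma sum_root_int (f : {poly F}) :
  f \is a polyOver (vint hv) -> vge v C (\sum_(x <- rs) f.[x]).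
Proof.
move=> /polyOverP fO; under eq_bigr do rewrite horner_coef.
rewrite exchange_big /=; apply: vge_sum => // i _; rewrite -mulr_sumr.
by apply: vgeMl; [|exact: fO|have [] := sum_root_pow i].
Qed.

(** The exponents i with q dividing i + 1, which sum_root_pow excludes from
    its second bound, have coefficient zero in a derivative. *)
Lemma sum_root_deriv (f : {poly F}) :
  f \is a polyOver (vint hv) -> vge v (C + C) (\sum_(x <- rs) (f^`()).[x]).
Proof.
move=> /polyOverP fO; under eq_bigr do rewrite horner_coef.
rewrite exchange_big /=; apply: vge_sum => // i _; rewrite -mulr_sumr coef_deriv.
have [qi|nqi] := boolP (q %| i.+1)%N.
  suff -> : f`_i.+1 *+ i.+1 = 0 by rewrite mul0r vge0.
  rewrite -mulr_natr; suff -> : i.+1%:R = 0 :> F by rewrite mulr0.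
  have pP : pdiv q \in [pchar F] by apply: (pnatPpi qF); rewrite pi_pdiv.
  by apply/eqP; rewrite -(dvdn_pcharf pP) (dvdn_trans (pdiv_dvd q)).
by apply: vgeMl; [|apply: vgeMn => //; exact: fO|have [_ ->] := sum_root_pow i].
Qed.

End PowerSums.

(** * The congruence over the roots of exact level *)

Section Perturbation.

Variables (F : closedFieldType) (v : F -> \bar rat) (q : nat).
Hypotheses (hv : is_valuation v) (q1 : (1 < q)%N) (qF : [pchar F].-nat q).
Variable (pi : F).
Hypothesis (pi1 : v pi = 1%:E).

(** At a point of positive valuation the value of 1 + X^h Y is a unit, so its roots
    have valuation at most 0; the t are their inverses. *)
Lemma factor_1subX (h : nat) (Y : {poly F}) :
  (0 < h)%N -> Y \is a polyOver (vint hv) ->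
  exists ts : seq F, [/\ 1 + 'X^h * Y = \prod_(t <- ts) (1 - t *: 'X),
    forall t, t \in ts -> vge v 0 t & forall t, t \in ts -> t != 0].
Proof.
move=> h0 YO; set W := 1 + _; have [zs hW] := closed_field_poly_normal W.
have W0 : W.[0] = 1 by rewrite !hornerE expr0n gtn_eqF // mul0r addr0.
have vz z : z \in zs -> exists2 t, v z = t%:E & t <= 0.
  move=> zzs; have rz : root W z.
    rewrite hW rootZ ?root_prod_XsubC // lead_coef_eq0; apply/eqP => W00.
    by move: W0; rewrite W00 horner0 => /eqP; rewrite eq_sym oner_eq0.
  have z0 : z != 0 by apply: contraTneq rz => ->; rewrite /root W0 oner_eq0.
  have [t vt] := v_fin hv z0; exists t => //; rewrite leNgt; apply/negP => t0.
  have : v W.[z] = 0%E.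
    rewrite /W hornerD hornerC hornerM hornerXn; apply: (v_1add hv t0).
    apply: vgeMr => //; last by apply: int_horner => //; rewrite (vgeE _ vt) ltW.
    by rewrite (vgeE _ (vX hv h vt)) ler_peMl ?ler1n // ltW.
  by rewrite (rootP rz) v0.
have z0 z : z \in zs -> z != 0 by move=> /vz[t vt _]; exact: (v_neq0 hv vt).
exists [seq z^-1 | z <- zs]; split.
- have E : \prod_(z <- zs) ('X - z%:P) =
     (\prod_(z <- zs) (- z))%:P * \prod_(z <- zs) (1 - z^-1 *: 'X).
    rewrite rmorph_prod -big_split /= big_seq [RHS]big_seq.
    apply: eq_bigr => z zzs; rewrite polyCN mulrBr mulr1 -scalerAr mulNr.
    by rewrite mul_polyC scalerN scalerA mulVf ?z0 // scale1r opprK addrC.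
  have [a aW] : exists a, W = a *: \prod_(z <- zs) ('X - z%:P).
    by exists (lead_coef W).
  move: W0; rewrite big_map aW E hornerZ hornerM hornerC horner_prod.
  have -> : \prod_(z <- zs) (1 - z^-1 *: 'X).[0] = 1.
    by apply: big1 => z _; rewrite hornerD hornerN hornerZ hornerX hornerC mulr0 subr0.
  rewrite mulr1 => e.
  by rewrite -mul_polyC mulrA -polyCM e mul1r.
- move=> _ /mapP[z zzs ->]; have [t vt t0] := vz z zzs.
  by rewrite (vgeE _ (vV hv vt)) oppr_ge0.
- by move=> _ /mapP[z zzs ->]; rewrite invr_eq0 z0.
Qed.

Lemma prod_1sub (l : seq F) (t : F) : t != 0 ->
  \prod_(x <- l) (1 - t * x) = t ^+ size l * (\prod_(x <- l) ('X - x%:P)).[t^-1].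
Proof.
move=> t0; rewrite horner_prod -prod_scale_seq; apply: eq_bigr => x _.
by rewrite hornerXsubC mulrBr divff.
Qed.

Lemma log_deriv_prod (ts : seq F) (x : F) :
  (forall t, t \in ts -> 1 - t * x != 0) ->
  let W := \prod_(t <- ts) (1 - t *: 'X) in
  x * (W^`()).[x] / W.[x] = (size ts)%:R - \sum_(t <- ts) (1 - t * x)^-1.
Proof.
elim: ts => [|t ts IH] hts /=.
  by rewrite !big_nil derivC horner0 mulr0 mul0r subrr.
have ht : 1 - t * x != 0 by apply: hts; rewrite mem_head.
have hts' u : u \in ts -> 1 - u * x != 0 by move=> uts; apply: hts; rewrite inE uts orbT.
have {IH} := IH hts'; rewrite /= !big_cons; set W := \prod_(t <- ts) _ => IH.
have W0 : W.[x] != 0.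
  rewrite horner_prod prodf_seq_neq0; apply/allP => u /hts' /=.
  by rewrite !hornerE.
have -> : (size (t :: ts))%:R - ((1 - t * x)^-1 + \sum_(u <- ts) (1 - u * x)^-1) =
    1 - (1 - t * x)^-1 + ((size ts)%:R - \sum_(u <- ts) (1 - u * x)^-1).
  by rewrite /= -natr1; ring.
rewrite -IH derivM derivB derivZ derivX -!polyC1 derivC sub0r.
rewrite !(hornerM, hornerD, hornerN, hornerZ, hornerX, hornerC).
by field; rewrite ht W0.
Qed.

Lemma v_prod_unit (I : eqType) (r : seq I) (f : I -> F) :
  (forall i, i \in r -> v (f i) = 0%E) -> v (\prod_(i <- r) f i) = 0%E.
Proof.
move=> hf; rewrite big_seq; elim/big_rec: _ => [|i x /hf vi vx]; first exact: v1.
by rewrite Defs.valM // vi vx add0e.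
Qed.

(** For a root x the power x^(q^s) is a combination of coefficients of valuation at
    least 1. *)
Lemma qpol_root_ge c s x : level v c s -> root (qpol q c s) x ->
  vge v (1 / (q ^ s)%:R) x.
Proof.
move=> lc rx; have xO := qpol_root_int hv q1 lc rx.
have [->|x0] := eqVneq x 0; first exact: vge0.
have [t vt] := v_fin hv x0; rewrite (vgeE _ vt).
move/rootP: rx; rewrite horner_qpol => /eqP; rewrite addr_eq0 => /eqP e.
have : vge v 1 (x ^+ (q ^ s)).
  rewrite e vgeN //; apply: vge_sum => // i _; apply: vgeMr; rewrite ?vgeX0 //.
  by apply: vgeW (lc i (ltn_ord i)); rewrite ler1n subn_gt0.
rewrite (vgeE _ (vX hv _ vt)) => h.
by rewrite ler_pdivrMr ?ltr0n ?qpow_gt0 // mulrC.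
Qed.

Lemma qpol_root_gt0 c s x : level v c s -> root (qpol q c s) x -> (0 < v x)%E.
Proof.
move=> lc rx; apply: vge_gt0 (qpol_root_ge lc rx).
by rewrite divr_gt0 // ltr0n qpow_gt0.
Qed.

Section Core.

Variables (c : nat -> F) (s k h : nat) (rs : seq F) (Y : {poly F}).
Hypotheses (lc : level v c s.+1) (urs : uniq rs).
Hypothesis (Prs : qpol q c s.+1 = \prod_(x <- rs) ('X - x%:P)).
Hypotheses (ks : (k <= s.+1)%N) (hk : (q ^ s * (1 + k.+1 * (q - 1)) <= q * h)%N).
Hypothesis (YO : Y \is a polyOver (vint hv)).

Let W := 1 + 'X^h * Y.

Let h0 : (0 < h)%N.
Proof.
rewrite lt0n; apply/negP => /eqP h0; move: hk; rewrite h0 muln0 leqn0 muln_eq0.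
by rewrite gtn_eqF ?qpow_gt0.
Qed.

Lemma v_unit_1add x : (0 < v x)%E -> v W.[x] = 0%E.
Proof.
move=> /(v_gt0P hv)[t t0 gx]; rewrite hornerD hornerC hornerM hornerXn.
apply: (v_1add hv t0); apply: vgeMr => //; last first.
  by apply: int_horner => //; apply: vgeW gx; apply: ltW.
by apply: vgeW (vgeX hv h gx); rewrite ler_peMl ?ler1n // ltW.
Qed.

(** To first order in the linear coefficient of the q-polynomial, the norm of W
    differs by minus the trace of the logarithmic derivative x W'/W from the norm
    at linear coefficient zero; the latter is a norm one level lower, of the
    polynomial with q-th power coefficients, and is trivial. *)
Lemma norm_perturbation :
  vge v (s.+1 + k)%:R
    (\prod_(x <- rs) W.[x] - 1 + \sum_(x <- rs) x * (W^`()).[x] / W.[x]).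
Proof.
have [ts [WE tO tn0]] := factor_1subX h0 YO.
have rsP x : x \in rs -> (0 < v x)%E.
  by move=> xrs; apply: qpol_root_gt0 lc _; rewrite Prs root_prod_XsubC.
have u1 t x : t \in ts -> x \in rs -> v (1 - t * x) = 0%E.
  move=> tts /rsP /(v_gt0P hv)[r r0 gx]; apply: (v_1add hv r0).
  by rewrite vgeN //; apply: vgeMl => //; apply: tO.
pose a t := \prod_(x <- rs) (1 - t * x).
have va t : t \in ts -> v (a t) = 0%E.
  by move=> tts; apply: v_prod_unit => x; apply: u1.
have an0 t : t \in ts -> a t != 0 by move/va/(v_neq0 hv).
have Wx x : W.[x] = \prod_(t <- ts) (1 - t * x).
  rewrite /W WE horner_prod; apply: eq_bigr => t _.
  by rewrite -polyC1 !(hornerD, hornerN, hornerZ, hornerX, hornerC).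
have NE : \prod_(x <- rs) W.[x] = \prod_(t <- ts) a t.
  by under eq_bigr do rewrite Wx; rewrite exchange_big.
set N := \prod_(x <- rs) W.[x] in NE *.
have vN0 : v N = 0%E by rewrite NE; apply: v_prod_unit.
have NO : vge v 0 N by rewrite /vge vN0.
have srs : size rs = (q ^ s.+1)%N.
  by have := size_qpol q1 c s.+1; rewrite Prs size_prod_XsubC => -[].
(* The t-th factor of the norm, compared with its value when c_0 = 0. *)
pose c' i := if i is 0%N then 0 else c i.
have [ds [P'E BE sds]] := qpol_frob_roots q1 qF (c := c') s erefl.
pose e t := t ^+ (q ^ s.+1) * c 0%N / t / a t.
have aE t : t \in ts -> \prod_(d <- ds) (1 - t * d) ^+ q = a t * (1 - e t).
  move=> tts; have t0 := tn0 t tts; have a0 := an0 t tts.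
  rewrite prodrXl prod_1sub // exprMn -exprM sds -expnSr -horner_exp -prodrXl -P'E.
  have -> : a t * (1 - e t) = a t - t ^+ (q ^ s.+1) * (c 0%N / t).
    by rewrite /e; field; rewrite a0 t0.
  rewrite {1}/a prod_1sub // srs -Prs -mulrBr; congr (_ * _).
  rewrite !horner_qpol !big_ord_recl /= mul0r add0r expn0 expr1.
  by rewrite -addrA [X in _ = _ + X]addrAC subrr add0r.
have eE t : t \in ts -> e t = \sum_(x <- rs) (1 - t * x)^-1.
  move=> tts; have t0 := tn0 t tts; have a0 := an0 t tts.
  have zx x : x \in rs -> t^-1 != x.
    move=> xrs; apply/negP => /eqP tx; have := u1 t x tts xrs.
    by rewrite -tx divff // subrr v0.
  rewrite /e -(sum_inv_root q1 qF (ltn0Sn s) urs Prs zx) mulr_sumr !mulr_suml.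
  rewrite big_seq [RHS]big_seq; apply: eq_bigr => x xrs.
  have b0 : 1 - t * x != 0 by exact: (v_neq0 hv (u1 t x tts xrs)).
  have b1 : t^-1 - x != 0 by rewrite subr_eq0 zx.
  have -> : a t = t ^+ (q ^ s.+1) * (qpol q c s.+1).[t^-1].
    by rewrite /a prod_1sub // srs -Prs.
  have P0 : (qpol q c s.+1).[t^-1] != 0.
    apply: contraNneq a0 => P0; rewrite /a prod_1sub // srs -Prs P0 mulr0 //.
  have -> : 1 - t * x = t * (t^-1 - x) by field.
  move: (t^-1 - x) b1 (horner _ _) P0 (t ^+ _) (expf_neq0 (q ^ s.+1) t0) => w w0 Pz Pz0 tQ tQ0.
  by field; rewrite w0 Pz0 t0 tQ0.
have ge_e t : t \in ts -> vge v s.+1%:R (e t).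
  move=> tts; rewrite /e vge_div_unit ?va //; have t0 := tn0 t tts.
  have -> : t ^+ (q ^ s.+1) * c 0%N / t = t ^+ (q ^ s.+1).-1 * c 0%N.
    by rewrite -{1}(prednK (qpow_gt0 q1 s.+1)) exprS; field.
  by apply: vgeMl => //; [apply: vgeX0 => //; apply: tO|apply: (lc (i := 0%N))].
set E := \sum_(t <- ts) e t.
have gE : vge v s.+1%:R E by apply: vge_sum_seq.
have TD : \sum_(x <- rs) x * (W^`()).[x] / W.[x] = - E.
  rewrite big_seq (eq_bigr (fun x => (size ts)%:R - \sum_(t <- ts) (1 - t * x)^-1)).
    rewrite -big_seq sumrB big_const_seq count_predT iter_addr_0 -[_ *+ size rs]mulr_natr.
    rewrite (card_roots_eq0 q1 qF (ltn0Sn s) urs Prs) mulr0 add0r exchange_big.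
    by congr (- _); rewrite big_seq [RHS]big_seq; apply: eq_bigr => t /eE ->.
  move=> x xrs; rewrite -log_deriv_prod -?WE // => t tts.
  by exact: (v_neq0 hv (u1 t x tts xrs)).
(* The product of all the factors at c_0 = 0 is a norm one level lower: each
   root d of that q-polynomial is repeated q times and W(d)^q = 1 + d^(qh) Y(d)^q. *)
have N0 : vge v (s.+1 + k)%:R (N * \prod_(t <- ts) (1 - e t) - 1).
  have -> : N * \prod_(t <- ts) (1 - e t) =
      \prod_(d <- ds) (1 + (d ^+ q) ^+ h * (frobp q Y).[d ^+ q]).
    rewrite NE -big_split /= big_seq (eq_bigr (fun t => \prod_(d <- ds) (1 - t * d) ^+ q)).
      rewrite -big_seq exchange_big; apply: eq_bigr => d _ /=.
      rewrite prodrXl -Wx frobp_horner // -exprM mulnC exprM -exprMn.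
      have := frobD qF 1 1 (d ^+ h * Y.[d]); rewrite !expn1 expr1n => <-.
      by rewrite hornerD hornerC hornerM hornerXn.
    by move=> t tts; rewrite aE.
  have lB : level v (fun i => c' i.+1) s.
    by move=> i hi; apply: vgeW (lc (i := i.+1) hi).
  have [y yO hy] := qpol_divisible hv q1 qF pi1 lB hk.
  have gpi : vge v k.+1%:R (pi ^+ k.+1) by rewrite (vgeE _ (vX hv _ pi1)) mulr1.
  have := norm_1add q1 qF (rs := [seq d ^+ q | d <- ds]) lB _
    (rpredM yO (frobp_int q YO)) (ltn0Sn k) gpi.
  rewrite BE big_map => /(_ erefl); rewrite big_map addSn addnC addSn.
  congr (vge _ _ (_ - 1)); rewrite big_seq [RHS]big_seq; apply: eq_bigr => d dds.
  rewrite hornerM mulrA -hy // BE -(big_map (fun d => d ^+ q) xpredT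
    (fun g => 'X - g%:P)) root_prod_XsubC.
  by apply: map_f.
rewrite TD; set kap := (s.+1 + k)%N in N0 *.
have kM : kap%:R <= s.+1%:R + s.+1%:R :> rat by rewrite -natrD ler_nat leq_add2l.
have Xe : vge v kap%:R (\prod_(t <- ts) (1 - e t) - 1 + E).
  have := vge_prod_first_order hv (M := s.+1%:R) (f := fun t => 1 - e t) (r := ts) _ kM.
  have -> : \sum_(t <- ts) (1 - e t - 1) = - E.
    by rewrite -sumrN; apply: eq_bigr => t _; ring.
  rewrite opprK; apply => // t tts.
  by have -> : 1 - e t - 1 = - e t by [ring]; rewrite vgeN // ge_e.
have N1 : vge v kap%:R (N * (1 - E) - 1).
  have -> : N * (1 - E) - 1 = (N * \prod_(t <- ts) (1 - e t) - 1)
     - N * (\prod_(t <- ts) (1 - e t) - 1 + E) by ring.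
  by apply: vgeB => //; apply: vgeMl.
have -> : N - 1 - E = (N * (1 - E) - 1) * (1 + E) + N * (E * E) by ring.
have EO : vge v 0 E by apply: vgeW gE.
apply: vgeD => //; first by apply: vgeMr => //; apply: vgeD => //; apply: vge1.
by apply: vgeMl => //; apply: vgeW kM _; apply: vgeM.
Qed.

Variables (V : {poly F}) (c1 : nat -> F) (rs1 A : seq F).
Hypotheses (VO : V \is a polyOver (vint hv)).
Hypothesis (hV : forall x, x \in rs ->
  vge v (s.+1 + k)%:R (V.[x] * W.[x] - x * (W^`()).[x])).
Hypotheses (lc1 : level v c1 s) (urs1 : uniq rs1).
Hypothesis (Prs1 : qpol q c1 s = \prod_(x <- rs1) ('X - x%:P)).
Hypothesis (rsA : perm_eq rs (rs1 ++ A)).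

Let Tr := (W - 1) * (1 + V).

Let WO : W \is a polyOver (vint hv).
Proof. by rewrite rpredD ?rpred1 // rpredM ?polyOverXn. Qed.

Let TrO : Tr \is a polyOver (vint hv).
Proof.
by apply: rpredM; [apply: rpredB => //; apply: rpred1|apply: rpredD => //; apply: rpred1].
Qed.

Let kM : (s.+1 + k)%:R <= s.+1%:R + s.+1%:R :> rat.
Proof. by rewrite -natrD ler_nat leq_add2l. Qed.

Let rs_gt0 x : x \in rs -> (0 < v x)%E.
Proof. by move=> xrs; apply: qpol_root_gt0 lc _; rewrite Prs root_prod_XsubC. Qed.

Let rs_int x : x \in rs -> vge v 0 x.
Proof. by move/rs_gt0/ltW. Qed.

(** On all the roots the trace of (W - 1)(1 + x W'/W) is minus that of x W'/W,
    because the two add up to the trace of the derivative of X W, and the trace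
    of a derivative is negligible. *)
Lemma norm_trace_all :
  vge v (s.+1 + k)%:R (\prod_(x <- rs) W.[x] - 1 - \sum_(x <- rs) Tr.[x]).
Proof.
have nW x : x \in rs -> W.[x] != 0.
  by move/rs_gt0/v_unit_1add => vW; exact: (v_neq0 hv vW).
have E : \sum_(x <- rs) (('X * W)^`()).[x] - (size rs)%:R =
    \sum_(x <- rs) Tr.[x] + \sum_(x <- rs) x * (W^`()).[x] / W.[x] +
    \sum_(x <- rs) (V.[x] * W.[x] - x * (W^`()).[x]) / W.[x] * (1 - W.[x]).
  rewrite -sum1_size natr_sum -sumrB -!big_split /= big_seq [RHS]big_seq.
  apply: eq_bigr => x xrs; rewrite /Tr; move: (W) (nW x xrs) => w w0.
  rewrite derivM derivX mul1r !(hornerD, hornerM, hornerN, hornerX, hornerC).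
  by field.
have szero := card_roots_eq0 q1 qF (ltn0Sn s) urs Prs.
rewrite szero subr0 in E.
have -> : \prod_(x <- rs) W.[x] - 1 - \sum_(x <- rs) Tr.[x] =
  (\prod_(x <- rs) W.[x] - 1 + \sum_(x <- rs) x * (W^`()).[x] / W.[x])
  - \sum_(x <- rs) (('X * W)^`()).[x]
  + \sum_(x <- rs) (V.[x] * W.[x] - x * (W^`()).[x]) / W.[x] * (1 - W.[x]).
  by rewrite E; ring.
apply: vgeD => //; last first.
  apply: vge_sum_seq => // x xrs; apply: vgeMr => //.
    by rewrite vge_div_unit ?v_unit_1add ?rs_gt0 //; apply: hV.
  by apply: vgeB; rewrite ?vge1 //; apply: int_horner; rewrite ?rs_int.
apply: vgeB => //; first exact: norm_perturbation.
apply: vgeW kM _; apply: (sum_root_deriv q1 qF (ltn0Sn s) urs Prs (C := s.+1%:R)) => //.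
  exact: (lc (i := 0%N)).
by rewrite rpredM ?polyOverX.
Qed.

Let Wdiv1 : exists2 y : {poly F}, y \is a polyOver (vint hv) &
  forall x, x \in rs1 -> x ^+ h = pi ^+ k.+1 * y.[x].
Proof.
have [y yO hy] := qpol_divisible hv q1 qF pi1 lc1 hk.
by exists y => // x xrs; apply: hy; rewrite Prs1 root_prod_XsubC.
Qed.

Let pi_k : vge v k.+1%:R (pi ^+ k.+1).
Proof. by rewrite (vgeE _ (vX hv _ pi1)) mulr1. Qed.

Let rs1_int x : x \in rs1 -> vge v 0 x.
Proof.
by move=> xrs; apply: (qpol_root_int hv q1 lc1); rewrite Prs1 root_prod_XsubC.
Qed.

(** On the roots of level s the power X^h is divisible by pi^(k+1), and the
    passage to the norm or to the trace gains s more. *)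
Lemma norm_low : vge v (s.+1 + k)%:R (\prod_(x <- rs1) W.[x] - 1).
Proof.
have [y yO hy] := Wdiv1.
have := norm_1add q1 qF lc1 Prs1 (rpredM yO YO) (ltn0Sn k) pi_k.
rewrite addSn addnC addSn; congr (vge _ _ (_ - 1)).
rewrite big_seq [RHS]big_seq; apply: eq_bigr => x xrs.
by rewrite hornerM mulrA -hy // /W hornerD hornerC hornerM hornerXn.
Qed.

Lemma trace_low : vge v (s.+1 + k)%:R (\sum_(x <- rs1) Tr.[x]).
Proof.
have [y yO hy] := Wdiv1.
have -> : \sum_(x <- rs1) Tr.[x] = pi ^+ k.+1 * \sum_(x <- rs1) (y * Y * (1 + V)).[x].
  rewrite mulr_sumr big_seq [RHS]big_seq; apply: eq_bigr => x xrs.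
  rewrite /Tr /W !(hornerM, hornerD, hornerN, hornerXn, hornerC) hy //; ring.
have yYO : y * Y * (1 + V) \is a polyOver (vint hv).
  by apply: rpredM; [apply: rpredM|apply: rpredD => //; apply: rpred1].
rewrite addSn -addnS addnC natrD; apply: vgeM => //.
have [s0|s0] := posnP s; first by rewrite s0; apply: vge_sum_seq => // x /rs1_int; exact: int_horner.
apply: (sum_root_int q1 qF s0 urs1 Prs1 lc1 _ yYO) => //.
by apply: vgeW (lc1 s0); rewrite subn0.
Qed.

(** The roots of level s contribute neither to the norm nor to the trace. *)
Lemma norm_trace_primitive :
  vge v (s.+1 + k)%:R (\prod_(x <- A) W.[x] - 1 - \sum_(x <- A) Tr.[x]) /\
  vge v s.+1%:R (\prod_(x <- A) W.[x] - 1).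
Proof.
have NE : \prod_(x <- rs) W.[x] = \prod_(x <- rs1) W.[x] * \prod_(x <- A) W.[x].
  by rewrite (perm_big _ rsA) big_cat.
have TE : \sum_(x <- rs) Tr.[x] = \sum_(x <- rs1) Tr.[x] + \sum_(x <- A) Tr.[x].
  by rewrite (perm_big _ rsA) big_cat.
have NAO : vge v 0 (\prod_(x <- A) W.[x]).
  apply: vge_prod => // x xA; apply: int_horner => //; apply: rs_int.
  by rewrite (perm_mem rsA) mem_cat xA orbT.
have g1 : vge v (s.+1 + k)%:R (\prod_(x <- A) W.[x] - 1 - \sum_(x <- A) Tr.[x]).
  have := norm_trace_all; rewrite NE TE.
  set a := \prod_(x <- rs1) _; set b := \prod_(x <- A) _; set t := \sum_(x <- rs1) _.
  move=> g; have -> : b - 1 - \sum_(x <- A) Tr.[x] =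
     (a * b - 1 - (t + \sum_(x <- A) Tr.[x])) - (a - 1) * b + t by ring.
  apply: vgeD => //; last exact: trace_low.
  by apply: vgeB => //; apply: vgeMr => //; apply: norm_low.
have le : s.+1%:R <= (s.+1 + k)%:R :> rat by rewrite ler_nat leq_addr.
split=> //; rewrite -[_ - 1](subrK (\sum_(x <- A) Tr.[x])).
apply: vgeD => //; first exact: vgeW g1.
have -> : \sum_(x <- A) Tr.[x] = \sum_(x <- rs) Tr.[x] - \sum_(x <- rs1) Tr.[x].
  by rewrite TE addrC addKr.
apply: vgeB => //; last by apply: vgeW le _; apply: trace_low.
apply: (sum_root_int q1 qF (ltn0Sn s) urs Prs lc _ TrO) => //.
exact: (lc (i := 0%N)).
Qed.

End Core.

End Perturbation.

(** * Trace and norm through embeddings *)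

Section Embeddings.

Variables (K : fieldType) (L : fieldExtType K) (Om : closedFieldType).
Variable (iK : {rmorphism K -> Om}).

Local Notation "p ^L" := (map_poly (in_alg L) p) (at level 2).
Local Notation "p ^O" := (map_poly iK p) (at level 2).

Definition Kmorphism (f : {rmorphism L -> Om}) := forall a : K, f a%:A = iK a.

Lemma Kmorphism_horner (f : {rmorphism L -> Om}) (p : {poly K}) x :
  Kmorphism f -> f (p^L).[x] = (p^O).[f x].
Proof.
move=> fK; rewrite -horner_map -map_poly_comp; congr _.[_].
by apply: eq_map_poly => a /=; apply: fK.
Qed.

(** The map sends p(z) to p(y); it is well defined because pz divides the
    difference of two polynomials with the same value at z. *)
Lemma embedding_exists (z : L) (pz : {poly K}) (y : Om) :
  (forall x, exists p : {poly K}, x = (p^L).[z]) ->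
  (forall p : {poly K}, root (p^L) z -> pz %| p) ->
  root (pz^O) y -> exists2 f : {rmorphism L -> Om}, Kmorphism f & f z = y.
Proof.
move=> gen min ry; have [P hP] := choice gen.
pose f x := ((P x)^O).[y].
have fE (p : {poly K}) x : x = (p^L).[z] -> f x = (p^O).[y].
  move=> xE; have : pz %| P x - p.
    by apply: min; rewrite /root rmorphB /= hornerD hornerN -hP -xE subrr.
  move=> /dvdpP[g gE]; apply/eqP; rewrite -subr_eq0 /f -hornerN -hornerD -rmorphB.
  by rewrite /= gE rmorphM hornerM (rootP ry) mulr0.
have fB : zmod_morphism f.
  move=> a b; rewrite [f a]/f [f b]/f -hornerN -hornerD -rmorphB; apply: fE.
  by rewrite rmorphB /= hornerD hornerN -!hP.
have fM : monoid_morphism f.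
  split=> [|a b].
    by rewrite (fE 1) ?rmorph1 ?hornerC // rmorph1 hornerC.
  rewrite [f a]/f [f b]/f -hornerM -rmorphM; apply: fE.
  by rewrite rmorphM /= hornerM -!hP.
pose mB := GRing.isZmodMorphism.Build L Om f fB.
pose mM := GRing.isMonoidMorphism.Build L Om f fM.
pose F : {rmorphism L -> Om} := HB.pack f mB mM.
exists F => [a|] /=.
  by rewrite (fE a%:P) ?map_polyC ?hornerC // map_polyC hornerC.
by rewrite (fE 'X) ?map_polyX ?hornerX.
Qed.

Lemma embeddings_exist : separable 1%VS {:L} ->
  exists (z : L) (f : 'I_(\dim {:L}) -> {rmorphism L -> Om}),
    (forall i, Kmorphism (f i)) /\ injective (fun i => f i z).
Proof.
move=> sepL; pose z := separable_generator 1%VS {:L}%AS.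
have Lz : {:L}%VS = <<1; z>>%VS.
  by apply: (@eq_adjoin_separable_generator _ _ {:L}%AS 1%AS); rewrite // sub1v.
have [pz mz] := polyOver1P (minPolyOver 1%AS z).
have sz : size pz = (\dim {:L}).+1.
  rewrite -(size_map_poly (in_alg L)) -mz size_minPoly adjoin_degreeE /=.
  by rewrite -Lz dimv1 divn1.
have seppz : separable_poly pz.
  rewrite -(separable_map (in_alg L)) -mz.
  exact: (separable_generatorP {:L}%AS 1%AS).
have [rs rsE] := closed_field_poly_normal (pz^O).
have lc0 : lead_coef (pz^O) != 0.
  by rewrite lead_coef_eq0 map_poly_eq0 -size_poly_eq0 sz.
have urs : uniq rs.
  rewrite -separable_prod_XsubC.
  by rewrite -(eqp_separable (eqp_scale _ lc0)) -rsE separable_map.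
have srs : size rs = \dim {:L}.
  have := congr1 (fun p : {poly Om} => size p) rsE.
  by rewrite size_scale // size_prod_XsubC size_map_poly sz => -[].
have emb (i : 'I_(\dim {:L})) : exists f : {rmorphism L -> Om},
    Kmorphism f /\ f z = rs`_i.
  have [|p rp||f fK fz] := @embedding_exists z pz rs`_i.
  - by move=> x; apply/Fadjoin1_polyP; rewrite -Lz memvf.
  - rewrite -(dvdp_map (in_alg L)) -mz; apply: minPoly_dvdp => //.
    by apply/polyOver1P; exists p.
  - by rewrite rsE rootZ // root_prod_XsubC mem_nth // srs.
  by exists f.
have [f hf] := choice emb; exists z, f; split=> [i|i j]; first by have [] := hf i.
have [_ ->] := hf i; have [_ ->] := hf j => /eqP.
by rewrite nth_uniq ?srs // => /eqP/val_inj.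
Qed.

Section TraceNorm.

Variables (z : L) (f : 'I_(\dim {:L}) -> {rmorphism L -> Om}).
Hypotheses (fK : forall i, Kmorphism (f i)) (finj : injective (fun i => f i z)).

Let b := vbasis {:L}.
Let T : 'M[Om]_(\dim {:L}) := \matrix_(i, j) f j b`_i.

Let f_coord (x : L) k : f k x = \sum_i iK (coord b i x) * f k b`_i.
Proof.
rewrite {1}(coord_vbasis (memvf x)) rmorph_sum; apply: eq_bigr => i _ /=.
by rewrite -mulr_algl rmorphM fK.
Qed.

(* The change of basis to the values of the embeddings is invertible because it
   carries the matrix of coordinates of the powers of z to a Vandermonde matrix. *)
Let T_unit : T \in unitmx.
Proof.
have V : Vandermonde (\dim {:L}) (\row_i f i z) =
    (\matrix_(j, i) iK (coord b i (z ^+ j))) *m T.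
  apply/matrixP => j k; rewrite !mxE -rmorphXn f_coord; apply: eq_bigr => i _.
  by rewrite !mxE.
have := det_Vandermonde (\row_i f i z); rewrite V det_mulmx => e.
rewrite unitmxE unitfE; apply/negP => /eqP T0; move/eqP: e.
rewrite T0 mulr0 eq_sym; apply/negP/prodf_neq0 => i _; apply/prodf_neq0 => j ij.
rewrite !mxE subr_eq0; apply/negP => /eqP/finj ji.
by rewrite ji ltnn in ij.
Qed.

Let mul_T (x : L) : map_mx iK (passmx.mxof b b (amull x)) *m T =
  T *m diag_mx (\row_i f i x).
Proof.
apply/matrixP => i k; rewrite mul_mx_diag !mxE mulrC -rmorphM /=.
rewrite (f_coord (x * b`_i)); apply: eq_bigr => j _; rewrite !mxE /=.
congr (iK _ * _); congr (coord _ _ _).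
rewrite /= lfunE /=; congr (_ * _).
rewrite /passmx.vecof (bigD1 i) //= mxE !eqxx scale1r big1 ?addr0 // => k' k'i.
by rewrite mxE eqxx (negbTE k'i) scale0r.
Qed.

Lemma ext_norm_embeddings (x : L) : iK (ext_norm x) = \prod_i f i x.
Proof.
rewrite /ext_norm -det_map_mx; have := congr1 determinant (mul_T x).
rewrite !det_mulmx det_diag mulrC => /mulfI -> //.
  by apply: eq_bigr => i _; rewrite mxE.
by have := T_unit; rewrite unitmxE unitfE.
Qed.

Lemma ext_trace_embeddings (x : L) : iK (ext_trace x) = \sum_i f i x.
Proof.
have E : map_mx iK (passmx.mxof b b (amull x)) =
    T *m diag_mx (\row_i f i x) *m invmx T.
  by rewrite -mul_T mulmxK.
rewrite /ext_trace -trace_map_mx E -mulmxA mxtrace_mulC -mulmxA mulVmx // mulmx1.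
by rewrite mxtrace_diag; apply: eq_bigr => i _; rewrite mxE.
Qed.

End TraceNorm.

Lemma big_fiber (R : Type) (idx : R) (op : Monoid.com_law idx) (I : finType)
    (T : eqType) (key : I -> T) (ks : seq T) (G : I -> R) :
  uniq ks -> (forall i, key i \in ks) ->
  \big[op/idx]_i G i = \big[op/idx]_(k <- ks) \big[op/idx]_(i | key i == k) G i.
Proof.
move=> uk hk; rewrite (exchange_big_dep xpredT) //=; apply: eq_bigr => i _.
rewrite -big_filter; rewrite (eq_filter (a2 := pred1 (key i))); last first.
  by move=> k /=; rewrite eq_sym.
by rewrite filter_pred1_uniq // big_seq1.
Qed.

(** The embeddings of L = H(v) are grouped by their restriction to H. In a group
    the images of v are roots of the image of one polynomial with roots A, so a
    group has at most #|A| members; there are at most [H : K] groups, and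
    [L : K] >= #|A| [H : K] embeddings in all. Hence in each group the images of v
    are exactly the images of A under any member of the group. *)
Lemma embeddings_grouped (H : {subfield L}) (v : L) (A : seq L) :
  separable 1%VS {:L} -> <<H; v>>%VS = {:L}%VS -> uniq A ->
  \prod_(a <- A) ('X - a%:P) \is a polyOver H -> v \in A ->
  (size A <= adjoin_degree H v)%N ->
  exists (z : L) (f : 'I_(\dim {:L}) -> {rmorphism L -> Om})
     (d : nat) (g : 'I_d -> {rmorphism L -> Om}),
   [/\ forall i, Kmorphism (f i), injective (fun i => f i z), forall i, Kmorphism (g i),
     forall F : {poly L}, F \is a polyOver H ->
       \sum_i f i F.[v] = \sum_i g i (\sum_(a <- A) F.[a]) &
     forall F : {poly L}, F \is a polyOver H ->
       \prod_i f i F.[v] = \prod_i g i (\prod_(a <- A) F.[a])].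
Proof.
move=> sepL Hv uA AH vA sA; have [z [f [fK finj]]] := embeddings_exist sepL.
have sepH : separable 1%VS H by apply: separableSr sepL; apply: subvf.
pose th := separable_generator 1%VS H.
have Hth : (H : {vspace L}) = <<1; th>>%VS.
  by apply: (@eq_adjoin_separable_generator _ _ H 1%AS); rewrite // sub1v.
have [pt mt] := polyOver1P (minPolyOver 1%AS th).
have st : size pt = (\dim H).+1.
  rewrite -(size_map_poly (in_alg L)) -mt size_minPoly adjoin_degreeE /=.
  by rewrite -Hth dimv1 divn1.
pose key i := f i th; pose ks := undup [seq key i | i <- enum 'I_(\dim {:L})].
have uks : uniq ks by apply: undup_uniq.
have hks i : key i \in ks by rewrite mem_undup map_f // mem_enum.
have sks : (size ks <= \dim H)%N.
  have pt0 : pt^O != 0 by rewrite map_poly_eq0 -size_poly_eq0 st.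
  have := max_poly_roots pt0 (rs := ks); rewrite uks size_map_poly st ltnS.
  apply=> //; apply/allP => x; rewrite mem_undup => /mapP[i _ ->].
  rewrite /root -(Kmorphism_horner _ _ (fK i)) -mt minPolyxx rmorph0 //.
have agree i j x : key i = key j -> x \in H -> f i x = f j x.
  by rewrite Hth => kij /Fadjoin1_polyP[p ->]; rewrite !Kmorphism_horner // -/(key _) kij.
have agree_poly i j (F : {poly L}) : key i = key j -> F \is a polyOver H ->
    map_poly (f i) F = map_poly (f j) F.
  move=> kij /polyOverP FH; apply/polyP => k; rewrite !coef_map; exact: agree.
have fv_inj i j : key i = key j -> f i v = f j v -> i = j.
  move=> kij vij; apply: finj; have zL : z \in <<H; v>>%VS by rewrite Hv memvf.
  rewrite -(Fadjoin_poly_eq zL) -!horner_map vij (agree_poly i j) //.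
  exact: Fadjoin_polyOver.
have conjA i j : key i = key j -> f i v \in [seq f j a | a <- A].
  move=> kij; rewrite -root_prod_XsubC big_map.
  have -> : \prod_(a <- A) ('X - (f j a)%:P) = map_poly (f i) (\prod_(a <- A) ('X - a%:P)).
    rewrite (agree_poly i j) // rmorph_prod; apply: eq_bigr => a _.
    by rewrite rmorphB /= map_polyX map_polyC.
  have rv : root (\prod_(a <- A) ('X - a%:P)) v by rewrite root_prod_XsubC.
  by rewrite /root horner_map (rootP rv) rmorph0.
have /choice[rep hrep] (j : 'I_(size ks)) : exists r, key r = nth 0 ks j.
  have := mem_nth 0 (ltn_ord j).
  by rewrite {2}/ks mem_undup => /mapP[i _ ->]; exists i.
pose cls k := [seq f i v | i <- enum 'I_(\dim {:L}) & key i == k].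
have scls k : size (cls k) = (\sum_(i | key i == k) 1)%N.
  by rewrite size_map -sum1_size big_filter big_enum_cond.
have ucls k : uniq (cls k).
  rewrite map_inj_in_uniq; first exact: filter_uniq (enum_uniq _).
  move=> i j; rewrite !mem_filter => /andP[/eqP ki _] /andP[/eqP kj _].
  by apply: fv_inj; rewrite ki kj.
have clsA j : {subset cls (key j) <= [seq f j a | a <- A]}.
  by move=> _ /mapP[i /[!mem_filter] /andP[/eqP kij _] ->]; apply: conjA.
have leA k : k \in ks -> (size (cls k) <= size A)%N.
  rewrite mem_undup => /mapP[j _ ->]; rewrite -(size_map (f j)).
  exact: uniq_leq_size (ucls _) (clsA j).
have eqA k : k \in ks -> size (cls k) = size A.
  have tot : (\sum_(k <- ks) size (cls k) = \dim {:L})%N.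
    rewrite -[RHS]card_ord -sum1_card (big_fiber _ _ uks hks).
    by apply: eq_bigr => k' _; rewrite scls.
  have le : (\sum_(k <- ks) size A <= \sum_(k <- ks) size (cls k))%N.
    rewrite tot big_const_seq count_predT iter_addn_0 -Hv dim_Fadjoin.
    by rewrite leq_mul.
  move=> kks; apply/eqP; rewrite eqn_leq leA //=.
  move: le; rewrite [X in (X <= _)%N]big_seq [X in (_ <= X)%N]big_seq -subn_eq0.
  rewrite -sumnB => [|i /leA //]; rewrite -big_seq sum_nat_seq_eq0.
  by move=> /allP /(_ k kks) /=; rewrite subn_eq0.
have permA j : perm_eq (cls (key j)) [seq f j a | a <- A].
  have le : (size [seq f j a | a <- A] <= size (cls (key j)))%N.
    by rewrite size_map eqA.
  have [_ eqi] := uniq_min_size (ucls (key j)) (clsA j) le.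
  apply: uniq_perm => //.
  by rewrite map_inj_uniq //; apply: fmorph_inj.
exists z, f, (size ks), (fun j => f (rep j)); split=> // F FH.
- rewrite (big_fiber _ _ uks hks) (big_nth 0) big_mkord; apply: eq_bigr => j _.
  rewrite rmorph_sum -hrep.
  transitivity (\sum_(x <- cls (key (rep j))) (map_poly (f (rep j)) F).[x]).
    rewrite big_map big_filter big_enum_cond; apply: eq_bigr => i /eqP ki.
    by rewrite -horner_map (agree_poly i (rep j)).
  rewrite (perm_big _ (permA (rep j))) big_map; apply: eq_bigr => a _.
  by rewrite horner_map.
- rewrite (big_fiber _ _ uks hks) (big_nth 0) big_mkord; apply: eq_bigr => j _.
  rewrite rmorph_prod -hrep.
  transitivity (\prod_(x <- cls (key (rep j))) (map_poly (f (rep j)) F).[x]).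
    rewrite big_map big_filter big_enum_cond; apply: eq_bigr => i /eqP ki.
    by rewrite -horner_map (agree_poly i (rep j)).
  rewrite (perm_big _ (permA (rep j))) big_map; apply: eq_bigr => a _.
  by rewrite horner_map.
Qed.

End Embeddings.

(** * Torsion of a formal Drinfeld module *)

Lemma valuation_comp (F G : fieldType) (v : G -> \bar rat) (f : {rmorphism F -> G}) :
  is_valuation v -> is_valuation (v \o f).
Proof.
move=> hv; split=> [x|x|x y|x y] /=.
- exact: val_gtNy.
- split=> [/(val_eqy hv)/eqP|->]; last by rewrite rmorph0 v0.
  by rewrite fmorph_eq0 => /eqP.
- by rewrite rmorphM Defs.valM.
- by rewrite rmorphD; apply: Defs.valD.
Qed.

Section ResidueOrder.

Variables (p q : nat) (K : fieldType) (vK : K -> \bar rat).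
Hypotheses (pK : p \in [pchar K]) (locK : is_local_field vK q).
Variables (H : fieldExtType K) (vH : H -> \bar rat) (rho : K -> nat -> H).
Hypotheses (hH : is_valuation vH) (vKH : forall a : K, vH a%:A = vK a).
Hypothesis (rhoP : is_drinfeld_height1 vK q vH rho).

Let hK : is_valuation vK := lf_val locK.

(** The residue classes of 0 and 1 are distinct. *)
Lemma residue_order_gt1 : (1 < q)%N.
Proof.
have [r [sr _ _ hr]] := lf_residue locK; rewrite -sr.
have [c0 [[c0r v0c0] _]] := hr 0 (vge0 hK 0).
have [c1 [[c1r v1c1] _]] := hr 1 (vge1 hK).
case: r c0r c1r {sr hr} => [//|x [|//]]; rewrite !inE => /eqP c0x /eqP c1x.
have : (0 < vK (1 - c1 - (0 - c0)))%E.
  have [t t0 g0] := v_gt0P hK v0c0; have [u u0 g1] := v_gt0P hK v1c1.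
  apply: (@vge_gt0 _ _ (Num.min t u)); first by rewrite lt_min t0.
  by apply: vgeB; rewrite //; [apply: vgeW g1|apply: vgeW g0]; rewrite ge_min lexx ?orbT.
by rewrite c0x c1x sub0r opprK subrK v1 // ltxx.
Qed.

(** Compare the coefficients of tau in rho_pi rho_a = rho_a rho_pi. *)
Lemma drinfeld_coef1 pi a : val_ring vK pi -> val_ring vK a ->
  rho a 1%N * (pi%:A - pi%:A ^+ q) = rho pi 1%N * (a%:A - a%:A ^+ q).
Proof.
move=> piO aO; have := drinM rhoP piO aO 1%N.
rewrite mulrC (drinM rhoP aO piO 1%N) /tps_mul !big_ord_recl !big_ord0 !addr0 /=.
rewrite !(drin_const rhoP) //= /bump /= expn0 !expr1 expn1.
move=> h; apply/eqP; rewrite -subr_eq0; apply/eqP.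
rewrite -[RHS](subrr (a%:A * rho pi 1%N + rho a 1%N * pi%:A ^+ q)) {1}h; ring.
Qed.

(** For a uniformizer pi the preceding identity says that, up to a factor of
    valuation 1, a - a^q is the coefficient of tau in rho_a. It is therefore
    additive in a, which forces q to be a power of p, and of positive valuation. *)
Lemma drinfeld_power : [pchar K].-nat q /\
  forall a, val_ring vK a -> val_max vK (a ^+ q - a).
Proof.
have q1 := residue_order_gt1.
have [pi pi1 u1] := drin_unit rhoP.
have piO : val_ring vK pi by rewrite /val_ring /= pi1 lee_fin.
have vpi : vK (pi - pi ^+ q) = 1%:E.
  rewrite (v_add_lt hK pi1) // vN // pi1 (vX hK q pi1) lte_fin mulr1.
  by rewrite ltr1n.
have key a : val_ring vK a ->
    rho a 1%N * (pi - pi ^+ q)%:A = rho pi 1%N * (a - a ^+ q)%:A.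
  by move=> aO; rewrite !scalerBl -!in_algE !rmorphXn !in_algE; apply: drinfeld_coef1.
split; last first.
  move=> a aO; rewrite /val_max /= -vN // opprB -vKH.
  have gr : vge vH 0 (rho a 1%N) by apply: (drin_int rhoP aO).
  have : vH (rho pi 1%N * (a - a ^+ q)%:A) = vH (a - a ^+ q)%:A.
    by rewrite Defs.valM // u1 add0e.
  rewrite -key // => <-; apply: (@vge_gt0 _ _ 1) => //; rewrite -[1]add0r.
  by apply: vgeM => //; rewrite /vge vKH vpi.
have add a b : val_ring vK a -> val_ring vK b -> (a + b) ^+ q = a ^+ q + b ^+ q.
  move=> aO bO; have abO : val_ring vK (a + b) by apply: (vgeD hK (t := 0)).
  have := key _ abO; rewrite (drinD rhoP aO bO 1%N) mulrDl !key // -mulrDr.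
  move/(mulfI (v_neq0 hH u1)); rewrite -scalerDl => /(fmorph_inj (in_alg H)) e.
  by apply: oppr_inj; apply: (addrI (a + b)); rewrite -e; ring.
apply: (@additive_power_pnat _ p q pK (ltnW q1) (fun i => pi ^+ i)).
  move=> i j ij; have := congr1 vK ij; rewrite !(vX hK _ pi1) !mulr1 => -[].
  by move/eqP; rewrite eqr_nat => /eqP.
move=> i; rewrite add ?expr1n //; first exact: vge1.
by apply: (vgeX0 hK).
Qed.

End ResidueOrder.

Section Tower.

Variables (q : nat) (K : fieldType) (vK : K -> \bar rat).
Hypotheses (hK : is_valuation vK) (q1 : (1 < q)%N) (qK : [pchar K].-nat q).
Variables (H : fieldExtType K) (vH : H -> \bar rat) (rho : K -> nat -> H).
Hypotheses (hH : is_valuation vH) (cH : vcomplete vH).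
Hypothesis (vKH : forall a : K, vH a%:A = vK a).
Hypothesis (rhoP : is_drinfeld_height1 vK q vH rho).
Variables (F : fieldType) (v : F -> \bar rat) (psi : {rmorphism H -> F}).
Hypotheses (hv : is_valuation v) (cv : vcomplete v).
Hypothesis (vpsi : forall y, v (psi y) = vH y).

Let qH : [pchar H].-nat q.
Proof. by rewrite (eq_pnat _ (pchar_lalg H)). Qed.

Let qF : [pchar F].-nat q.
Proof. by rewrite (eq_pnat _ (fmorph_pchar psi)). Qed.

Lemma vge_psi t y : vge v t (psi y) = vge vH t y.
Proof. by rewrite /vge vpsi. Qed.

Lemma psi_tps_mul (f g : nat -> H) :
  psi \o tps_mul q f g = tps_mul q (psi \o f) (psi \o g).
Proof.
apply: funext => k; rewrite /tps_mul /= rmorph_sum; apply: eq_bigr => i _ /=.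
by rewrite rmorphM rmorphXn.
Qed.

Lemma level_psi (c : nat -> H) k : level vH c k -> level v (psi \o c) k.
Proof. by move=> lc i /lc; rewrite vge_psi. Qed.

Lemma rho_int a i : val_ring vK a -> vge v 0 (psi (rho a i)).
Proof. by move=> aO; rewrite vge_psi; apply: (drin_int rhoP aO i). Qed.

Lemma rho_lim_ex a x : val_ring vK a -> (0 < v x)%E ->
  exists l, tps_lim v q (psi \o rho a) x l.
Proof. by move=> aO; apply: tps_lim_ex => // i; apply: rho_int. Qed.

Lemma rho_lim_mul a b x y z : val_ring vK a -> val_ring vK b ->
  tps_lim v q (psi \o rho b) x y -> tps_lim v q (psi \o rho a) y z ->
  tps_lim v q (psi \o rho (a * b)) x z.
Proof.
move=> aO bO hb ha; have -> : rho (a * b) = tps_mul q (rho a) (rho b).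
  by apply: funext; apply: (drinM rhoP).
by rewrite psi_tps_mul; apply: tps_lim_mul hb ha => // i; apply: rho_int.
Qed.

Lemma qpol_ge (c : nat -> F) k t x :
  level v c k -> 0 < t -> vge v t x -> vge v t (qpol q c k).[x].
Proof.
move=> lc t0 gx; have gX i : vge v t (x ^+ (q ^ i)).
  by apply: vgeW (vgeX hv _ gx); rewrite ler_peMl ?ler1n ?qpow_gt0 // ltW.
rewrite horner_qpol; apply: vgeD => //; apply: vge_sum => // i _.
by apply: vgeMl => //; apply: level_int lc (ltn_ord i).
Qed.

Lemma qpol_gt0 (c : nat -> F) k x :
  level v c k -> (0 < v x)%E -> (0 < v (qpol q c k).[x])%E.
Proof.
by move=> lc /(v_gt0P hv)[t t0 gx]; apply: (vge_gt0 t0); apply: qpol_ge.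
Qed.

(** The torsion polynomial of level k: rho_(pi^k) factors through it, the other
    factor being a series with unit constant coefficient; a point at which the
    polynomial has valuation t <= 1/(q-1) has valuation t / q^k. *)
Definition torsion_poly (pi : K) (k : nat) (c : nat -> H) :=
  [/\ level vH c k, (0 < k)%N -> c 0%N != 0,
     exists r : nat -> H, [/\ forall i, vge vH 0 (r i), vH (r 0%N) = 0%E &
      forall x l, (0 < v x)%E -> tps_lim v q (psi \o r) (qpol q (psi \o c) k).[x] l ->
         tps_lim v q (psi \o rho (pi ^+ k)) x l] &
     forall x t, (0 < v x)%E -> v (qpol q (psi \o c) k).[x] = t%:E ->
       t <= 1 / (q%:R - 1) -> v x = (t / (q ^ k)%:R)%:E].

Variable (pi : K).
Hypotheses (pi1 : vK pi = 1%:E) (rho1 : vH (rho pi 1%N) = 0%E).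

Let pi_int k : val_ring vK (pi ^+ k).
Proof. by rewrite /val_ring /= (vX hK k pi1) lee_fin mulr1. Qed.

Lemma torsion_poly0 : torsion_poly pi 0 (fun=> 0).
Proof.
split=> // [|x t vx]; last by rewrite horner_qpol big_ord0 addr0 expn0 expr1 divr1.
exists (rho 1); split=> [i||x l vx].
- by apply: (drin_int rhoP); apply: (pi_int 0).
- by rewrite (drin1 rhoP) /tps_tau eqxx v1.
- by rewrite horner_qpol big_ord0 addr0 expn0 !expr1.
Qed.

(** If rho_(pi^k) = r P_k then rho_(pi^(k+1)) = (rho_pi r) P_k. The series rho_pi r
    has height one, so it is a multiple r' (tau + d), and P_(k+1) = (tau + d) P_k. *)
Lemma torsion_polyS k c : torsion_poly pi k c ->
  exists d c', [/\ vH d = 1%:E, torsion_poly pi k.+1 c' &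
    qpol q c' k.+1 = qpol q c k ^+ q + d *: qpol q c k].
Proof.
move=> [lc c0 [r [rO r0 hr]] hval].
have piO : val_ring vK pi by have := pi_int 1; rewrite expr1.
pose f := tps_mul q (rho pi) r.
have rpO i : vge vH 0 (rho pi i) by apply: (drin_int rhoP piO).
have f0 : f 0%N = pi%:A * r 0%N.
  by rewrite /f /tps_mul big_ord1 subnn expn0 expr1 (drin_const rhoP).
have f1 : f 1%N = pi%:A * r 1%N + rho pi 1%N * r 0%N ^+ q.
  rewrite /f /tps_mul !big_ord_recl big_ord0 addr0 /= expn0 expr1 expn1.
  by rewrite (drin_const rhoP).
have fO i : vge vH 0 (f i).
  by apply: vge_sum => // j _; apply: vgeMl => //; apply: vgeX0.
have vf0 : vH (f 0%N) = 1%:E by rewrite f0 Defs.valM // vKH pi1 r0 adde0.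
have vf1 : vH (f 1%N) = 0%E.
  have u : vH (rho pi 1%N * r 0%N ^+ q) = 0%E.
    by rewrite Defs.valM // rho1 (vX hH q r0) mulr0 adde0.
  rewrite f1 addrC (v_add_lt hH u) // u.
  apply: (@vge_gt0 _ _ 1) => //; apply: vgeMr => //; by rewrite /vge vKH pi1.
have gf0 : vge vH 1 (f 0%N) by rewrite /vge vf0.
have [d [r' [d1 r'O r'0 fd fS]]] := twisted_weierstrass hH cH q1 fO gf0 vf1.
have vd : vH d = 1%:E.
  by have := vf0; rewrite fd Defs.valM // r'0 add0e.
pose c' i := (if i is j.+1 then c j ^+ q else 0) +
  (if (i < k)%N then d * c i else if i == k then d else 0).
have E : qpol q c' k.+1 = qpol q c k ^+ q + d *: qpol q c k.
  have qHX : [pchar {poly H}].-nat q by rewrite (eq_pnat _ (pchar_poly H)).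
  have -> : qpol q c k ^+ q = 'X^(q ^ k.+1) + \sum_(i < k) c i ^+ q *: 'X^(q ^ i.+1).
    rewrite exprDn_pchar // -exprM -expnSr; congr (_ + _).
    have := frob_sum q1 qHX 1 (index_enum 'I_k) xpredT (fun i : 'I_k => c i *: 'X^(q ^ i)).
    rewrite expn1 => ->; apply: eq_bigr => i _.
    by rewrite exprZn -exprM -expnSr.
  rewrite /qpol -addrA; congr (_ + _).
  under eq_bigr do rewrite scalerDl.
  rewrite big_split /= big_ord_recl scale0r add0r; congr (_ + _).
  rewrite big_ord_recr /= ltnn eqxx scalerDr addrC scaler_sumr; congr (_ + _).
  by apply: eq_bigr => i _; rewrite ltn_ord scalerA.
exists d, c'; split=> //; split=> //.
- move=> i ik; rewrite /c'; apply: vgeD => //.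
    case: i ik => [_|i ik]; first exact: vge0.
    have := vgeX hH q (lc i ik); apply: vgeW; rewrite -natrM ler_nat subSS.
    by rewrite leq_pmull // ltnW.
  case: ltnP => ik'; first by rewrite subSn 1?ltnW // -add1n natrD; apply: vgeM; rewrite // lc.
  case: eqP => [->|_]; last exact: vge0.
  by rewrite subSn // subnn.
- move=> _; rewrite /c' add0r; have dn0 := v_neq0 hH vd.
  by case: (posnP k) => [->|k0] //=; rewrite mulf_neq0 // c0.
- exists r'; split=> // x l vx hl.
  have [y yE] : exists y, y = (qpol q (psi \o c) k).[x] by exists (qpol q (psi \o c) k).[x].
  have vy : (0 < v y)%E by rewrite yE; apply: qpol_gt0 => //; apply: level_psi.
  have ev : (qpol q (psi \o c') k.+1).[x] = y ^+ q + psi d * y.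
    by rewrite -map_qpol E rmorphD rmorphXn /= map_polyZ map_qpol hornerD horner_exp hornerZ -yE.
  rewrite ev in hl.
  have hf : tps_lim v q (psi \o f) y l.
    apply: (tps_lim_factor hv q1 qF) hl => /=.
    + by move=> i; rewrite vge_psi.
    + by rewrite vge_psi; apply: vgeW d1.
    + by rewrite fd rmorphM.
    + by move=> i; rewrite fS rmorphD rmorphM rmorphXn.
  have [y1 hy1] : exists y1, tps_lim v q (psi \o r) y y1.
    by apply: tps_lim_ex => // i; rewrite /= vge_psi.
  have [z hz] := rho_lim_ex piO (tps_lim_gt0 hv vy hy1).
  have -> : l = z.
    apply: (tps_lim_unique hv q1 vy hf); rewrite psi_tps_mul.
    by apply: tps_lim_mul hy1 hz => // i; apply: rho_int.
  rewrite exprS; apply: rho_lim_mul hz => //.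
  by apply: hr => //; rewrite -yE.
- move=> x t vx; set y := (qpol q (psi \o c) k).[x].
  have vy : (0 < v y)%E by apply: qpol_gt0 => //; apply: level_psi.
  have -> : (qpol q (psi \o c') k.+1).[x] = y ^+ q + psi d * y.
    by rewrite -map_qpol E rmorphD rmorphXn /= map_polyZ map_qpol hornerD horner_exp hornerZ.
  move=> vt tq; have q0 : 0 < q%:R - 1 :> rat by rewrite subr_gt0 ltr1n.
  have y0 : y != 0.
    apply/negP => /eqP y0; rewrite y0 mulr0 addr0 expr0n in vt.
    by rewrite gtn_eqF ?(ltnW q1) // v0 in vt.
  have [a va] := v_fin hv y0; rewrite va lte_fin in vy.
  have vdy : v (psi d * y) = (1 + a)%:E by apply: vM; rewrite // vpsi.
  have vyq := vX hv q va.
  have aq : q%:R * a < 1 + a.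
    rewrite ltNge; apply/negP => le.
    have : vge v (1 + a) (y ^+ q + psi d * y).
      by apply: vgeD => //; rewrite (vgeE _ vyq, vgeE _ vdy).
    rewrite (vgeE _ vt) => h; have : 1 + a <= 1 / (q%:R - 1) by apply: le_trans tq.
    rewrite ler_pdivlMr // => h2.
    have : 1 <= q%:R - 1 :> rat by rewrite lerBrDr (ler_nat _ 2).
    nra.
  rewrite (v_add_lt hv vyq) ?vyq ?vdy ?lte_fin // in vt; case: vt => vt.
  rewrite (hval x a vx va) ?expnS ?natrM.
    rewrite -vt; congr (_%:E); have : (q ^ k)%:R != 0 :> rat by rewrite pnatr_eq0 -lt0n qpow_gt0.
    have : q%:R != 0 :> rat by rewrite pnatr_eq0 -lt0n ltnW.
    by move=> qn qk; field; rewrite qn qk.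
  rewrite ler_pdivlMr //; lra.
Qed.

(** A series with unit constant coefficient has no nonzero root of positive
    valuation, so the cofactor of the polynomial adds no torsion point. *)
Lemma torsion_polyP k c a x : torsion_poly pi k c -> vK a = k%:R%:E ->
  (0 < v x)%E ->
  tps_eval v q (psi \o rho a) x = 0 <-> (qpol q (psi \o c) k).[x] = 0.
Proof.
move=> [lc _ [r [rO r0 hr]] _] va vx.
pose e := a / pi ^+ k; have piX := vX hK k pi1; rewrite mulr1 in piX.
have ve : vK e = 0%E by rewrite /e Defs.valM // va (vV hK piX) -EFinD subrr.
have eO : val_ring vK e by rewrite /val_ring /= ve.
have aE : a = e * pi ^+ k by rewrite divfK // (v_neq0 hK piX).
set y := (qpol q (psi \o c) k).[x].
have vy : (0 < v y)%E by apply: qpol_gt0 => //; apply: level_psi.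
have prO i : vge v 0 ((psi \o r) i) by rewrite /= vge_psi.
have [y1 h1] := tps_lim_ex hv cv q1 prO vy.
have vy1 := tps_lim_gt0 hv vy h1.
have [z hz] := rho_lim_ex eO vy1.
have hx := rho_lim_mul eO (pi_int k) (hr x y1 vx h1) hz; rewrite -aE in hx.
rewrite (tps_lim_eval hv q1 vx hx); split=> [z0|y0].
- rewrite z0 in hz; have y10 : y1 = 0.
    have ue : v ((psi \o rho e) 0%N) = 0%E.
      by rewrite /= vpsi (drin_const rhoP) // vKH.
    exact: (tps_lim_unit_eq0 hv q1 ue vy1 hz).
  have ur : v ((psi \o r) 0%N) = 0%E by rewrite /= vpsi.
  by rewrite y10 in h1; exact: (tps_lim_unit_eq0 hv q1 ur vy h1).
- have y10 : y1 = 0.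
    by apply: (tps_lim_unique hv q1 vy h1); rewrite y0; apply: tps_lim_0.
  by apply: (tps_lim_unique hv q1 vy1 hz); rewrite y10; apply: tps_lim_0.
Qed.

(** Otherwise all the torsion points, being values rho_b(x), would be roots of the
    level k polynomial, which has too few roots. *)
Lemma generator_exact_level k c c1 a x (rs : seq F) :
  torsion_poly pi k c1 -> torsion_poly pi k.+1 c -> vK a = k.+1%:R%:E ->
  drin_generator v q vK (fun a => psi \o rho a)
    (drin_torsion v q (fun a => psi \o rho a) a) x ->
  uniq rs -> size rs = (q ^ k.+1)%N ->
  (forall y, y \in rs -> (0 < v y)%E /\ (qpol q (psi \o c) k.+1).[y] = 0) ->
  (qpol q (psi \o c1) k).[x] <> 0.
Proof.
move=> tp1 tp va [[vx _] Wgen] urs srs hrs x0.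
have vpiX : vK (pi ^+ k) = k%:R%:E by rewrite (vX hK k pi1) mulr1.
have evx0 : tps_eval v q (psi \o rho (pi ^+ k)) x = 0.
  by apply/(torsion_polyP tp1 vpiX vx).
have [l hl] := rho_lim_ex (pi_int k) vx.
have l0 : l = 0 by rewrite -evx0 (tps_lim_eval hv q1 vx hl).
have low y : y \in rs -> (qpol q (psi \o c1) k).[y] = 0.
  move=> /hrs[vy y0]; apply/(torsion_polyP tp1 vpiX vy).
  have : drin_torsion v q (fun a => psi \o rho a) a y.
    by split=> //; apply/(torsion_polyP tp va vy).
  rewrite Wgen => -[b bO yE].
  have [y' hy'] := rho_lim_ex bO vx; have y'E : y' = y by rewrite -yE (tps_lim_eval hv q1 vx hy').
  rewrite y'E in hy'; have [z hz] := rho_lim_ex (pi_int k) vy.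
  rewrite (tps_lim_eval hv q1 vy hz); have h1 := rho_lim_mul (pi_int k) bO hy' hz.
  have h2 : tps_lim v q (psi \o rho (b * pi ^+ k)) x 0.
    by apply: rho_lim_mul hl _ => //; rewrite l0; apply: tps_lim_0.
  by apply: (tps_lim_unique hv q1 vx h1); rewrite mulrC.
have P0 : qpol q (psi \o c1) k != 0 by rewrite -size_poly_eq0 size_qpol.
have := max_poly_roots P0 (rs := rs); rewrite urs srs size_qpol // ltnS.
rewrite leqNgt qpow_lt // => H1; suff : false by [].
by apply: H1 => //; apply/allP => y yrs; apply/rootP/low.
Qed.

End Tower.

(** * Residue subfields and power series *)

Section DistinctValuations.

Variables (F : fieldType) (v : F -> \bar rat) (hv : is_valuation v).

(** The term of least valuation determines that of the sum. *)
Lemma vge_sum_distinct N (x : 'I_N -> F) t :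
  (forall i j, x i != 0 -> x j != 0 -> i != j -> v (x i) != v (x j)) ->
  vge v t (\sum_i x i) -> forall j, vge v t (x j).
Proof.
case: N x => [|N] x dist gS j; first by case: j.
pose i0 := [arg min_(i < j) v (x i)]%O.
have min i : (v (x i0) <= v (x i))%E.
  by rewrite /i0; case: Order.TotalTheory.arg_minP => // k _; apply.
apply: le_trans (min j); have [->|x0] := eqVneq (x i0) 0; first exact: vge0.
have [r vr] := v_fin hv x0.
rewrite (bigD1 i0) //= in gS.
rewrite -(v_add_lt hv (y := \sum_(i | i != i0) x i) vr) //.
elim/big_ind: _ => [|a b ha hb|i ii0]; first by rewrite v0 // vr ltey.
  by apply: lt_le_trans (Defs.valD hv a b); rewrite lt_min ha.
have [->|xi0] := eqVneq (x i) 0; first by rewrite v0 // vr ltey.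
by rewrite lt_neqAle min andbT eq_sym dist.
Qed.

End DistinctValuations.

Section PowerSeries.

Variables (F : fieldType) (v : F -> \bar rat).
Hypotheses (hv : is_valuation v) (cv : vcomplete v).

Lemma ps_tail (a : nat -> F) x t N M : (forall i, vge v 0 (a i)) -> 0 <= t ->
  vge v t x -> (N <= M)%N ->
  vge v (N%:R * t) (\sum_(i < M) a i * x ^+ i - \sum_(i < N) a i * x ^+ i).
Proof.
move=> aO t0 gx NM; rewrite -(subnK NM) addnC big_split_ord /= addrAC subrr add0r.
apply: vge_sum => // i _; apply: vgeMl => //.
by apply: vgeW (vgeX hv _ gx); rewrite ler_wpM2r // ler_nat leq_addr.
Qed.

(** The rate lets a value of the series be compared with that of a truncation. *)
Lemma ps_eval_rate (a : nat -> F) x t : (forall i, vge v 0 (a i)) -> 0 < t ->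
  vge v t x ->
  forall N, vge v (N%:R * t) (\sum_(i < N) a i * x ^+ i - ps_eval v a x).
Proof.
move=> aO t0 gx.
have [M|l hl] := cv (s := fun N => \sum_(i < N) a i * x ^+ i).
  have [N hN] := rat_ltn (M / t); rewrite ltr_pdivrMr // in hN.
  exists N => i j Ni Nj; wlog ji : i j Ni Nj / (j <= i)%N.
    move=> H; case/orP: (leq_total j i) => ?; first exact: H.
    by rewrite -/(vge _ _ _) vge_subC //; apply: H.
  apply: vgeW (ps_tail aO (ltW t0) gx ji); apply: (le_trans (ltW hN)).
  by rewrite ler_pM2r // ler_nat.
rewrite /ps_eval (vlimE hv hl) => N.
have [N1 h1] := hl (N%:R * t).
apply: (vge_trans hv) (h1 (maxn N N1) (leq_maxr _ _)).
by rewrite vge_subC //; apply: ps_tail => //; [apply: ltW|apply: leq_maxl].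
Qed.

End PowerSeries.

Section ResidueSubfield.

Variables (L : fieldType) (v : L -> \bar rat) (k : set L).
Hypotheses (hv : is_valuation v) (resk : residue_subfield v k).

Let kP x : reflect (k x) (x \in [in k]).
Proof. by apply: (iffP idP); rewrite inE /= ?inE. Qed.

Lemma resf1 : k 1.
Proof. by case: resk => -[/kP]. Qed.

Lemma resfB x y : k x -> k y -> k (x - y).
Proof.
case: resk => -[_ hB _] _ _ /kP kx /kP ky; apply/kP; exact: hB.
Qed.

Lemma resf_div x y : k x -> k y -> k (x / y).
Proof.
case: resk => -[_ _ hV] _ _ /kP kx /kP ky; apply/kP; exact: hV.
Qed.

Lemma resf0 : k 0. Proof. by rewrite -(subrr 1); apply: resfB; apply: resf1. Qed.

Lemma resfD x y : k x -> k y -> k (x + y).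
Proof.
by move=> kx ky; rewrite -[y]opprK -[- y]sub0r; do 2?apply: resfB => //; apply: resf0.
Qed.

Lemma resfM x y : k x -> k y -> k (x * y).
Proof.
move=> kx ky; rewrite -[y]invrK -[y^-1]div1r.
by do 2?apply: resf_div => //; apply: resf1.
Qed.

Lemma resfX n x : k x -> k (x ^+ n).
Proof.
by move=> kx; elim: n => [|n IH]; [exact: resf1|rewrite exprS; apply: resfM].
Qed.

Lemma resf_sum (I : Type) (r : seq I) (P : pred I) (f : I -> L) :
  (forall i, P i -> k (f i)) -> k (\sum_(i <- r | P i) f i).
Proof. by move=> h; elim/big_ind: _ => //; [exact: resf0|exact: resfD]. Qed.

Lemma resf_int x : k x -> vge v 0 x.
Proof. by case: resk => _ kO _ /kO. Qed.

Lemma resf_small x : k x -> (0 < v x)%E -> x = 0.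
Proof.
move=> kx vx; case: resk => _ kO /(_ x (kO x kx))[c [_ uc]].
rewrite -(uc x); last by split=> //; rewrite /val_max /= subrr v0.
by apply: uc; split; [exact: resf0|rewrite subr0].
Qed.

Lemma resf_unit x : k x -> x != 0 -> v x = 0%E.
Proof.
move=> kx x0; apply/le_anti/andP; split; last exact: resf_int.
by rewrite leNgt; apply: contra_neqN x0; apply: resf_small.
Qed.

Lemma resf_approx x : vge v 0 x -> exists2 c, k c & (0 < v (x - c))%E.
Proof. by case: resk => _ _ /(_ x) h /h[c [[kc vc] _]]; exists c. Qed.

Lemma val_maxD x y : (0 < v x)%E -> (0 < v y)%E -> (0 < v (x + y)%R)%E.
Proof.
by move=> vx vy; apply: lt_le_trans (Defs.valD hv x y); rewrite lt_min vx.
Qed.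

Lemma val_maxMl x y : vge v 0 x -> (0 < v y)%E -> (0 < v (x * y)%R)%E.
Proof.
move=> gx /(v_gt0P hv)[t t0 gy]; apply: (vge_gt0 t0).
by apply: vgeMl.
Qed.

End ResidueSubfield.

Section ResidueFinite.

Variables (q : nat) (K : fieldType) (vK : K -> \bar rat).
Hypotheses (hK : is_valuation vK) (q1 : (1 < q)%N) (qK : [pchar K].-nat q).
Hypothesis (fermat : forall a, val_ring vK a -> val_max vK (a ^+ q - a)).
Variables (L : fieldExtType K) (v : L -> \bar rat) (k : set L).
Hypotheses (hv : is_valuation v) (vKL : forall a : K, v a%:A = vK a).
Hypothesis (resk : residue_subfield v k).

Let qL : [pchar L].-nat q.
Proof. by rewrite (eq_pnat _ (pchar_lalg L)). Qed.

(** The difference c^q - c lies in the residue subfield and in the maximal ideal. *)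
Lemma resf_fermat x c : val_ring vK x -> k c -> (0 < v (x%:A - c)%R)%E ->
  c ^+ q = c.
Proof.
move=> xO kc vxc; apply/eqP; rewrite -subr_eq0; apply/eqP.
apply: (resf_small hv resk); first by apply: (resfB resk) => //; apply: (resfX resk).
have -> : c ^+ q - c = - (x%:A - c) ^+ q + ((x ^+ q - x)%:A + (x%:A - c)).
  have := frobB qL 1 x%:A c; rewrite expn1 => ->.
  by rewrite scalerBl -!in_algE rmorphXn; ring.
apply: (val_maxD hv); last first.
  by apply: (val_maxD hv) => //; rewrite vKL; apply: fermat.
rewrite vN // -(prednK (ltnW q1)) exprS mulrC; apply: (val_maxMl hv) => //.
by apply: vgeX0 => //; apply: ltW.
Qed.

(** The residue field of a finite extension is algebraic over that of the base:
    reduce an equation of y over K with coprime integral coefficients. Its roots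
    include all the powers y^(q^i), so two of these coincide. *)
Lemma resf_frobenius_fixed y : k y -> exists2 i, (0 < i)%N & y ^+ (q ^ i) = y.
Proof.
move=> ky; have [pz mz] := polyOver1P (minPolyOver 1%AS y).
have rz : (map_poly (in_alg L) pz).[y] = 0 by rewrite -mz minPolyxx.
have pz0 : pz != 0.
  apply: contraTneq (monic_minPoly 1%AS y) => pz0; rewrite mz pz0 rmorph0.
  by rewrite monicE lead_coef0 eq_sym oner_eq0.
have spz : (0 < size pz)%N by rewrite size_poly_gt0.
pose i0 := [arg min_(i < Ordinal spz) vK pz`_(i : 'I_(size pz))]%O.
have min i : (vK pz`_i0 <= vK pz`_i)%E.
  have [ilt|ige] := ltnP i (size pz); last by rewrite [pz`_i]nth_default // (v0 hK) leey.
  by rewrite /i0; case: Order.TotalTheory.arg_minP => // j _ /(_ (Ordinal ilt)); apply.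
have p0 : pz`_i0 != 0.
  apply: contra_neq pz0 => p0; apply/polyP => i; rewrite coef0.
  by apply/eqP; have := min i; rewrite p0 (v0 hK) leye_eq => /eqP/(val_eqy hK) ->.
have [t vt] := v_fin hK p0.
pose a i := pz`_i / pz`_i0.
have aO i : val_ring vK (a i).
  have := min i; rewrite vt => gi.
  suff : vge vK (t - t) (a i) by rewrite subrr.
  by apply: (vgeM hK) => //; rewrite (vgeE _ (vV hK vt)).
have /choice[c hc] (i : nat) : exists c, k c /\ (0 < v ((a i)%:A - c)%R)%E.
  have [|c kc vc] := resf_approx resk (x := (a i)%:A).
    by rewrite /vge vKL; apply: aO.
  by exists c.
pose F := \poly_(i < size pz) c i.
have Fy : F.[y] = 0.
  apply: (resf_small hv resk).
    rewrite horner_poly; apply: (resf_sum resk) => i _.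
    by apply: (resfM resk); [case: (hc i)|apply: (resfX resk)].
  have -> : F.[y] = - \sum_(i < size pz) ((a i)%:A - c i) * y ^+ i.
    under eq_bigr do rewrite mulrBl; rewrite sumrB -horner_poly opprB.
    suff -> : \sum_(i < size pz) (a i)%:A * y ^+ i = 0 by rewrite subr0.
    transitivity ((pz`_i0)^-1 *: (map_poly (in_alg L) pz).[y]); last first.
      by rewrite rz scaler0.
    rewrite horner_coef size_map_poly scaler_sumr; apply: eq_bigr => i _.
    by rewrite coef_map /= -!scalerAl mul1r scalerA mulrC.
  rewrite vN //; elim/big_ind: _ => [||i _]; first by rewrite (v0 hv).
    exact: val_maxD.
  rewrite mulrC; apply: (val_maxMl hv); last by case: (hc i).
  by apply: vgeX0 => //; apply: (resf_int resk).
have F0 : F != 0.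
  apply/negP => /eqP F0; have := congr1 (fun f : {poly L} => f`_i0) F0.
  rewrite coef_poly ltn_ord coef0 => c0; have [_] := hc i0.
  by rewrite c0 subr0 vKL /a divff // (v1 hK) ltxx.
have Ffrob i : root F (y ^+ (q ^ i)).
  apply/rootP; transitivity (F.[y] ^+ (q ^ i)); last first.
    by rewrite Fy expr0n expn_eq0 (gtn_eqF (ltnW q1)).
  rewrite !horner_poly (frob_sum q1 qL); apply: eq_bigr => j _.
  rewrite exprMn -!exprM mulnC; congr (_ * _).
  have cq : c j ^+ q = c j by have [kc vc] := hc j; apply: resf_fermat kc vc.
  by elim: (i) => [|i' IH]; rewrite ?expn0 ?expr1 // expnSr exprM -IH cq.
have [i [j [ij yij]]] : exists i j, (i < j)%N /\ y ^+ (q ^ i) = y ^+ (q ^ j).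
  apply: contrapT => /forallNP h.
  have := max_poly_roots F0 (rs := [seq y ^+ (q ^ i) | i <- iota 0 (size F)]).
  rewrite size_map size_iota ltnn => H; suff : false by []; apply: H.
    by apply/allP => _ /mapP[i _ ->].
  rewrite map_inj_uniq ?iota_uniq // => i j yij.
  have [lt|lt|//] := ltngtP i j; exfalso.
    by apply: (h i); exists j; split.
  by apply: (h j); exists i; split.
exists (j - i)%N; first by rewrite subn_gt0.
apply/eqP; rewrite -subr_eq0; have := frobB qL i (y ^+ (q ^ (j - i))) y.
rewrite -exprM -expnD subnK ?(ltnW ij) // yij subrr => /eqP.
by rewrite expf_eq0 => /andP[].
Qed.

End ResidueFinite.

(** * Totally ramified extensions *)

Section ImageSubfield.

Variables (K : fieldType) (H L : fieldExtType K) (Om : closedFieldType).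
Variables (iK : {rmorphism K -> Om}).
Variables (jH : {rmorphism H -> Om}) (jL : {rmorphism L -> Om}).
Hypotheses (KjH : Kmorphism iK jH) (KjL : Kmorphism iK jL).

Lemma subextension : (forall h, exists x, jL x = jH h) ->
  exists (i : {rmorphism H -> L}) (HL : {subfield L}),
    [/\ forall h, jL (i h) = jH h, forall a : K, i a%:A = a%:A &
        forall x, x \in HL <-> exists h, x = i h].
Proof.
move=> sub; have [i hi] := choice sub; have inj := fmorph_inj jL.
have iB : zmod_morphism i by move=> a b; apply: inj; rewrite rmorphB !hi rmorphB.
have iM : monoid_morphism i.
  by split=> [|a b]; apply: inj; rewrite ?rmorphM ?rmorph1 !hi ?rmorphM ?rmorph1.
pose mB := GRing.isZmodMorphism.Build H L i iB.
pose mM := GRing.isMonoidMorphism.Build H L i iM.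
pose I : {rmorphism H -> L} := HB.pack i mB mM.
have IK (a : K) : I a%:A = a%:A by apply: inj; rewrite hi KjH KjL.
have Ilin : linear I.
  by move=> a x y; rewrite -mulr_algl rmorphD rmorphM IK mulr_algl.
pose mL := GRing.isLinear.Build K H L *:%R i Ilin.
pose IL : {linear H -> L} := HB.pack i mL.
pose U := limg (linfun IL).
have UP x : x \in U <-> exists h, x = I h.
  split=> [/memv_imgP[h _ ->]|[h ->]]; first by exists h; rewrite lfunE.
  by apply/memv_imgP; exists h; rewrite ?memvf // lfunE.
have asp : is_aspace U.
  apply/andP; split; first by apply: has_algid1; apply/UP; exists 1; rewrite rmorph1.
  apply/prodvP => _ _ /UP[x ->] /UP[y ->]; apply/UP.
  by exists (x * y); rewrite rmorphM.
by exists I, (ASpace asp); split.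
Qed.

End ImageSubfield.

Lemma euclid_unique (e i j : nat) (a b : int) : (i < e)%N -> (j < e)%N ->
  a * e%:Z + i%:Z = b * e%:Z + j%:Z -> i = j.
Proof.
move=> ie je E; have := congr1 (fun x => (x %% e%:Z)%Z) E.
by rewrite !modzMDl !modz_nat !modn_small // => -[].
Qed.

Section TotallyRamified.

Variables (q : nat) (K : fieldType) (vK : K -> \bar rat).
Hypotheses (hK : is_valuation vK) (cK : vcomplete vK).
Hypotheses (q1 : (1 < q)%N) (qK : [pchar K].-nat q).
Hypothesis (fermat : forall a, val_ring vK a -> val_max vK (a ^+ q - a)).
Variable (pi : K).
Hypothesis (pi1 : vK pi = 1%:E).
Variables (L : fieldExtType K) (vL : L -> \bar rat).
Hypotheses (hL : is_valuation vL) (vKL : forall a : K, vL a%:A = vK a).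
Variable (k : set L).
Hypothesis (resk : residue_subfield vL k).
Variables (H : {subfield L}) (w : L) (e : nat) (A : seq L).
Hypotheses (intH : forall x, x \in H -> x != 0 -> exists a : int, vL x = a%:~R%:E).
Hypotheses (e0 : (0 < e)%N) (vw : vL w = (1 / e%:R)%:E).
Hypotheses (Hw : <<H; w>>%VS = {:L}%VS) (uA : uniq A) (sA : size A = e) (wA : w \in A).
Hypothesis (AH : \prod_(a <- A) ('X - a%:P) \is a polyOver H).

Let qL : [pchar L].-nat q.
Proof. by rewrite (eq_pnat _ (pchar_lalg L)). Qed.

Let w0 : w != 0. Proof. exact: (v_neq0 hL vw). Qed.

Let e_rat : 0 < e%:R :> rat. Proof. by rewrite ltr0n. Qed.

(** The valuations of the terms are distinct because they differ modulo 1: those of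
    the h_i are integers, and the valuation of w is 1/e. *)
Lemma totally_ramified_ge N (h : 'I_N -> L) t : (N <= e)%N ->
  (forall i, h i \in H) -> vge vL t (\sum_i h i * w ^+ i) ->
  forall i, vge vL t (h i * w ^+ i).
Proof.
move=> Ne hH; apply: (vge_sum_distinct hL) => i j xi xj ij.
have hi0 : h i != 0 by apply: contraNneq xi => ->; rewrite mul0r.
have hj0 : h j != 0 by apply: contraNneq xj => ->; rewrite mul0r.
have [a va] := intH (hH i) hi0; have [b vb] := intH (hH j) hj0.
rewrite (vM hL va (vX hL i vw)) (vM hL vb (vX hL j vw)).
apply/negP => /eqP[] E; move/negP: ij; apply; apply/eqP/val_inj => /=.
have E' : a * e%:Z + i%:Z = b * e%:Z + j%:Z.
  apply: (@intr_inj rat); rewrite !rmorphD !rmorphM /= -!pmulrn.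
  have en : e%:R != 0 :> rat by rewrite gt_eqF.
  transitivity ((a%:~R + i%:R * (1 / e%:R)) * e%:R : rat); first by field.
  by rewrite E; field.
by have := euclid_unique (leq_trans (ltn_ord i) Ne) (leq_trans (ltn_ord j) Ne) E'.
Qed.

Lemma degree_le_e : (adjoin_degree H w <= e)%N.
Proof.
have A0 : \prod_(a <- A) ('X - a%:P) != 0 by apply/monic_neq0/monic_prod_XsubC.
have rw : root (\prod_(a <- A) ('X - a%:P)) w by rewrite root_prod_XsubC.
have := dvdp_leq A0 (minPoly_dvdp AH rw).
by rewrite size_minPoly size_prod_XsubC sA ltnS.
Qed.

(** A relation of smaller degree would be a vanishing sum of terms with distinct
    valuations. *)
Lemma degree_ge_e : (e <= adjoin_degree H w)%N.
Proof.
rewrite leqNgt; apply/negP => lt; set N := adjoin_degree H w in lt.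
have E : \sum_(i < N.+1) (minPoly H w)`_i * w ^+ i = 0.
  by have := minPolyxx H w; rewrite horner_coef size_minPoly.
have cH (i : 'I_N.+1) : (minPoly H w)`_i \in H.
  exact: (polyOverP (minPolyOver H w)).
have := fun t => @totally_ramified_ge N.+1 (fun i => (minPoly H w)`_i) t lt cH.
rewrite E => h; have : w ^+ N = 0.
  apply: (vge_eq0 hL) => t; have := h t%:R (vge0 hL _) ord_max.
  have -> : (minPoly H w)`_(@ord_max N) = 1.
    by have := monicP (monic_minPoly H w); rewrite lead_coefE size_minPoly.
  by rewrite mul1r.
by apply/eqP; rewrite expf_eq0 (negbTE w0) andbF.
Qed.

Let H_int_ge0 x t : x \in H -> -1 < t -> vge vL t x -> vge vL 0 x.
Proof.
move=> xH t1; have [->|x0] := eqVneq x 0; first by move=> _; apply: vge0.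
have [a va] := intH xH x0; rewrite !(vgeE _ va) => ta.
have : -1 < a%:~R :> rat by apply: lt_le_trans ta.
by rewrite -[-1]/((-1)%:~R) ltr_int ler0z -lezD1 addNr.
Qed.

(** The constants of L lie in H: such a y is fixed by a power of Frobenius and
    congruent to some h in H, of which it is the limit of Frobenius iterates. *)
Lemma residue_sub y : k y -> y \in H.
Proof.
move=> ky; have [n n0 yn] := resf_frobenius_fixed hK q1 qK fermat hL vKL resk ky.
have yO := resf_int resk ky.
have yL : y \in <<H; w>>%VS by rewrite Hw memvf.
pose P := Fadjoin_poly H w y.
have sP : (size P <= e)%N := leq_trans (size_Fadjoin_poly _ _ _) degree_le_e.
have PH i : P`_i \in H := polyOverP (Fadjoin_polyOver H w y) i.
have yE : y = \sum_(i < e) P`_i * w ^+ i.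
  by rewrite -[LHS](Fadjoin_poly_eq yL) (horner_coef_wide _ sP).
have gP : forall i : 'I_e, vge vL 0 (P`_i * w ^+ i).
  by apply: (totally_ramified_ge (h := fun i => P`_i)) => //; rewrite -yE.
have PO (i : 'I_e) : vge vL 0 P`_i.
  apply: (@H_int_ge0 _ (- (i%:R / e%:R))) => //.
    by rewrite ltrN2 ltr_pdivrMr // mul1r ltr_nat.
  have -> : P`_i = P`_i * w ^+ i * (w ^+ i)^-1 by rewrite mulfK // expf_neq0.
  rewrite -[- _]add0r; apply: vgeM => //.
  by rewrite (vgeE _ (vV hL (vX hL i vw))) mul1r.
have h0H : P`_0 \in H by [].
have dy : vge vL (1 / e%:R) (y - P`_0).
  rewrite {1}yE (bigD1 (Ordinal e0)) //= expr0 mulr1 addrAC subrr add0r.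
  apply: vge_sum => // i i0; apply: vgeMl => //.
  have ip : (0 < i)%N by rewrite lt0n; apply: contraNneq i0 => i0; apply/eqP/val_inj.
  rewrite -(prednK ip) exprS; apply: vgeMr => //; first by rewrite (vgeE _ vw).
  by apply: vgeX0 => //; rewrite (vgeE _ vw) divr_ge0 // ltW.
have yNn N : y ^+ (q ^ (N * n)) = y.
  by elim: N => [|N IH]; rewrite ?mul0n ?expr1 // mulSn expnD exprM yn.
apply: (subspace_closed hK cK hL vKL (s := fun N => P`_0 ^+ (q ^ (N * n)))).
  by move=> N; apply: rpredX.
move=> M; have [N hN] := rat_ltn (M * e%:R); exists N => i Ni.
rewrite -/(vge _ _ _) vge_subC // -[y in y - _](yNn i) -(frobB qL).
apply: vgeW (vgeX hL _ dy); rewrite mulrA mulr1 ler_pdivlMr //.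
apply: (le_trans (ltW hN)); rewrite ler_nat; apply: (leq_trans Ni).
by apply: (leq_trans _ (ltnW (ltn_expl _ q1))); rewrite leq_pmulr.
Qed.

Let S := <<1; separable_generator 1 {:L}>>%AS.

Let sep_sub x : separable_element 1 x -> x \in S.
Proof.
move=> sx; rewrite -separable_inseparable_element (separable_elementS (sub1v S)) //=.
have /purely_inseparableP := separable_generator_maximal {:L}%AS 1%AS.
by apply; rewrite memvf.
Qed.

Let S_sep x : x \in S -> separable_element 1 x.
Proof. by move=> xS; apply: (adjoin_separableP (separable_generatorP {:L}%AS 1%AS)). Qed.

(** It is a root of X^(q^n) - X. *)
Lemma residue_separable y : k y -> separable_element 1 y.
Proof.
move=> ky; have [n n0 yn] := resf_frobenius_fixed hK q1 qK fermat hL vKL resk ky.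
pose f : {poly L} := 'X^(q ^ n) - 'X.
have fO : f \is a polyOver 1%VS by rewrite rpredB ?polyOverXn ?polyOverX.
have rf : root f y by rewrite /root !hornerE yn subrr.
apply: dvdp_separable (minPoly_dvdp (K := 1%AS) fO rf) _.
have df : f^`() = - 1.
  have pL : pdiv q \in [pchar L] by apply: (pnatPpi qL); rewrite pi_pdiv.
  rewrite /f derivB derivXn derivX -mulr_natr.
  suff -> : (q ^ n)%:R = 0 :> {poly L} by rewrite mulr0 sub0r.
  apply/eqP; rewrite -(dvdn_pcharf (p := pdiv q)) ?pchar_poly //.
  by rewrite (dvdn_trans (pdiv_dvd q)) // dvdn_exp.
by rewrite separable_poly.unlock df -scaleN1r coprimepZr ?coprimep1 // oppr_eq0 oner_eq0.
Qed.

(** An integral element of H is the sum of a series in pi with coefficients in the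
    residue subfield, and the field S of separable elements is closed. *)
Lemma H_sub_separable x : x \in H -> x \in S.
Proof.
have piH (N : nat) : (pi ^+ N)%:A \in H by rewrite memvZ ?mem1v.
have vpi N : vL (pi ^+ N)%:A = N%:R%:E by rewrite vKL (vX hK _ pi1) mulr1.
have appr N : forall y, y \in H -> vge vL 0 y -> exists2 s, s \in S & vge vL N%:R (y - s).
  elim: N => [|N IH] y yH yO; first by exists 0; rewrite ?mem0v ?subr0.
  have [c kc vc] := resf_approx resk yO; have cH := residue_sub kc.
  pose z := (y - c) / pi%:A.
  have pi0 : pi%:A != 0 :> L by have := v_neq0 hL (vpi 1%N); rewrite expr1.
  have piH1 : pi%:A \in H by have := piH 1%N; rewrite expr1.
  have vpi1 : vL pi%:A = 1%:E by have := vpi 1%N; rewrite expr1.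
  have zH : z \in H by rewrite rpred_div // rpredB.
  have zO : vge vL 0 z.
    have [t t0 gt] := v_gt0P hL vc.
    apply: (@H_int_ge0 _ (t - 1)) => //; first by lra.
    by apply: vgeM => //; rewrite (vgeE _ (vV hL vpi1)).
  have [s sS gs] := IH z zH zO.
  exists (c + pi%:A * s).
    by rewrite rpredD ?rpredM ?memvZ ?mem1v // sep_sub // residue_separable.
  have -> : y - (c + pi%:A * s) = pi%:A * (z - s) by rewrite /z; field.
  by rewrite -add1n natrD; apply: vgeM => //; rewrite (vgeE _ vpi1).
move=> xH; have [N hN] : exists N, vge vL 0 ((pi ^+ N)%:A * x).
  have [D hD] := vge_lower hL x; exists D; rewrite -(subrr D%:R).
  by apply: vgeM => //; rewrite (vgeE _ (vpi D)).
set y := _ * x in hN; have yH : y \in H by rewrite rpredM.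
have [s hs] := choice (fun N => let: ex_intro2 s a b := appr N y yH hN in ex_intro _ s (conj a b)).
have yS : y \in S.
  apply: (subspace_closed hK cK hL vKL (s := s)) => [i|M]; first by have [] := hs i.
  have [i0 hi0] := rat_ltn M; exists i0 => i ii0; have [_] := hs i.
  rewrite vge_subC //; apply: vgeW; apply: (le_trans (ltW hi0)).
  by rewrite ler_nat.
have -> : x = y / (pi ^+ N)%:A by rewrite /y mulrAC divff ?mul1r // (v_neq0 hL (vpi N)).
by rewrite rpred_div // memvZ ?mem1v.
Qed.

(** H consists of separable elements, and w is a root of a polynomial over H
    without multiple roots. *)
Lemma totally_ramified_separable : separable 1 {:L}.
Proof.
have sH : separable 1 H by apply/separableP => x /H_sub_separable/S_sep.
apply: (separable_trans (M := H)) => //.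
suff : separable H <<H; w>> by rewrite Hw.
rewrite -adjoin_separable_eq.
apply: dvdp_separable (minPoly_dvdp AH _) _; first by rewrite root_prod_XsubC.
by rewrite separable_prod_XsubC.
Qed.

End TotallyRamified.

(** * Polynomial approximation of units *)

Section Approximation.

Variables (q : nat) (L : fieldType) (vL : L -> \bar rat).
Hypotheses (hL : is_valuation vL) (cL : vcomplete vL).
Hypotheses (q1 : (1 < q)%N) (qL : [pchar L].-nat q).
Variable (k : set L).
Hypothesis (resk : residue_subfield vL k).
Variables (w : L) (e : nat).
Hypotheses (e0 : (0 < e)%N) (vw : vL w = (1 / e%:R)%:E).
Variables (u : L) (g : nat -> L).
Hypotheses (u_unit : vL u = 0%E) (gk : forall i, k (g i)).
Hypothesis (gu : ps_eval vL g w = u).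

Let e_rat : 0 < e%:R :> rat. Proof. by rewrite ltr0n. Qed.

Let ie_gt0 : 0 < 1 / e%:R :> rat. Proof. by rewrite divr_gt0. Qed.

Let gO i : vge vL 0 (g i). Proof. exact: (resf_int resk). Qed.

Let gw : vge vL (1 / e%:R) w. Proof. by rewrite (vgeE _ vw). Qed.

Let wO : vge vL 0 w. Proof. by apply: vgeW gw; apply: ltW. Qed.

Lemma ps_rate N : vge vL (N%:R / e%:R) (\sum_(i < N) g i * w ^+ i - u).
Proof. by have := ps_eval_rate hL cL gO ie_gt0 gw N; rewrite gu mulrA mulr1. Qed.

(** The valuation of u - 1 is that of the first term of the series g - 1. *)
Lemma series_near1 (t : rat) : 0 <= t -> (t%:E < vL (1 - u)%R)%E ->
  exists h : nat, t * e%:R < h%:R /\ forall i, (i < h)%N -> g i = (i == 0%N)%:R.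
Proof.
move=> t0 tu; have [bad|nbad] := pselect (exists i, g i != (i == 0%N)%:R); last first.
  have [N hN] := rat_ltn (t * e%:R); exists N; split=> // i _.
  by apply/eqP/negP => /negP gi; apply: nbad; exists i.
exists (ex_minn bad); case: ex_minnP => h gh min; split; last first.
  by move=> i ih; apply/eqP; apply: contraLR ih; rewrite -leqNgt => /min.
pose d := g h - (h == 0%N)%:R.
have kd : k d.
  by apply: (resfB resk) => //; case: (h == 0%N); [exact: (resf1 resk)|exact: (resf0 resk)].
have d0 : d != 0 by rewrite subr_eq0.
have vd : vL (d * w ^+ h) = (h%:R / e%:R)%:E.
  by rewrite (vM hL (resf_unit hL resk kd d0) (vX hL h vw)) add0r mulrA mulr1.
have E : \sum_(i < h.+1) g i * w ^+ i - 1 = d * w ^+ h.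
  rewrite big_ord_recr /= /d mulrBl.
  have -> : \sum_(i < h) g i * w ^+ i = \sum_(i < h) (i == 0%N :> nat)%:R.
    apply: eq_bigr => i _.
    have -> : g i = (i == 0%N :> nat)%:R.
      by apply/eqP; apply: contraT => /min; rewrite leqNgt ltn_ord.
    by case: eqP => [->|_]; rewrite ?mulr1 ?mul0r.
  case: (h) => [|h'] /=; first by rewrite big_ord0 add0r expr0 !mulr1.
  by rewrite big_ord_recl big1 // addr0 mul0r subr0 addrAC subrr add0r.
have := ps_rate h.+1; rewrite -[X in X - u](subrK 1) E -addrA.
move=> gh1; rewrite ltNge; apply/negP => ht.
have : (vL (d * w ^+ h) < vL (1 - u)%R)%E.
  by rewrite vd; apply: le_lt_trans tu; rewrite lee_fin ler_pdivrMr.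
move/(v_add_lt hL vd) => v1; move: gh1; rewrite /vge v1 vd lee_fin.
rewrite leNgt => /negP; apply; rewrite ltr_pM2r ?invr_gt0 //.
by rewrite ltr_nat.
Qed.

(** The form 1 + X^h Y of a truncation is inherited by its powers. *)
Lemma pow_1add_Xn (S : subringClosed L) (h : nat) (Y : {poly L}) j : Y \is a polyOver S ->
  exists2 Z : {poly L}, Z \is a polyOver S & (1 + 'X^h * Y) ^+ j = 1 + 'X^h * Z.
Proof.
move=> YS; elim: j => [|j [Z ZS E]]; first by exists 0; rewrite ?rpred0 // mulr0 addr0.
exists (Y + Z + 'X^h * (Y * Z)); last by rewrite exprS E; ring.
by rewrite !rpredD ?rpredM ?polyOverXn.
Qed.

(** The approximations of 1/u and of its logarithmic derivative come from the
    truncation G of the series g, and W = G^(Q - 1) for Q a large power of q, so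
    that W G = G^Q is close to 1 while the derivative of W is -G^(Q-2) G'. *)
Lemma approximating_polynomials (t : rat) (kap Q0 : nat) (S : subringClosed L) :
  0 <= t -> (t%:E < vL (1 - u)%R)%E -> (0 < Q0)%N -> (forall x, k x -> x \in S) ->
  exists (h : nat) (W V Y : {poly L}),
  [/\ t * e%:R < h%:R, W = 1 + 'X^h * Y,
     [/\ Y \is a polyOver (vint hL), V \is a polyOver (vint hL),
      W \is a polyOver S & V \is a polyOver S],
     forall x, vge vL (1 / Q0%:R) x -> vge vL kap%:R (V.[x] * W.[x] - x * (W^`()).[x]) &
     vge vL kap%:R (u^-1 - W.[w]) /\
     vge vL kap%:R ((1 - u) / u * (1 - ps_eval vL (ps_deriv g) w / u * w)
       - ((W - 1) * (1 + V)).[w])].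
Proof.
move=> t0 tu Q00 kS; have [h [th gh]] := series_near1 t0 tu.
have h0 : (0 < h)%N.
  by rewrite -(ltr_nat rat); apply: le_lt_trans th; rewrite mulr_ge0 // ltW.
pose N := (h + (kap * e).+1)%N; pose G : {poly L} := \poly_(i < N) g i.
have Nrat : kap%:R <= N.-1%:R / e%:R :> rat.
  by rewrite ler_pdivlMr // -natrM ler_nat /N; lia.
have Nrat' : kap%:R <= N%:R / e%:R :> rat.
  apply: (le_trans Nrat); rewrite ler_pM2r ?invr_gt0 // ler_nat; exact: leq_pred.
pose Y0 : {poly L} := \poly_(i < N - h) g (i + h)%N.
have GE : G = 1 + 'X^h * Y0.
  apply/polyP => i; rewrite coefD coef1 coefXnM !coef_poly.
  have [ih|hi] := ltnP i h.
    by rewrite gh // addr0 (leq_trans ih) // leq_addr.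
  rewrite (gtn_eqF (leq_trans h0 hi)) add0r ltn_sub2rE // subnK //.
have GO : G \is a polyOver (vint hL).
  by apply/polyOverP => i; rewrite coef_poly; case: ifP => _; [exact: gO|exact: rpred0].
have GS : G \is a polyOver S.
  by apply/polyOverP => i; rewrite coef_poly; case: ifP => _; [exact: kS|exact: rpred0].
have Y0O : Y0 \is a polyOver (vint hL).
  by apply/polyOverP => i; rewrite coef_poly; case: ifP => _; [exact: gO|exact: rpred0].
pose m := (kap * Q0 + kap * e).+1; pose Q := (q ^ m)%N.
have Q1 : (1 < Q)%N by rewrite -(exp1n m) ltn_exp2r.
have [Q2 QE] : exists Q2, Q = Q2.+2 by exists Q.-2; rewrite -subn2 -addn2 subnK.
have Qbig : (kap * Q0 + kap * e <= Q)%N.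
  by apply: (leq_trans _ (ltnW (ltn_expl _ q1))); apply: leqnSn.
have [Y YO WE] := pow_1add_Xn (S := vint hL) h Q.-1 Y0O.
rewrite -GE in WE; pose W := G ^+ Q.-1; pose V := - ('X * G^`() * W).
have WS : W \is a polyOver S by apply: rpredX.
have G'S (T : subringClosed L) : G \is a polyOver T -> G^`() \is a polyOver T.
  move=> GT; apply/polyOverP => i; rewrite coef_deriv; apply: rpredMn.
  exact: (polyOverP GT).
have VT (T : subringClosed L) : G \is a polyOver T -> V \is a polyOver T.
  by move=> GT; rewrite rpredN !rpredM ?polyOverX ?G'S ?rpredX.
have WG x : W.[x] * G.[x] = G.[x] ^+ Q.
  by rewrite /W horner_exp -exprSr prednK // ltnW.
have GQ x d : vge vL (1 / d%:R) x -> (0 < d)%N -> (kap * d <= Q)%N ->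
    vge vL kap%:R (1 - G.[x] ^+ Q).
  move=> gx d0 dQ; have -> : 1 - G.[x] ^+ Q = (1 - G.[x]) ^+ Q.
    by have := frobB qL m 1 G.[x]; rewrite /= expr1n => ->.
  have d_rat : 0 < d%:R :> rat by rewrite ltr0n.
  have g1 : vge vL (1 / d%:R) (1 - G.[x]).
    rewrite GE hornerD hornerC opprD addrA subrr sub0r vgeN // hornerM hornerXn.
    have xO : vge vL 0 x by apply: vgeW gx; rewrite divr_ge0 // ltW.
    apply: vgeMr => //; last by apply: int_horner.
    apply: vgeW (vgeX hL h gx); rewrite ler_peMl ?ler1n //.
    by rewrite divr_ge0 // ltW.
  apply: vgeW (vgeX hL Q g1); rewrite mulrA mulr1 ler_pdivlMr //.
  by rewrite -natrM ler_nat.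
exists h, W, V, Y; split=> //.
- by split=> //; [exact: (VT (vint hL))|exact: VT].
- move=> x gx; have xO : vge vL 0 x by apply: vgeW gx; rewrite divr_ge0.
  have W' : W^`() = - (G^`() * G ^+ Q2).
    rewrite /W deriv_exp QE /=; rewrite -mulr_natr.
    have pL : pdiv q \in [pchar L] by apply: (pnatPpi qL); rewrite pi_pdiv.
    have -> : Q2.+1%:R = - 1 :> {poly L}.
      apply/eqP; rewrite -addr_eq0 natr1 -QE -(dvdn_pcharf (p := pdiv q)) ?pchar_poly //.
      by rewrite (dvdn_trans (pdiv_dvd q)) // dvdn_exp.
    by rewrite mulrN1.
  have -> : V.[x] * W.[x] - x * W^`().[x] =
     x * (G^`()).[x] * G.[x] ^+ Q2 * (1 - G.[x] ^+ Q).
    rewrite W' /V /W QE /= !(hornerN, hornerM, hornerX, horner_exp) !exprS; ring.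
  apply: vgeMl => //; last by apply: (GQ x Q0) => //; apply: leq_trans Qbig; exact: leq_addr.
  apply: vgeMl => //; last by apply: vgeX0 => //; apply: int_horner.
  by apply: vgeMl => //; apply: int_horner => //; apply: (G'S (vint hL)).
have Gu : vge vL kap%:R (G.[w] - u).
  by apply: vgeW Nrat' _; rewrite horner_poly; apply: ps_rate.
have gdO i : vge vL 0 (ps_deriv g i) by apply: vgeMn.
set D := ps_eval vL (ps_deriv g) w.
have G'D : vge vL kap%:R ((G^`()).[w] - D).
  apply: vgeW Nrat _; have := ps_eval_rate hL cL gdO ie_gt0 gw N.-1.
  rewrite mulrA mulr1 -/D; congr (vge _ _ (_ - _)).
  rewrite (@horner_coef_wide _ N.-1).
    apply: eq_bigr => i _; rewrite coef_deriv coef_poly.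
    by rewrite -ltn_predRL ltn_ord.
  apply/leq_sizeP => j Nj; rewrite coef_deriv coef_poly ltnNge.
  by rewrite (leq_trans _ (_ : N.-1.+1 <= j.+1)%N) ?leqSpred ?mul0rn.
have vu1 : vge vL 0 u^-1 by apply: vge_inv_unit.
have uO : vge vL 0 u by rewrite /vge u_unit.
have un0 := v_neq0 hL u_unit.
have WO : vge vL 0 W.[w] by apply: int_horner => //; apply: rpredX.
have G'O : vge vL 0 (G^`()).[w] by apply: int_horner => //; apply: (G'S (vint hL)).
have Wu : vge vL kap%:R (u^-1 - W.[w]).
  have -> : u^-1 - W.[w] = (1 - G.[w] ^+ Q + W.[w] * (G.[w] - u)) / u.
    by rewrite -WG; field.
  rewrite vge_div_unit //; apply: vgeD => //; last exact: vgeMl.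
  by apply: (GQ w e) => //; apply: leq_trans Qbig; apply: leq_addl.
split=> //.
have V1O : vge vL 0 (1 + V).[w].
  by apply: int_horner; rewrite // rpredD ?rpred1 // (VT (vint hL)).
have -> : (1 - u) / u * (1 - D / u * w) - ((W - 1) * (1 + V)).[w] =
  (u^-1 - W.[w]) * (1 + V).[w] +
  (1 - u) / u * w * ((G^`()).[w] * (W.[w] - u^-1) + u^-1 * ((G^`()).[w] - D)).
  rewrite /V; move: (W) => W1.
  rewrite !(hornerM, hornerD, hornerN, hornerX, hornerC); field.
  exact: un0.
apply: vgeD => //; first exact: vgeMr.
apply: vgeMl => //.
  apply: vgeMl => //; rewrite vge_div_unit //; apply: vgeB => //; exact: vge1.
by apply: vgeD => //; apply: vgeMl => //; rewrite vge_subC.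
Qed.

End Approximation.

(** * The torsion field *)

Local Open Scope classical_set_scope.
Local Open Scope ring_scope.

Lemma set_inP (T : Type) (S : set T) x : reflect (S x) (x \in [in S]).
Proof. by apply: (iffP idP); rewrite inE /= ?inE. Qed.

Section TorsionField.

Variables (p q : nat) (K : fieldType) (muK : K -> \bar rat).
Hypotheses (charK : p \in [pchar K]) (locK : is_local_field muK q).
Variables (Omega : closedFieldType) (iK : {rmorphism K -> Omega}).
Variables (Omegabar : fieldType) (iO : {rmorphism Omega -> Omegabar}).
Variable (mu : Omegabar -> \bar rat).
Hypotheses (val_mu : is_valuation mu) (complO : vcomplete mu).
Hypothesis (mu_muK : forall a : K, mu (iO (iK a)) = muK a).
Variables (H : fieldExtType K) (jH : {rmorphism H -> Omega}).
Hypotheses (KjH : Kmorphism iK jH).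
Hypothesis (unrH : unramified muK (mu \o (iO \o jH))).
Variable (rho : K -> nat -> H).
Hypothesis (rhoP : is_drinfeld_height1 muK q (mu \o (iO \o jH)) rho).
Variables (L : fieldExtType K) (jL : {rmorphism L -> Omega}).
Hypotheses (KjL : Kmorphism iK jL).
Variables (a : K) (s : nat).
Hypothesis (va : muK a = s.+1%:R%:E).

Local Notation W := (drin_torsion mu q (fun b => (iO \o jH) \o rho b) a).

Hypothesis (defL : range (iO \o jL) =
  subfield_gen (range (iO \o jH) `|` W)).
Variable (w : L).
Hypothesis (gen_w :
  drin_generator mu q muK (fun b => (iO \o jH) \o rho b) W ((iO \o jL) w)).

Let hK : is_valuation muK := lf_val locK.
Let cK : vcomplete muK := lf_complete locK.
Let hO : is_valuation (mu \o iO) := valuation_comp iO val_mu.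

Lemma val_H : is_valuation (mu \o (iO \o jH)).
Proof. exact: (valuation_comp (iO \o jH) val_mu). Qed.

Lemma val_L : is_valuation (mu \o (iO \o jL)).
Proof. exact: (valuation_comp (iO \o jL) val_mu). Qed.

Lemma val_HK (b : K) : (mu \o (iO \o jH)) b%:A = muK b.
Proof. by rewrite /= KjH mu_muK. Qed.

Lemma val_LK (b : K) : (mu \o (iO \o jL)) b%:A = muK b.
Proof. by rewrite /= KjL mu_muK. Qed.

Let cH : vcomplete (mu \o (iO \o jH)) := finite_ext_complete hK cK val_H val_HK.

Let q1 : (1 < q)%N := residue_order_gt1 locK.

Let qK : [pchar K].-nat q.
Proof. by have [] := drinfeld_power charK locK val_H val_HK rhoP. Qed.

Let qO : [pchar Omega].-nat q.
Proof. by rewrite (eq_pnat _ (fmorph_pchar iK)). Qed.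

Let range_sub x : (range (iO \o jH) `|` W) x -> exists y, iO (jL y) = x.
Proof.
move=> Wx; have : range (iO \o jL) x by rewrite defL; apply: sub_gen_smallest.
by case=> y _ <-; exists y.
Qed.

Let jH_sub (h : H) : exists y, jL y = jH h.
Proof.
have [|y yE] := @range_sub (iO (jH h)); first by left; exists h.
by exists y; apply: (fmorph_inj iO).
Qed.

(** The arithmetic of the torsion field. The torsion points are the roots rs of the
    torsion polynomial P of level s + 1, which has q^(s+1) of them; rs1 are those of
    level s, and the others are the images of A. If P1 is the polynomial of level
    s then P = P1^q + d P1, so that the product of the X - b over A is
    P1^(q-1) + d, with coefficients in H, and P1(w)^(q-1) = -d determines the
    valuation of w. The field generated by w over H is closed and contains all
    the torsion, whose points are sums of series at w. *)
Lemma torsion_field : exists (HL : {subfield L}) (A : seq L) (c c1 : nat -> Omega)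
    (rs rs1 : seq Omega),
  [/\ [/\ forall x, x \in HL -> x != 0 ->
            exists k : int, (mu \o (iO \o jL)) x = k%:~R%:E,
          <<HL; w>>%VS = {:L}%VS & \prod_(b <- A) ('X - b%:P) \is a polyOver HL],
      [/\ uniq A, size A = (q ^ s * (q - 1))%N, w \in A &
          (mu \o (iO \o jL)) w = (1 / (q ^ s * (q - 1))%:R)%:E],
      [/\ level (mu \o iO) c s.+1, uniq rs,
          qpol q c s.+1 = \prod_(x <- rs) ('X - x%:P) &
          forall x, x \in rs -> exists y, jL y = x],
      [/\ level (mu \o iO) c1 s, uniq rs1 &
          qpol q c1 s = \prod_(x <- rs1) ('X - x%:P)] &
      perm_eq rs (rs1 ++ [seq jL b | b <- A])].
Proof.
have [pi pi1 u1] := drin_unit rhoP.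
pose psi : {rmorphism H -> Omegabar} := iO \o jH.
have vpsi y : mu (psi y) = (mu \o (iO \o jH)) y by [].
have tower k : exists c, torsion_poly q (mu \o (iO \o jH)) rho mu psi pi k c.
  elim: k => [|k [c tp]].
    by exists (fun=> 0); exact: (torsion_poly0 hK val_H rhoP mu psi pi1).
  have [d [c' [_ tp' _]]] := torsion_polyS hK q1 qK val_H cH val_HK rhoP val_mu complO
    vpsi pi1 u1 tp.
  by exists c'.
have [c1 tp1] := tower s.
have [d [c [vd tp PE]]] := torsion_polyS hK q1 qK val_H cH val_HK rhoP val_mu complO
    vpsi pi1 u1 tp1.
have [lc c0 _ _] := tp; have [lc1 c10 _ hval] := tp1.
pose cO := jH \o c; pose c1O := jH \o c1.
have lcO : level (mu \o iO) cO s.+1 by [].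
have lc1O : level (mu \o iO) c1O s by [].
have [rs] := closed_field_poly_normal (qpol q cO s.+1).
rewrite (monicP (qpol_monic q1 _ _)) scale1r => rsE.
have [rs1] := closed_field_poly_normal (qpol q c1O s).
rewrite (monicP (qpol_monic q1 _ _)) scale1r => rs1E.
have urs : uniq rs.
  by apply: (qpol_uniq_roots q1 qO _ rsE) => _; rewrite /= fmorph_eq0 c0.
have urs1 : uniq rs1.
  by apply: (qpol_uniq_roots q1 qO _ rs1E) => s0; rewrite /= fmorph_eq0 c10.
have srs : size rs = (q ^ s.+1)%N.
  by have := size_qpol q1 cO s.+1; rewrite rsE size_prod_XsubC => -[].
have srs1 : size rs1 = (q ^ s)%N.
  by have := size_qpol q1 c1O s; rewrite rs1E size_prod_XsubC => -[].
pose fH : {poly H} := qpol q c1 s ^+ q.-1 + d%:P.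
have PfH : qpol q c s.+1 = qpol q c1 s * fH.
  by rewrite PE /fH mulrDr -exprS prednK ?(ltnW q1) // mulrC mul_polyC.
have POE : qpol q cO s.+1 = qpol q c1O s * map_poly jH fH.
  by rewrite -!map_qpol PfH rmorphM.
have rs_sub : {subset rs1 <= rs}.
  move=> x; rewrite -!root_prod_XsubC -rsE -rs1E POE /root hornerM => /eqP ->.
  by rewrite mul0r.
have toOb k x : (qpol q (psi \o k) s).[iO x] = iO (qpol q (jH \o k) s).[x].
  by rewrite -horner_map map_qpol.
have toOb' k x : (qpol q (psi \o k) s.+1).[iO x] = iO (qpol q (jH \o k) s.+1).[x].
  by rewrite -horner_map map_qpol.
have rs_gt0 x : x \in rs -> (0 < mu (iO x))%E.
  move=> xrs; apply: (qpol_root_gt0 (v := mu \o iO) hO q1 lcO).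
  by rewrite rsE root_prod_XsubC.
have rs_root x : x \in rs -> (qpol q cO s.+1).[x] = 0.
  by move=> xrs; apply/rootP; rewrite rsE root_prod_XsubC.
have torP x : (0 < mu x)%E ->
    tps_eval mu q (psi \o rho a) x = 0 <-> (qpol q (psi \o c) s.+1).[x] = 0.
  exact: (torsion_polyP hK q1 qK val_HK rhoP val_mu complO vpsi pi1 tp va).
have rsL x : x \in rs -> exists y, jL y = x.
  move=> xrs; have [|y yE] := @range_sub (iO x).
    right; split; first exact: rs_gt0.
    by apply/torP; [exact: rs_gt0|rewrite toOb' rs_root ?rmorph0].
  by exists y; apply: (fmorph_inj iO).
have /choice[pre hpre] (x : Omega) : exists y : L, x \in rs -> jL y = x.
  by have [/rsL[y yE]|_] := boolP (x \in rs); [exists y|exists 0].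
pose AO := [seq x <- rs | x \notin rs1]; pose A := [seq pre x | x <- AO].
have AOrs x : x \in AO -> x \in rs by rewrite mem_filter => /andP[].
have AE : [seq jL b | b <- A] = AO.
  rewrite -map_comp -[RHS]map_id; apply/eq_in_map => x /AOrs; exact: hpre.
have permA : perm_eq rs (rs1 ++ AO).
  apply: uniq_perm => //.
    rewrite cat_uniq urs1 filter_uniq // andbT; apply/hasPn => x.
    by rewrite mem_filter => /andP[].
  move=> x; rewrite mem_cat mem_filter; have [/rs_sub ->|] := boolP (x \in rs1) => //.
have uA : uniq A by apply: (map_uniq (f := jL)); rewrite AE filter_uniq.
have sA : size A = (q ^ s * (q - 1))%N.
  have := perm_size permA; rewrite size_cat srs srs1 -AE !size_map expnSr.
  by rewrite mulnBr muln1 => ->; rewrite addKn.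
have [iHL [HL [iHLE iHLK HLP]]] := subextension KjH KjL jH_sub.
have AHL : \prod_(b <- A) ('X - b%:P) = map_poly iHL fH.
  apply: (map_poly_inj jL); rewrite rmorph_prod /= -map_poly_comp.
  have -> : map_poly (jL \o iHL) fH = map_poly jH fH.
    by apply: eq_map_poly => h /=; rewrite iHLE.
  have P10 : qpol q c1O s != 0 by rewrite monic_neq0 ?qpol_monic.
  apply: (mulfI P10); rewrite -POE rsE (perm_big _ permA) big_cat -rs1E /=.
  rewrite -AE; congr (_ * _); rewrite [RHS]big_map; apply: eq_bigr => b _.
  by rewrite rmorphB /= map_polyX map_polyC.
have gen_w' := gen_w; have [[vw wtor] _] := gen_w'.
have wrs : jL w \in rs.
  rewrite -root_prod_XsubC -rsE; apply/rootP/(fmorph_inj iO).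
  by rewrite -toOb' rmorph0; apply/torP.
have wlow : (qpol q c1O s).[jL w] != 0.
  have := generator_exact_level hK q1 qK val_HK rhoP val_mu complO vpsi pi1
    (rs := [seq iO x | x <- rs]) tp1 tp va gen_w.
  rewrite map_inj_uniq ?size_map; last exact: fmorph_inj.
  move=> /(_ urs srs) h; apply/negP => /eqP w0; apply: h; last first.
    by rewrite toOb w0 rmorph0.
  move=> _ /mapP[x xrs ->]; split; first exact: rs_gt0.
  by rewrite toOb' rs_root ?rmorph0.
have wAO : jL w \in AO.
  by rewrite mem_filter wrs andbT -root_prod_XsubC -rs1E.
have wA : w \in A.
  have : jL w \in [seq jL b | b <- A] by rewrite AE.
  by rewrite mem_map //; apply: fmorph_inj.
have vwE : (mu \o (iO \o jL)) w = (1 / (q ^ s * (q - 1))%:R)%:E.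
  pose y := (qpol q c1O s).[jL w].
  have [t vt] : exists t : rat, mu (iO y) = t%:E by apply: (v_fin hO).
  have yq : y ^+ q.-1 = - jH d.
    have := rs_root _ wrs; rewrite POE hornerM => /eqP.
    rewrite mulf_eq0 (negbTE wlow) /= /fH rmorphD rmorphXn /= map_polyC map_qpol.
    by rewrite hornerD horner_exp hornerC addr_eq0 => /eqP.
  have := vX hO q.-1 vt; rewrite yq vN // => e.
  have {e} [e] : (1%:E : \bar rat) = (q.-1%:R * t)%:E by rewrite -e /= -vd.
  have qn : q.-1%:R != 0 :> rat by rewrite pnatr_eq0 -lt0n -subn1 subn_gt0.
  have tE : t = 1 / (q%:R - 1).
    have -> : q%:R - 1 = q.-1%:R :> rat by rewrite -subn1 natrB // ltnW.
    by apply: (mulfI qn); rewrite -e mulrC divfK.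
  have := hval (iO (jL w)) t vw; rewrite toOb -/y vt tE => /(_ erefl (lexx _)) /= ->.
  congr (_%:E); rewrite natrM natrB ?(ltnW q1) //.
  have qs0 : (q ^ s)%:R != 0 :> rat by rewrite pnatr_eq0 -lt0n qpow_gt0.
  have q10 : q%:R - 1 != 0 :> rat by rewrite subr_eq0 (eqr_nat _ q 1) gtn_eqF.
  by field; rewrite qs0 q10.
have intH x : x \in HL -> x != 0 -> exists k : int, (mu \o (iO \o jL)) x = k%:~R%:E.
  move=> /HLP[h ->] h0; have [b vb] := unrH h; rewrite /= iHLE.
  have b0 : b != 0.
    apply: contraNneq h0 => b0; have : mu (iO (jH h)) = +oo%E.
      by rewrite -[LHS]vb b0 v0.
    by move/(val_eqy val_H) => ->; rewrite rmorph0.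
  by have [/(_ b b0)[k vk] _] := lf_discrete locK; exists k; rewrite -vk vb.
have Hw : <<HL; w>>%VS = {:L}%VS.
  pose E : set L := [set y | y \in <<HL; w>>%VS].
  pose S : set Omegabar := [set iO (jL y) | y in E].
  have divS : divring_closed [in S].
    split; first by apply/set_inP; exists 1; rewrite ?rmorph1 //; apply: mem1v.
      move=> _ _ /set_inP[x xE <-] /set_inP[y yE <-]; apply/set_inP.
      by exists (x - y); rewrite ?rmorphB //; apply: memvB.
    move=> _ _ /set_inP[x xE <-] /set_inP[y yE <-]; apply/set_inP.
    by exists (x / y); rewrite ?fmorph_div //; apply: rpred_div.
  have genS : range (iO \o jH) `|` W `<=` S.
    move=> x [[h _ <-]|Wx].
      exists (iHL h); rewrite /= ?iHLE //; apply: (subvP (subv_adjoin HL w)).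
      by apply/HLP; exists h.
    have [y yx] := range_sub (or_intror Wx); exists y => //.
    have [_ Wgen] := gen_w'; move: Wx; rewrite Wgen => -[b bO bx].
    have [l hl] := rho_lim_ex q1 rhoP val_mu complO vpsi bO vw.
    (* The point x is the sum of a series at w with coefficients in H, and the
       subspace H(w) is closed. *)
    have lx : l = x by rewrite -bx; symmetry; apply: (tps_lim_eval val_mu q1 vw hl).
    have cvl := tps_lim_cvg val_mu q1 vw hl; rewrite lx -yx in cvl.
    apply: (subspace_closed hK cK val_L val_LK
      (s := fun N => \sum_(i < N) iHL (rho b i) * w ^+ (q ^ i))).
      move=> N; apply: rpred_sum => i _; apply: rpredM.
        by apply: (subvP (subv_adjoin HL w)); apply/HLP; exists (rho b i).
      by apply: rpredX; apply: memv_adjoin.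
    move=> B; have [N hN] := cvl B; exists N => i Ni; move: (hN i Ni) => /=.
    congr (_ <= mu _)%E; rewrite !rmorphB !rmorph_sum; congr (_ - _).
    by apply: eq_bigr => j _; rewrite !rmorphM !rmorphXn iHLE.
  apply/vspaceP => y; rewrite memvf.
  have : S (iO (jL y)).
    have : range (iO \o jL) (iO (jL y)) by exists y.
    by rewrite defL; apply: (smallest_sub divS genS).
  by case=> y' y'E /(fmorph_inj iO)/(fmorph_inj jL) <-.
exists HL, A, cO, c1O, rs, rs1; split=> //.
- by split=> //; rewrite AHL; apply/polyOverP => i; rewrite coef_map; apply/HLP; exists fH`_i.
- by rewrite AE.
Qed.

End TorsionField.

(** * The norm congruence *)

Theorem proposition1p3
    (p q : nat) (K : fieldType) (muK : K -> \bar rat)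
    (charK : p \in [pchar K]) (locK : is_local_field muK q)
    (Omega : closedFieldType) (iK : {rmorphism K -> Omega})
    (algOmega : is_algebraic_closure iK)
    (Omegabar : fieldType) (iO : {rmorphism Omega -> Omegabar})
    (mu : Omegabar -> \bar rat) (val_mu : is_valuation mu)
    (mu_muK : forall a : K, mu (iO (iK a)) = muK a)
    (complO : is_completion mu iO)
    (H : fieldExtType K) (jH : {rmorphism H -> Omega})
    (KjH : is_Kembedding iK jH) (unrH : unramified muK (mu \o (iO \o jH)))
    (rho : K -> nat -> H)
    (drin_rho : is_drinfeld_height1 muK q (mu \o (iO \o jH)) rho)
    (m0 : nat) (m0_gt0 : (1 <= m0)%N) (m0_dvd : (m0 %| \dim {:H})%N)
    (eta : K) (mu_eta : muK eta = m0%:R%:E)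
    (n : nat) (n_gt0 : (1 <= n)%N)
    (rho_eta : forall i,
       val_max (mu \o (iO \o jH)) (rho eta i - tps_tau H m0 i))
    (m : nat) (le_nm : (n <= m)%N)
    (L : fieldExtType K) (jL : {rmorphism L -> Omega})
    (KjL : is_Kembedding iK jL)
    (defL : range (iO \o jL) =
       subfield_gen (range (iO \o jH) `|`
         drin_torsion mu q (fun a => (iO \o jH) \o rho a) (eta ^+ m)))
    (vm : L)
    (gen_vm : drin_generator mu q muK (fun a => (iO \o jH) \o rho a)
       (drin_torsion mu q (fun a => (iO \o jH) \o rho a) (eta ^+ m))
       ((iO \o jL) vm))
    (FqL : set L) (resL : residue_subfield (mu \o (iO \o jL)) FqL)
    (u : L) (unit_u : (mu \o (iO \o jL)) u = 0%E)
    (u_near1 :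
       ((Num.max ((n * m0)%:R / q%:R) (1 / (q%:R - 1)) + 1 / (q%:R - 1))%R%:E
         < (mu \o (iO \o jL)) (1 - u)%R)%E)
    (g : nat -> L) (g_FqL : forall i, FqL (g i))
    (g_vm : ps_eval (mu \o (iO \o jL)) g vm = u) :
  val_congr muK ((n + m) * m0)
    (ext_norm u^-1 - 1)
    (ext_trace ((1 - u) / u *
       (1 - ps_eval (mu \o (iO \o jL)) (ps_deriv g) vm / u * vm))).
Proof.
pose s := (m * m0).-1; pose k := (n * m0)%N; pose kap := ((n + m) * m0)%N.
have sM : s.+1 = (m * m0)%N by rewrite prednK // muln_gt0 m0_gt0 (leq_trans n_gt0).
have kapE : kap = (s.+1 + k)%N by rewrite sM /kap mulnDl addnC.
have ks : (k <= s.+1)%N by rewrite sM leq_mul2r le_nm orbT.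
have hK := lf_val locK; have cK := lf_complete locK.
have cmu := complO.1.
have va : muK (eta ^+ m) = s.+1%:R%:E by rewrite (vX hK m mu_eta) -natrM -sM.
have hL : is_valuation (mu \o (iO \o jL)) := valuation_comp (iO \o jL) val_mu.
have vKL := val_LK mu_muK KjL.
have hH : is_valuation (mu \o (iO \o jH)) := valuation_comp (iO \o jH) val_mu.
have vKH := val_HK mu_muK KjH.
have cL := finite_ext_complete hK cK hL vKL.
have hO : is_valuation (mu \o iO) := valuation_comp iO val_mu.
have q1 := residue_order_gt1 locK.
have [qK fermat] := drinfeld_power charK locK hH vKH drin_rho.
have qO : [pchar Omega].-nat q by rewrite (eq_pnat _ (fmorph_pchar iK)).
have qL : [pchar L].-nat q by rewrite (eq_pnat _ (pchar_lalg L)).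
have [pi pi1 _] := drin_unit drin_rho.
have [HL [A [c [c1 [rs [rs1 []]]]]]] := torsion_field charK locK val_mu cmu mu_muK
  KjH unrH drin_rho KjL va defL gen_vm.
set e := (q ^ s * (q - 1))%N.
move=> [intH Hv AH] [uA sA vA vv] [lc urs rsE rsL] [lc1 urs1 rs1E] permA.
have e0 : (0 < e)%N by rewrite muln_gt0 qpow_gt0 // subn_gt0.
have sepL : separable 1 {:L}.
  exact: (totally_ramified_separable hK cK q1 qK fermat pi1 hL vKL resL intH e0 vv
    Hv uA sA vA AH).
have degA : (size A <= adjoin_degree HL vm)%N.
  by rewrite sA; exact: (degree_ge_e hL intH e0 vv).
have [z [f [d [gg [fK finj gK sumE prodE]]]]] :=
  embeddings_grouped iK sepL Hv uA AH vA degA.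
have iso (h : {rmorphism L -> Omega}) : Kmorphism iK h ->
    forall x, mu (iO (h x)) = mu (iO (jL x)).
  move=> hK' x; apply: (embedding_isometric hK cK hL vKL hO (f := h)) => b /=.
  by rewrite hK' mu_muK.
pose t : rat := k%:R / q%:R + 1 / (q%:R - 1).
have q1r : 0 < q%:R - 1 :> rat by rewrite subr_gt0 ltr1n.
have q0r : 0 < q%:R :> rat by rewrite ltr0n ltnW.
have t0 : 0 <= t by rewrite addr_ge0 // divr_ge0 // ltW.
have tu : (t%:E < (mu \o (iO \o jL)) (1 - u)%R)%E.
  by apply: le_lt_trans u_near1; rewrite lee_fin lerD2r le_max lexx.
have resH y : FqL y -> y \in HL.
  exact: (residue_sub hK cK q1 qK fermat hL vKL resL intH e0 vv Hv sA vA AH).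
have [h [W [V [Y [th WE [YO VO WH VH] hV [Wu Tu]]]]]] :=
  approximating_polynomials hL cL q1 qL resL e0 vv unit_u g_FqL g_vm
    kap t0 tu (qpow_gt0 q1 s.+1) (S := HL) resH.
have hk : (q ^ s * (1 + k.+1 * (q - 1)) <= q * h)%N.
  rewrite -(ler_nat rat) [in leRHS]natrM.
  have -> : (q ^ s * (1 + k.+1 * (q - 1)))%:R = q%:R * (t * e%:R) :> rat.
    rewrite /t /e !natrM natrD natrM natrB ?(ltnW q1) // -(natr1 k).
    by rewrite [k%:R]natrM; field; rewrite !gt_eqF.
  by rewrite ler_pM2l // ltW.
pose Tr := (W - 1) * (1 + V).
have mapW : map_poly jL W = 1 + 'X^h * map_poly jL Y.
  by rewrite WE rmorphD rmorph1 rmorphM /= map_polyXn.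
have map_int (B : {poly L}) : B \is a polyOver (vint hL) ->
    map_poly jL B \is a polyOver (vint hO).
  by move=> /polyOverP BO; apply/polyOverP => i; rewrite coef_map; apply: BO.
have hV' x : x \in rs -> vge (mu \o iO) (s.+1 + k)%:R
    ((map_poly jL V).[x] * (1 + 'X^h * map_poly jL Y).[x] -
      x * ((1 + 'X^h * map_poly jL Y)^`()).[x]).
  move=> xrs; have [y yx] := rsL x xrs; rewrite -mapW deriv_map -yx !horner_map.
  rewrite -!rmorphM -rmorphB -kapE; apply: hV.
  have : vge (mu \o iO) (1 / (q ^ s.+1)%:R) x.
    by apply: (qpol_root_ge hO q1 lc); rewrite rsE root_prod_XsubC.
  by rewrite -yx.
have [g1 g2] : vge (mu \o (iO \o jL)) kap%:R
      (\prod_(b <- A) W.[b] - 1 - \sum_(b <- A) Tr.[b]) /\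
    vge (mu \o (iO \o jL)) s.+1%:R (\prod_(b <- A) W.[b] - 1).
  have vpi : (mu \o iO) (iK pi) = 1%:E by rewrite /= mu_muK.
  have := norm_trace_primitive q1 qO vpi lc urs rsE ks hk (map_int _ YO)
    (map_int _ VO) hV' lc1 urs1 rs1E permA.
  rewrite -mapW -kapE !big_map.
  have -> : \prod_(b <- A) (map_poly jL W).[jL b] = jL (\prod_(b <- A) W.[b]).
    by rewrite rmorph_prod; apply: eq_bigr => b _; rewrite horner_map.
  have -> : \sum_(b <- A) ((map_poly jL W - 1) * (1 + map_poly jL V)).[jL b] =
      jL (\sum_(b <- A) Tr.[b]).
    rewrite rmorph_sum; apply: eq_bigr => b _.
    by rewrite -horner_map rmorphM rmorphB rmorphD !rmorph1.
  by rewrite /vge /= !(rmorphB jL) (rmorph1 jL).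
(* The error splits into: the replacement of 1/u and of the argument of the
   trace by values of polynomials; the products of two terms nu - 1, each of
   valuation at least m m0; and the congruence over H, seen through each
   restriction of the embeddings to H. *)
pose y := (1 - u) / u * (1 - ps_eval (mu \o (iO \o jL)) (ps_deriv g) vm / u * vm).
pose nu := \prod_(b <- A) W.[b]; pose tr := \sum_(b <- A) Tr.[b].
have TrH : Tr \is a polyOver HL.
  by apply: rpredM; [apply: rpredB|apply: rpredD]; rewrite ?rpred1.
have geL (b : {rmorphism L -> Omega}) r x : Kmorphism iK b ->
    vge (mu \o (iO \o jL)) r x -> vge (mu \o iO) r (b x).
  by move=> bK; rewrite /vge /= iso.
rewrite /val_congr -mu_muK -/(vge (mu \o iO) kap%:R _) !rmorphB rmorph1.
rewrite (ext_norm_embeddings fK finj) (ext_trace_embeddings fK finj) -/y.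
have -> : \prod_i f i u^-1 - 1 - \sum_i f i y =
    (\prod_i f i u^-1 - \prod_i f i W.[vm]) +
    (\prod_j gg j nu - 1 - \sum_j (gg j nu - 1)) +
    \sum_j gg j (nu - 1 - tr) + \sum_i f i (Tr.[vm] - y).
  rewrite (prodE W WH) -/nu.
  have -> : \sum_i f i (Tr.[vm] - y) = \sum_i f i Tr.[vm] - \sum_i f i y.
    by rewrite -sumrB; apply: eq_bigr => i _; rewrite rmorphB.
  rewrite (sumE Tr TrH) -/tr.
  have -> : \sum_j gg j (nu - 1 - tr) = \sum_j (gg j nu - 1) - \sum_j gg j tr.
    by rewrite -sumrB; apply: eq_bigr => j _; rewrite !rmorphB rmorph1.
  by ring.
have WvO : vge (mu \o (iO \o jL)) 0 W.[vm].
  have -> : W.[vm] = u^-1 - (u^-1 - W.[vm]) by rewrite opprB addrCA subrr addr0.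
  by apply: vgeB; [exact: hL|exact: vge_inv_unit|apply: vgeW Wu].
apply: (vgeD hO); first apply: (vgeD hO); first apply: (vgeD hO).
- apply: (vge_prod_congr hO) => i _; [exact/geL/vge_inv_unit|exact: geL|].
  by rewrite -rmorphB; apply: geL.
- apply: (vge_prod_first_order hO (M := s.+1%:R)) => [//||j _].
    by rewrite -natrD ler_nat kapE leq_add2l.
  by rewrite -(rmorph1 (gg j)) -rmorphB; apply: geL.
- by apply: (vge_sum hO) => j _; apply: geL.
- apply: (vge_sum hO) => i _; apply: geL => //.
  by rewrite (vge_subC hL).
Qed.
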